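(* Let $p,s$ be integers with $s-1>p>2$. If $$\Delta>0,\qquad \Psi(\lambda_1^* )>0\qquad\text{and}\qquad \Psi(\lambda_{2\to1F})\le 0,$$ then there exist constants $0<\lambda_{1\to2}<\lambda_{2\to1}<1$ such that the spherical model with mixture $\xi(x)=\lambda x^p+(1-\lambda)x^s$ is at zero temperature (i) 1-RSB when $\lambda\in[0,\lambda_{1\to2}]\cup[\lambda_{2\to1},1]$; (ii) 2-RSB when $\lambda\in(\lambda_{1\to2},\lambda_{2\to1})$.
   Context: Parisi measure at zero temperature. The spherical model with mixture $\xi$ is the centered Gaussian field $H_N$ on $S_N=\{\sigma\in\mathbb R^N:\sum_i\sigma_i^2=N\}$ with covariance $\mathbb E H_N(\sigma^1)H_N(\sigma^2)=N\xi\big(\tfrac1N\sum_i\sigma^1_i\sigma^2_i\big)$. Let $\mathcal K$ be the set of measures on $[0,1]$ of the form $\nu(dx)=\mathbf 1_{[0,1)}(x)\gamma(x)\,dx+\Delta_0\,\delta_{\{1\}}(dx)$, with $\gamma$ nonnegative, right-continuous and nondecreasing on $[0,1)$ and $\Delta_0>0$. For $\nu\in\mathcal K$ put $$\mathcal Q(\nu)=\frac12\Big(\int_0^1\xi'(x)\,\nu(dx)+\int_0^1\frac{dx}{\nu((x,1])}\Big).$$ The functional $\mathcal Q$ has a unique minimizer $\nu_P(dx)=\gamma_P(x)\mathbf 1_{[0,1)}(x)dx+\Delta_P\delta_{\{1\}}(dx)$ in $\mathcal K$, called the Parisi measure at zero temperature. Let $\rho_P$ be the measure on $[0,1)$ with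 $\rho_P([0,x])=\gamma_P(x)$ for $x\in[0,1)$. For $k\ge0$ the model is $k$-RSB at zero temperature if the support of $\rho_P$ consists of exactly $k$ points of $[0,1)$ (so together with the point $1$ there are $k+1$ points). Quantities. For $\xi(x)=\lambda x^p+(1-\lambda)x^s$ (derivatives in $x$) set $$\Psi(\lambda)=-\frac{\xi'(1)-1}{\xi''(1)}-\log\Big(\frac{\xi''(1)}{\xi'(1)}\Big)+1-\frac{2}{\xi'(1)}+\frac{\xi''(1)}{\xi'(1)^2},$$ $$Q(\lambda)=(s-p)^2(s^2-3s+2+p^2+3ps-3p)\lambda^2-s(s-p)(2s^2-6s+4-p^2+3ps-3p)\lambda+s^2(s-1)(s-2),$$ $$\Delta=s^2-6(p-1)s+(p-1)(p+7),$$ $$S(\lambda)=s^3(s-1)^2(s-2)(1-\lambda)^2+p^3(p-1)^2(p-2)\lambda^2-2p(p-1)s(s-1)\big[(p-2)(p-3)+(s-2)(s-3)-3(p-2)(s-2)\big]\lambda(1-\lambda).$$ If $\Delta>0$, $Q$ has two real roots $\lambda_1^*<\lambda_2^*$, and $S$ has two real roots $\lambda_{2\to1F}<\lambda'_{2\to1F}$. *)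

(* Defs.v *)
From HB Require Import structures.
From mathcomp Require Import all_boot all_order all_algebra.
From mathcomp Require Import all_classical all_reals all_analysis.

Set Implicit Arguments.
Unset Strict Implicit.
Unset Printing Implicit Defensive.

Import Order.TTheory GRing.Theory Num.Theory.
Import numFieldNormedType.Exports.

Local Open Scope classical_set_scope.
Local Open Scope ring_scope.

Section ParisiMeasure.
Context {R : realType}.

(* Measures on [0,1] (or [0,1[) are represented by Borel measures on R
   vanishing outside that interval. *)
Notation borel_measure := {measure set (measurableTypeR R) -> \bar R}.

(* Only the values of gamma on [0,1[ matter. *)
Definition admissible_density (gamma : R -> R) : Prop :=
  [/\ forall x : R, x \in `[0, 1[ -> 0 <= gamma x,
      {in `[0, 1[ &, {homo gamma : x y / x <= y}} &
      forall x : R, x \in `[0, 1[ -> gamma y @[y --> x^'+] --> gamma x].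

(* nu(dx) = 1_{[0,1[}(x) gamma(x) dx + Delta delta_1(dx) *)
Definition has_parisi_form (gamma : R -> R) (Delta : R) (nu : borel_measure)
    : Prop :=
  [/\ admissible_density gamma, 0 < Delta &
      forall A : set (measurableTypeR R), measurable A ->
        nu A = (\int[lebesgue_measure]_(x in A `&` `[0%R, 1%R[) (gamma x)%:E
                + Delta%:E * \d_(1%R : measurableTypeR R) A)%E].

Definition class_K (nu : borel_measure) : Prop :=
  exists (gamma : R -> R) (Delta : R), has_parisi_form gamma Delta nu.

(* The value may be +oo (when gamma is not integrable near 1). *)
Definition parisi_functional (xi : R -> R) (nu : borel_measure) : \bar R :=
  ((2^-1)%:E *
   (\int[nu]_(x in `[0%R, 1%R]) (derive1 xi x)%:E
    + \int[lebesgue_measure]_(x in `[0%R, 1%R])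
        (nu [set` `]x : R, 1%R]])^-1))%E.

(* Measures are compared on measurable sets only, since the underlying set
   functions are unconstrained elsewhere. *)
Definition is_parisi_measure (xi : R -> R) (nu : borel_measure) : Prop :=
  [/\ class_K nu,
      forall mu : borel_measure, class_K mu ->
        (parisi_functional xi nu <= parisi_functional xi mu)%E &
      forall mu : borel_measure, class_K mu ->
        parisi_functional xi mu = parisi_functional xi nu ->
        forall A : set (measurableTypeR R), measurable A -> mu A = nu A].

(* rho need not be finite: gamma may be unbounded near 1. *)
Definition has_cdf_on_01 (rho : borel_measure) (gamma : R -> R) : Prop :=
  rho (~` [set` `[0%R, 1%R[]) = 0%E /\
  forall x : R, x \in `[0, 1[ -> rho [set` `[0, x]] = (gamma x)%:E.

(* Topological support, relative to the space [0,1[. *)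
Definition support_on_01 (rho : borel_measure) : set R :=
  [set x | (x \in `[0, 1[) /\
           forall U : set R, open U -> U x ->
             (0 < rho (U `&` [set` `[0%R, 1%R[]))%E].

Definition is_kRSB (xi : R -> R) (k : nat) : Prop :=
  exists (nuP : borel_measure) (gammaP : R -> R) (DeltaP : R)
         (rhoP : borel_measure),
    [/\ is_parisi_measure xi nuP, has_parisi_form gammaP DeltaP nuP,
        has_cdf_on_01 rhoP gammaP & (support_on_01 rhoP #= `I_k)%card].

End ParisiMeasure.

Section Quantities.
Context {R : realType}.
Implicit Types lam : R.

Definition mixture (p s : nat) lam (x : R) : R :=
  lam * x ^+ p + (1 - lam) * x ^+ s.

Definition Psi (p s : nat) lam : R :=
  let xi1 := derive1 (mixture p s lam) 1 in
  let xi2 := derive1n 2 (mixture p s lam) 1 in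
  - ((xi1 - 1) / xi2) - ln (xi2 / xi1) + 1 - 2 / xi1 + xi2 / xi1 ^+ 2.

Definition Qpol (p s : R) lam : R :=
  (s - p) ^+ 2 * (s ^+ 2 - 3 * s + 2 + p ^+ 2 + 3 * p * s - 3 * p) * lam ^+ 2
  - s * (s - p) * (2 * s ^+ 2 - 6 * s + 4 - p ^+ 2 + 3 * p * s - 3 * p) * lam
  + s ^+ 2 * (s - 1) * (s - 2).

Definition Delta_ps (p s : R) : R :=
  s ^+ 2 - 6 * (p - 1) * s + (p - 1) * (p + 7).

Definition Spol (p s : R) lam : R :=
  s ^+ 3 * (s - 1) ^+ 2 * (s - 2) * (1 - lam) ^+ 2
  + p ^+ 3 * (p - 1) ^+ 2 * (p - 2) * lam ^+ 2
  - 2 * p * (p - 1) * s * (s - 1)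
    * ((p - 2) * (p - 3) + (s - 2) * (s - 3) - 3 * (p - 2) * (s - 2))
    * lam * (1 - lam).

Definition two_real_roots (f : R -> R) (a b : R) : Prop :=
  a < b /\ forall x : R, f x = 0 <-> x = a \/ x = b.

End Quantities.

(* Main.v *)
Require Import Defs.
From HB Require Import structures.
From mathcomp Require Import all_boot all_order all_algebra.
From mathcomp Require Import finmap.
From mathcomp Require Import all_classical all_reals all_analysis.
From mathcomp Require Import measurable_realfun.
From mathcomp Require Import ring lra.

Set Implicit Arguments.
Unset Strict Implicit.
Unset Printing Implicit Defensive.

Import Order.TTheory GRing.Theory Num.Theory.
Import numFieldNormedType.Exports.

Local Open Scope classical_set_scope.
Local Open Scope ring_scope.

(** Why the theorem holds. Write R u = - ln (1 - u) - u, which is logser below.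

The minimizer is found by duality. Let q be the tail x -> nu (]x, 1]) of a candidate nu
and P the solution of P'' = q^(-2) with P 0 = 0 and P' 0 = 0. If P' 1 = xi' 1 and P >= xi
on [0, 1] with equality at 1, then against every competitor mu, whose density is
nondecreasing, the integral of xi' is at least that of P', which is the integral of the tail
of mu times q^(-2). The remaining convex problem is solved pointwise by
t / q^2 + 1 / t >= 2 / q. This gives parisi_measure_criterion and, for densities with at most
one interior jump, step_kRSB: what is left is to exhibit P above the mixture, touching it
where the density jumps.

One slope. When q is linear, P x = R (k x) / R k, and P' 1 = xi' 1 determines k through
cratio k = xi' 1, where cratio u = u R' u / R u is the local exponent of R. A weight fails
when this P dips below the mixture. Everything is governed by the sign of
curv = (theta - p) (theta - s) R, with theta = u d/du, which is positive, negative, positive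
on three consecutive intervals separated by kb < ka (curv_pattern). If k <= kb there is no
failure, if kb < k <= ka there is one, and beyond ka failure is inherited by smaller k; since
k decreases with the weight, the failing weights form an interval from some lam12 > 0 to the
weight crit_weight at which k = kb (failure_interval).

Two slopes. For a failing weight, left pieces tangent to the mixture form a one-parameter
family, and the slope xi' 1 determines the continuation beyond the contact point. The
end value P 1 exceeds or equals 1 at one end of a suitable part of this family and is below 1
at the other, so some member satisfies P 1 = 1 (two_step_of_failure). It lies above the mixture
because xi''^(-1/2) minus a linear function cannot change sign too often: the second
derivative of xi''^(-1/2) at x has the sign of Spol at the share of x^p in the
mixture at x (right_arc_lt1, right_arc_ge).

The hypotheses enter as follows. The sign of Psi is opposite to that of curv k (Psi_gt0), so
Psi lam1 > 0 puts k strictly between kb and ka for the weight lam1, and Psi lam21F <= 0 gives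
crit_weight <= lam21F, which makes Spol positive on all weights below crit_weight. The
condition on Delta_ps locates the roots, 0 < lam1 < 1 and lam1 < lam21F
(Q_root_position). *)

(** * Integration against measures of the prescribed form *)

Section FormIntegral.
Context {R : realType}.
Notation leb := (@lebesgue_measure R).
Notation borel_measure := {measure set (measurableTypeR R) -> \bar R}.

Lemma nondecreasing_measurable_itv (I : interval R) (f : R -> R) :
  {in I &, {homo f : x y / x <= y}} -> measurable_fun [set` I] f.
Proof.
move=> f_nd.
apply: (measurability (@RGenCInfty.G R)) => [|/= _ [_] [r] -> <-].
  exact: RGenCInfty.measurableE.
apply: is_interval_measurable => s t/= [Is]; rewrite in_itv/= andbT => fs.
move=> [It]; rewrite in_itv/= andbT => ft u /andP[su ut].
have Iu : u \in I.
  have := @interval_is_interval _ I s t Is It u; rewrite su ut; exact.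
by split => //; rewrite in_itv/= andbT (le_trans fs)// f_nd.
Qed.

Import HBNNSimple.

(** By definition of the form both sides agree on indicators, hence on simple functions, and
    both pass to monotone limits. *)
Lemma parisi_form_integral (gamma : R -> R) (Delta : R) (nu : borel_measure)
    (h : measurableTypeR R -> \bar R) :
  has_parisi_form gamma Delta nu ->
  measurable_fun setT h -> (forall x, 0 <= h x)%E ->
  (\int[nu]_x h x = \int[leb]_(x in `[0%R, 1%R[) (h x * (gamma x)%:E)
                    + Delta%:E * h 1%R)%E.
Proof.
move=> [[g0 gnd _] D0 nuE] mh h0.
pose T := measurableTypeR R.
have mg : measurable_fun (`[0%R, 1%R[ : set T) gamma.
  exact: nondecreasing_measurable_itv.
have mI : measurable (`[0%R, 1%R[ : set T) by [].
have sfunE (f : {nnsfun T >-> R}) :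
    (\int[nu]_x (f x)%:E = \int[leb]_(x in `[0%R, 1%R[) ((f x)%:E * (gamma x)%:E)
                    + Delta%:E * (f 1%R)%:E)%E.
  have fE x : ((f x)%:E = \sum_(r \in range f) (r * \1_(f @^-1` [set r]) x)%:E)%E.
    by rewrite {1}fimfunE -fsumEFin.
  under eq_integral do rewrite fE.
  rewrite ge0_integral_fsum//; last 2 first.
    - by move=> r; exact/measurable_EFinP/measurableT_comp.
    - by move=> r x _; rewrite EFinM nnfun_muleindic_ge0.
  under [X in _ = (X + _)%E]eq_integral => x /[!inE] xI.
    rewrite fE ge0_mule_fsuml; last first.
      by move=> r; rewrite EFinM nnfun_muleindic_ge0.
    over.
  rewrite [X in _ = (X + _)%E]ge0_integral_fsum//; last 2 first.
    - move=> r; apply: emeasurable_funM; last exact/measurable_EFinP.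
      by apply/measurable_funTS/measurable_EFinP/measurableT_comp.
    - move=> r x xI; rewrite mule_ge0 ?lee_fin ?g0//.
      by rewrite -lee_fin EFinM nnfun_muleindic_ge0.
  rewrite fE ge0_mule_fsumr; last first.
    by move=> r; rewrite EFinM nnfun_muleindic_ge0.
  rewrite -fsbig_split//=; apply: eq_fsbigr => r /[!inE] -[y _ ry].
  have r0 : 0 <= r by rewrite -ry.
  have mr : measurable (f @^-1` [set r]) by [].
  under eq_integral do rewrite EFinM.
  rewrite ge0_integralZl//; last exact/measurable_EFinP.
  rewrite integral_indic// setIT nuE// ge0_muleDr//; last 2 first.
    - by apply: integral_ge0 => x [_ xI]; rewrite lee_fin g0.
    - by rewrite mule_ge0// lee_fin ltW.
  congr (_ + _)%E; last by rewrite muleCA EFinM.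
  rewrite integral_mkcondl -ge0_integralZl//; last 2 first.
    - apply/(measurable_restrict _ mr mI).
      by apply/measurable_EFinP; apply: measurable_funS mg.
    - move=> x xI; rewrite patchE; case: ifP => // _; rewrite lee_fin g0//.
  apply: eq_integral => x xI; rewrite patchE indicE EFinM -muleA.
  by case: ifP => xr; rewrite ?mul1e ?mul0e.
pose f_ := nnsfun_approx measurableT mh.
have flim x : (h x = limn (fun n => (f_ n x)%:E))%E.
  by apply/esym/cvg_lim => //; exact: cvg_nnsfun_approx.
have fnd x : {homo (fun n => (f_ n x)%:E) : m n / (m <= n)%N >-> (m <= n)%E}.
  by move=> a b ab; rewrite lee_fin//; exact/lefP/nd_nnsfun_approx.
transitivity (limn (fun n => \int[nu]_x (f_ n x)%:E))%E.
  rewrite -monotone_convergence//=.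
  - by apply: eq_integral => x _; exact: flim.
  - by move=> n; exact/measurable_EFinP.
  - by move=> n x _; rewrite lee_fin.
under eq_fun do rewrite sfunE.
have c1 : cvgn (fun n => (f_ n 1)%:E) by exact/ereal_nondecreasing_is_cvgn.
have iG n : measurable_fun (`[0%R, 1%R[ : set T)
    (fun x => (f_ n x)%:E * (gamma x)%:E)%E.
  apply: emeasurable_funM; last exact/measurable_EFinP.
  exact/measurable_funTS/measurable_EFinP.
have pG n x : `[0%R, 1%R[%classic x -> (0 <= (f_ n x)%:E * (gamma x)%:E)%E.
  by move=> xI; rewrite mule_ge0 ?lee_fin ?g0.
have ndG x : `[0%R, 1%R[%classic x ->
   {homo (fun n => ((f_ n x)%:E * (gamma x)%:E)%E) : m n / (m <= n)%N >-> (m <= n)%E}.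
  move=> xI a b ab; rewrite lee_wpmul2r//; first by rewrite lee_fin g0.
  exact: fnd.
have ndI : {homo (fun n => (\int[leb]_(x in `[0%R, 1%R[)
    ((f_ n x)%:E * (gamma x)%:E))%E) : m n / (m <= n)%N >-> (m <= n)%E}.
  move=> a b ab; apply: ge0_le_integral => //.
  - by move=> x xI; exact: (pG a).
  - by move=> x xI; exact: (ndG x xI).
rewrite limeD; last 3 first.
- exact: ereal_nondecreasing_is_cvgn.
- exact: is_cvgeMl.
- apply: ge0_adde_def; rewrite inE.
    apply: lime_ge; first exact: ereal_nondecreasing_is_cvgn.
    by apply: nearW => n; apply: integral_ge0 => x; exact: (pG n).
  apply: lime_ge; first exact: is_cvgeMl.
  by apply: nearW => n; rewrite mule_ge0 ?lee_fin// ltW.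
congr (_ + _)%E; last first.
  by rewrite limeMl// -flim.
rewrite -monotone_convergence//.
apply: eq_integral => x /[!inE] xI.
rewrite limeMr//; last exact/ereal_nondecreasing_is_cvgn.
by rewrite -flim.
Qed.

End FormIntegral.

Section LayerCake.
Context {R : realType}.
Notation leb := (@lebesgue_measure R).
Notation T := (measurableTypeR R).
Notation borel_measure := {measure set (measurableTypeR R) -> \bar R}.
Notation I01 := ([set` `[(0:R), (1:R)[] : set (measurableTypeR R)).
Implicit Types (gamma : R -> R) (g : T -> \bar R).

Lemma measurable_density gamma : {in `[0, 1[ &, {homo gamma : x y / x <= y}} ->
  measurable_fun setT (gamma \_ I01).
Proof.
move=> gnd; have mI : measurable I01 by [].
exact: (measurable_restrictT gamma mI).1 (nondecreasing_measurable_itv gnd).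
Qed.

(** The set where a nondecreasing density exceeds t is an interval with right end 1; whether
    it contains its left end y is invisible to Lebesgue integrals. *)
Lemma integral_upper_section gamma t :
  {in `[0, 1[ &, {homo gamma : x y / x <= y}} ->
  exists2 y : R, 0 <= y & forall g, measurable_fun setT g ->
    (\int[leb]_(x in [set x | I01 x /\ (t < gamma x)%R]) g x
     = \int[leb]_(x in [set` `[y, 1%R[]) g x)%E.
Proof.
move=> gnd; set B := [set x | _].
have [B0|/set0P[b0 Bb0]] := eqVneq B set0.
  by exists 1 => // g mg; rewrite B0 set_itv_ge// bnd_simp ltxx.
have Bup x z : B x -> x <= z -> z < 1 -> B z.
  move=> [/=]; rewrite !in_itv/= => /andP[x0 x1] tx xz z1; split => /=.
    by rewrite in_itv/= z1 (le_trans x0).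
  by rewrite (lt_le_trans tx)// gnd// in_itv/= ?x0 ?x1 ?z1 ?(le_trans x0 xz).
have hB : has_inf B.
  split; first by exists b0.
  by exists 0 => x [/=]; rewrite in_itv/= => /andP[].
have y0 : 0 <= inf B.
  by apply: lb_le_inf; [exists b0|move=> x [/=]; rewrite in_itv/= => /andP[]].
exists (inf B) => //.
have [yB|yB] := pselect (B (inf B)).
  move=> g mg; suff BE : B = [set` `[inf B, 1%R[] by rewrite {1}BE.
  apply/seteqP; split=> x /=.
    move=> Bx; rewrite in_itv/= ge_inf//=; last by case: hB.
    by case: Bx => /=; rewrite in_itv/= => /andP[].
  by rewrite in_itv/= => /andP[yx x1]; exact: (Bup _ _ yB yx x1).
move=> g mg; rewrite -integral_itv_obnd_cbnd//; last exact: measurable_funTS.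
suff BE : B = [set` `]inf B, 1%R[] by rewrite {1}BE.
apply/seteqP; split=> x /=.
  move=> Bx; rewrite in_itv/= lt_neqAle ge_inf//=; last by case: hB.
  rewrite andbT; apply/andP; split; last first.
    by case: Bx => /=; rewrite in_itv/= => /andP[].
  by apply/negP => /eqP yx; apply: yB; rewrite yx.
rewrite in_itv/= => /andP[yx x1].
have [z Bz zx] := inf_lt hB.1 yx.
exact: (Bup _ _ Bz (ltW zx) x1).
Qed.

(** Tonelli's theorem on the region below the graph of gamma. Measurability in t is recorded
    because comparing two such integrals requires it. *)
Lemma layer_cake gamma g :
  (forall x, x \in `[0, 1[ -> 0 <= gamma x) ->
  {in `[0, 1[ &, {homo gamma : x y / x <= y}} ->
  measurable_fun setT g -> (forall x, 0 <= g x)%E ->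
  (\int[leb]_(x in I01) (g x * (gamma x)%:E) =
   \int[leb]_(t in [set` `[0%R, +oo[])
     \int[leb]_(x in [set x | I01 x /\ (t < gamma x)%R]) g x)%E
  /\ measurable_fun ([set` `[0%R, +oo[] : set T) (fun t : T =>
     \int[leb]_(x in [set x | I01 x /\ (t < gamma x)%R]) g x)%E.
Proof.
move=> g0 gnd mg gg0.
pose gam := gamma \_ I01.
have mgam : measurable_fun setT gam by exact: measurable_density.
pose A : set (T * T) := [set z | (0 <= z.2)%R /\ (z.2 < gam z.1)%R].
have mA : measurable A.
  apply: (@measurableI _ _ [set z : T * T | (0 <= z.2)%R] [set z | (z.2 < gam z.1)%R]).
    rewrite [X in measurable X](_ : _ = setT `*` [set` `[0%R, +oo[]); last first.
      by apply/seteqP; split=> -[x t] /=; rewrite in_itv/= andbT => // -[].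
    exact: measurableX.
  have := @measurable_fun_ltr _ (T * T)%type R setT snd (gam \o fst) measurable_snd
    (measurableT_comp mgam measurable_fst) measurableT.
  move=> /(_ [set true]) /=; rewrite setTI => h.
  rewrite (_ : [set z : T * T | _] = (fun x : T * T => x.2 < (gam \o fst) x) @^-1` [set true])//.
  exact: h.
pose f (z : T * T) := (g z.1 * (\1_A z)%:E)%E.
have mf : measurable_fun setT f.
  apply: emeasurable_funM; first exact: measurableT_comp.
  exact/measurable_EFinP.
have f0 z : (0 <= f z)%E by rewrite mule_ge0// lee_fin.
have := @fubini_tonelli _ _ _ _ _ leb leb f mf f0.
have -> : (\int[leb]_x \int[leb]_y f (x, y) =
           \int[leb]_(x in I01) (g x * (gamma x)%:E))%E.
  rewrite [RHS]integral_mkcond; apply: eq_integral => x _; rewrite patchE.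
  rewrite [LHS](_ : _ = \int[leb]_y (g x * (\1_A (x, y))%:E))%E//.
  rewrite ge0_integralZl//; last first.
    apply/measurable_EFinP.
    exact: measurableT_comp (measurable_indic mA) (pair1_measurable x).
  have -> : (\int[leb]_y (\1_A (x, y))%:E = (gam x)%:E)%E.
    have -> : (fun y : T => (\1_A (x, y) : R)%:E) = (fun y => (\1_(`[0%R, gam x[ : set T) y)%:E).
      apply/funext => y; rewrite !indicE; congr ((nat_of_bool _)%:R%:E).
      by apply/idP/idP; rewrite !inE /A /= in_itv/=; [move=> [-> ->]|move=> /andP[]].
    rewrite integral_indic// setIT.
    apply: etrans; first exact: (lebesgue_measure_itv `[(0 : R), gam x[).
    rewrite /= lte_fin.
    case: ltP => [_|h]; first by rewrite -EFinB subr0.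
    apply/eqP; rewrite eqe eq_sym eq_le h/= /gam patchE; case: ifPn => // /[!inE] xI.
    exact: g0.
  rewrite /gam patchE; case: ifPn => // _; exact: mule0.
have GE t : (0 <= t)%R -> (\int[leb]_x f (x, t) =
    \int[leb]_(x in [set x | I01 x /\ (t < gamma x)%R]) g x)%E; last first.
  move=> ->; split.
    rewrite [RHS]integral_mkcond; apply: eq_integral => t _; rewrite patchE.
    case: ifPn => [|tI]; last first.
      apply: integral0_eq => x _; rewrite /f indicE memNset ?mule0//.
      by move=> [/= t0 _]; move: tI; rewrite notin_setE/= in_itv/= t0.
    by rewrite inE /= in_itv/= andbT; exact: GE.
  have mG := @measurable_fun_fubini_tonelli_G _ _ _ _ _ leb f mf f0.
  apply: (eq_measurable_fun (fubini_G leb f)); last exact: measurable_funTS.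
  by move=> t; rewrite inE /= in_itv/= andbT => t0; rewrite -GE.
move=> t0.
rewrite [RHS]integral_mkcond; apply: eq_integral => x _; rewrite patchE /f indicE.
case: ifPn => [|xB].
  rewrite inE /= => -[xI tx]; rewrite mem_set ?mule1// /A/=; split => //.
  by rewrite /gam patchE mem_set.
rewrite memNset ?mule0// => -[/= _]; rewrite /gam patchE.
case: ifPn => [xI tg|_ tlt0]; last by move: (le_lt_trans t0 tlt0); rewrite ltxx.
by move: xB; rewrite notin_setE; apply; rewrite inE in xI.
Qed.

(** A nondecreasing density is a superposition of indicators of intervals [y, 1[, so domination
    on these intervals suffices. *)
Lemma layer_cake_le gamma g1 g2 :
  (forall x, x \in `[0, 1[ -> 0 <= gamma x) ->
  {in `[0, 1[ &, {homo gamma : x y / x <= y}} ->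
  measurable_fun setT g1 -> (forall x, 0 <= g1 x)%E ->
  measurable_fun setT g2 -> (forall x, 0 <= g2 x)%E ->
  (forall y : R, (0 <= y)%R -> \int[leb]_(x in [set` `[y, 1%R[]) g1 x
                 <= \int[leb]_(x in [set` `[y, 1%R[]) g2 x)%E ->
  (\int[leb]_(x in I01) (g1 x * (gamma x)%:E) <=
   \int[leb]_(x in I01) (g2 x * (gamma x)%:E))%E.
Proof.
move=> g0 gnd mg1 g10 mg2 g20 H.
have [-> m1] := layer_cake g0 gnd mg1 g10.
have [-> m2] := layer_cake g0 gnd mg2 g20.
apply: ge0_le_integral => //.
  by move=> t _; exact: integral_ge0.
move=> t _.
have [y y0 E] := integral_upper_section t gnd.
by rewrite !E// H.
Qed.

End LayerCake.

Section Tails.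
Context {R : realType}.
Notation leb := (@lebesgue_measure R).
Notation T := (measurableTypeR R).
Notation borel_measure := {measure set (measurableTypeR R) -> \bar R}.
Notation I01 := ([set` `[(0:R), (1:R)[] : set (measurableTypeR R)).
Implicit Types (gamma : R -> R) (g : T -> \bar R) (nu mu : borel_measure).

Lemma nondecreasing_emeasurable_itv (I : interval R) (f : R -> \bar R) :
  {in I &, {homo f : x y / (x <= y)%R >-> (x <= y)%E}} ->
  measurable_fun [set` I] f.
Proof.
move=> f_nd.
apply: (measurability (@ErealGenCInfty.G R)) => [|/= _ [_] [r] -> <-].
  exact: ErealGenCInfty.measurableE.
apply: is_interval_measurable => s t/= [Is]; rewrite in_itv/= andbT => fs.
move=> [It]; rewrite in_itv/= andbT => ft u /andP[su ut].
have Iu : u \in I.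
  have := @interval_is_interval _ I s t Is It u; rewrite su ut; exact.
by split => //; rewrite in_itv/= andbT (le_trans fs)// f_nd.
Qed.

Lemma tail_mass gamma (Delta : R) nu (x : R) : has_parisi_form gamma Delta nu ->
  0 <= x < 1 ->
  nu [set` `]x, 1]] = (\int[leb]_(t in [set` `]x, 1%R[]) (gamma t)%:E + Delta%:E)%E.
Proof.
move=> [_ _ nuE] /andP[x0 x1]; rewrite nuE//.
rewrite diracE mem_set/= ?in_itv/= ?x1 ?lexx// mule1; congr (_ + _)%E.
congr (integral _ _ _).
apply/seteqP; split => t /=; rewrite !in_itv/=.
  by move=> [/andP[-> _] /andP[_ ->]].
by move=> /andP[xt t1]; rewrite xt t1 (ltW t1) (le_trans x0 (ltW xt)).
Qed.

(** Tonelli's theorem on the triangle x < t. It turns an integral against the tail of nu, the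
    only way nu enters the second term of the functional, into one against nu. *)
Lemma tail_tonelli gamma (Delta : R) nu g :
  has_parisi_form gamma Delta nu ->
  measurable_fun setT g -> (forall x, 0 <= g x)%E ->
  (\int[leb]_(x in I01) (nu [set` `]x, 1%R]] * g x) =
   \int[leb]_(t in I01) ((\int[leb]_(x in [set` `[0%R, t[]) g x) * (gamma t)%:E)
   + Delta%:E * \int[leb]_(x in I01) g x)%E
  /\ measurable_fun I01 (fun t : T => \int[leb]_(x in [set` `[0%R, t[]) g x)%E.
Proof.
move=> nuf mg g0; have [[ga0 gnd _] D0 _] := nuf.
have mP : measurable_fun I01 (fun t : T => \int[leb]_(x in [set` `[0%R, t[]) g x)%E.
  apply: nondecreasing_emeasurable_itv => s t _ _ st.
  apply: ge0_subset_integral => //; first exact: measurable_funTS.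
  by move=> x /=; rewrite !in_itv/= => /andP[-> /lt_le_trans]; apply.
split=> //.
pose gam := gamma \_ I01.
have mgam : measurable_fun setT gam by exact: measurable_density.
have gam0 t : 0 <= gam t.
  by rewrite /gam patchE; case: ifPn => // /[!inE]; exact: ga0.
pose A : set (T * T) := [set z | (0 <= z.1)%R /\ (z.1 < z.2)%R].
have mA : measurable A.
  apply: (@measurableI _ _ [set z : T * T | (0 <= z.1)%R] [set z | (z.1 < z.2)%R]).
    rewrite [X in measurable X](_ : _ = [set` `[0%R, +oo[] `*` setT); last first.
      by apply/seteqP; split=> -[x t] /=; rewrite in_itv/= andbT => // -[].
    exact: measurableX.
  have := @measurable_fun_ltr _ (T * T)%type R setT fst snd measurable_fst
    measurable_snd measurableT.
  move=> /(_ [set true]) /=; rewrite setTI => h.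
  by rewrite (_ : [set z : T * T | _] = (fun x : T * T => x.1 < x.2) @^-1` [set true])//; exact: h.
pose f (z : T * T) := (g z.1 * (\1_A z * gam z.2)%:E)%E.
have mf : measurable_fun setT f.
  apply: emeasurable_funM; first exact: measurableT_comp.
  apply/measurable_EFinP; apply: measurable_funM => //.
  exact: measurableT_comp.
have f0 z : (0 <= f z)%E by rewrite mule_ge0// lee_fin mulr_ge0.
have mF := @measurable_fun_fubini_tonelli_F _ _ _ _ _ leb f mf f0.
have FE x : x \in I01 ->
    (fubini_F leb f x = g x * \int[leb]_(t in [set` `]x, 1%R[]) (gamma t)%:E)%E.
  rewrite inE /= in_itv/= => /andP[x0 x1].
  rewrite /fubini_F [LHS](_ : _ = \int[leb]_y (g x * (\1_A (x, y) * gam y)%:E))%E//.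
  rewrite ge0_integralZl//; last 2 first.
    - apply/measurable_EFinP/measurable_funM => //.
      exact: measurableT_comp (measurable_indic mA) (pair1_measurable x).
    - by move=> y _; rewrite lee_fin mulr_ge0.
  congr (_ * _)%E; rewrite [RHS]integral_mkcond; apply: eq_integral => t _.
  rewrite patchE indicE /gam patchE.
  case: (boolP (t \in [set` `]x, 1%R[])) => tI.
    move: tI; rewrite inE/= in_itv/= => /andP[xt t1].
    have -> : (x, t) \in A by rewrite inE; split.
    have -> : t \in I01 by rewrite inE/= in_itv/= t1 (le_trans x0 (ltW xt)).
    by rewrite mul1r.
  case: (boolP (t \in I01)) => [|_]; last by rewrite mulr0.
  rewrite inE/= in_itv/= => /andP[t0 t1].
  rewrite memNset ?mul0r// => -[/= _ xt].
  by move: tI; rewrite notin_setE/= in_itv/= xt t1.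
have tail0 x : x \in I01 -> (0 <= \int[leb]_(t in [set` `]x, 1%R[]) (gamma t)%:E)%E.
  rewrite inE /= in_itv/= => /andP[x0 x1].
  apply: integral_ge0 => t /=; rewrite in_itv/= => /andP[xt t1].
  by rewrite lee_fin ga0// in_itv/= t1 (le_trans x0 (ltW xt)).
transitivity (\int[leb]_(x in I01) (fubini_F leb f x + Delta%:E * g x))%E.
  apply: eq_integral => x xI; rewrite FE// (tail_mass nuf); last first.
    by move: xI; rewrite inE/= in_itv.
  by rewrite ge0_muleDl ?lee_fin ?(ltW D0) ?tail0// muleC.
rewrite ge0_integralD//; last 4 first.
- by move=> x _; exact: integral_ge0.
- exact: measurable_funTS.
- by move=> x _; rewrite mule_ge0 ?lee_fin ?(ltW D0).
- by apply: measurable_funeM; exact: measurable_funTS.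
congr (_ + _)%E; last first.
  by rewrite ge0_integralZl ?lee_fin ?(ltW D0)//; exact: measurable_funTS.
have F0 x : x \notin I01 -> fubini_F leb f x = 0%E.
  move=> xI; apply: integral0_eq => t _; rewrite /f/= indicE /gam patchE.
  case: (boolP (t \in I01)) => [|_]; last by rewrite mulr0 mule0.
  rewrite inE/= in_itv/= => /andP[t0 t1].
  rewrite memNset ?mul0r ?mule0// => -[/= x0 xt].
  by move: xI; rewrite notin_setE/= in_itv/= x0 (lt_trans xt t1).
transitivity (\int[leb]_x (fubini_F leb f x))%E.
  rewrite integral_mkcond; apply: eq_integral => x _; rewrite patchE.
  by case: ifPn => // /F0 ->.
have -> := @fubini_tonelli _ _ _ _ _ leb leb f mf f0.
rewrite [RHS]integral_mkcond; apply: eq_integral => t _; rewrite patchE.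
case: ifPn => tI; last first.
  by apply: integral0_eq => x _; rewrite /f/= /gam patchE (negPf tI) mulr0 mule0.
rewrite -ge0_integralZr//; last 2 first.
- exact: measurable_funTS.
- by move: tI; rewrite inE lee_fin; exact: ga0.
rewrite [RHS]integral_mkcond; apply: eq_integral => x _; rewrite patchE.
rewrite /f /= indicE /gam patchE tI.
case: (boolP (x \in [set` `[0%R, t[])); rewrite ?inE ?notin_setE /= in_itv/= => h.
  have -> : (x, t) \in A by rewrite inE; case/andP: h.
  by rewrite mul1r.
by rewrite memNset ?mul0r ?mule0// => -[/= x0 xt]; apply: h; rewrite x0.
Qed.

End Tails.

(** * A sufficient condition for the minimizer *)

Section TailsDetermine.
Context {R : realType}.
Notation leb := (@lebesgue_measure R).
Notation T := (measurableTypeR R).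
Notation borel_measure := {measure set (measurableTypeR R) -> \bar R}.
Notation I01 := ([set` `[(0:R), (1:R)[] : set (measurableTypeR R)).

(** Rays generate the Borel sets, whereas tails are only considered from points of [0, 1[;
    there is no mass elsewhere. *)
Lemma ray_mass gamma (Delta : R) (nu : borel_measure) (x : R) :
  has_parisi_form gamma Delta nu ->
  nu [set` `]x, +oo[] = nu [set` `]Num.max 0 x, 1]].
Proof.
move=> [[ga0 gnd _] D0 nuE]; rewrite !nuE//.
have mg : measurable_fun I01 (fun t : T => (gamma t)%:E).
  apply/measurable_EFinP.
  exact: (nondecreasing_measurable_itv gnd).
congr (_ + _)%E.
  have [x0|x0] := leP x 0.
    have [xl|xg] := ltP x 0.
      rewrite [X in integral _ X _](_ : _ = I01); last first.
        apply/seteqP; split => t /=; rewrite !in_itv/= andbT; first by move=> [].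
        by move=> /andP[t0 t1]; split; [exact: lt_le_trans t0|rewrite t0].
      rewrite -integral_itv_obnd_cbnd; last first.
        by apply: measurable_funS mg => // t /=; rewrite !in_itv/= => /andP[/ltW -> ->].
      congr (integral _ _ _); apply/seteqP; split => t /=; rewrite !in_itv/=.
        by move=> /andP[t0 t1]; rewrite t0 t1 (ltW t0) (ltW t1).
      by move=> [/andP[-> _] /andP[_ ->]].
    have -> : x = 0 by apply/le_anti; rewrite x0 xg.
    congr (integral _ _ _); apply/seteqP; split => t /=; rewrite !in_itv/= andbT.
      by move=> [t0 /andP[_ t1]]; rewrite t0 t1 (ltW t0) (ltW t1).
    by move=> [/andP[-> _] ->].
  congr (integral _ _ _); apply/seteqP; split => t /=; rewrite !in_itv/= andbT.
    by move=> [xt /andP[t0 t1]]; rewrite xt t0 t1 (ltW t1).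
  by move=> [/andP[-> _] ->].
congr (_ * _)%E; rewrite !diracE; congr ((nat_of_bool _)%:R%:E).
apply/idP/idP; rewrite !inE/= !in_itv/= andbT.
  by rewrite gt_max ltr01 lexx => ->.
by rewrite gt_max => /andP[/andP[]].
Qed.

(** Rays form a pi-system on which the two measures agree. *)
Lemma tails_determine g1 (D1 : R) g2 (D2 : R) (mu nu : borel_measure) :
  has_parisi_form g1 D1 mu -> has_parisi_form g2 D2 nu ->
  (forall x : R, 0 < x < 1 -> mu [set` `]x, 1]] = nu [set` `]x, 1]]) ->
  (nu [set` `]0%R, 1%R]] < +oo)%E ->
  forall A : set T, measurable A -> nu A = mu A.
Proof.
move=> muf nuf E nufin A mA.
(* equality of the tails is not assumed at 0, where continuity from below is used *)
have E0 : nu [set` `]0%R, 1%R]] = mu [set` `]0%R, 1%R]].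
  pose F (n : nat) := ([set` `](n.+2%:R^-1 : R), 1%R]] : set T).
  have Fm n : measurable (F n) by exact: measurable_itv.
  have Fnd : nondecreasing_seq F.
    move=> m n mn; apply/subsetPset; rewrite /F => t /=; rewrite !in_itv/= => /andP[mt ->].
    by rewrite andbT; apply: le_lt_trans mt; rewrite lef_pV2 ?posrE// ler_nat.
  have FU : \bigcup_n F n = [set` `]0%R, 1%R]].
    rewrite /F; apply/seteqP; split => t /=.
      by move=> [n _ /=]; rewrite !in_itv/= => /andP[nt ->]; rewrite andbT (lt_trans _ nt).
    rewrite in_itv/= => /andP[t0 t1].
    exists (Num.bound t^-1) => //=; rewrite in_itv/= t1 andbT.
    rewrite invf_plt ?posrE//; apply: lt_trans (archi_boundP _) _.
      by rewrite invr_ge0 ltW.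
    by rewrite ltr_nat.
  have mFU : measurable (\bigcup_n F n) by rewrite FU.
  have c1 := nondecreasing_cvg_mu (mu := mu) Fm mFU Fnd.
  have c2 := nondecreasing_cvg_mu (mu := nu) Fm mFU Fnd.
  rewrite -FU -(cvg_lim _ c1)// -(cvg_lim _ c2)//.
  congr (limn _); apply/funext => n /=; rewrite /F E//.
  by rewrite invr_gt0 ltr0n/= invf_lt1 ?ltr1n.
apply: (@measure_unique _ R T (@RGenOInfty.G R) (fun n : nat => [set` `](- n%:R : R), +oo[])
  _ _ _ _ nu mu _ _ A mA) => //.
- exact: RGenOInfty.measurableE.
- move=> _ _ [x ->] [y ->]; exists (Num.max x y).
  by apply/seteqP; split => t /=; rewrite !in_itv/= !andbT gt_max; [move=> [-> ->]|move=> /andP[]].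
- by move=> n; exists (- n%:R).
- apply/seteqP; split => // t _; exists (Num.bound `|t|) => //=.
  rewrite in_itv/= andbT ltrNl; apply: le_lt_trans (archi_boundP (normr_ge0 t)).
  by rewrite -normrN ler_norm.
- move=> _ [x ->]; rewrite (ray_mass _ nuf) (ray_mass _ muf).
  have [x0|x0] := leP x 0; first exact: E0.
  have [x1|x1] := ltP x 1; first by rewrite E// x0.
  by rewrite set_itv_ge ?bnd_simp -?leNgt// !measure0.
- move=> n; rewrite (ray_mass _ nuf) max_l// oppr_le0.
Qed.

End TailsDetermine.

Section Criterion.
Context {R : realType}.
Notation leb := (@lebesgue_measure R).
Notation T := (measurableTypeR R).
Notation borel_measure := {measure set (measurableTypeR R) -> \bar R}.
Notation I01 := ([set` `[(0:R), (1:R)[] : set (measurableTypeR R)).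
Notation C01 := ([set` `[(0:R), (1:R)]] : set (measurableTypeR R)).

Variables (xi : R -> R) (gamma : R -> R) (Delta : R) (nu : borel_measure).
Hypothesis nuf : has_parisi_form gamma Delta nu.
Hypothesis mxi1 : measurable_fun (setT : set T) (derive1 xi).
Hypothesis xi1_ge0 : forall x : R, 0 <= x <= 1 -> 0 <= derive1 xi x.
Variable q : R -> R.
Hypothesis cq : continuous q.
Hypothesis q_gt0 : forall x, 0 <= x < 1 -> 0 < q x.
Hypothesis nuq : forall x : R, 0 <= x < 1 -> nu [set` `]x, 1]] = (q x)%:E.

Let g : T -> \bar R := (fun x : T => ((q x)^-1 ^+ 2)%:E) \_ I01.
Let P (t : T) := (\int[leb]_(x in [set` `[0%R, t[]) g x)%E.

Hypothesis P_le : forall y : R, 0 <= y < 1 ->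
  (\int[leb]_(t in [set` `[y, 1%R[]) P t
   <= \int[leb]_(t in [set` `[y, 1%R[]) (derive1 xi t)%:E)%E.
Hypothesis P1 : (\int[leb]_(x in I01) g x = (derive1 xi 1)%:E)%E.
Hypothesis Pgamma : (\int[leb]_(t in I01) (P t * (gamma t)%:E)
  = \int[leb]_(t in I01) ((derive1 xi t)%:E * (gamma t)%:E))%E.
Hypothesis qVfin : (\int[leb]_(x in I01) ((q x)^-1)%:E < +oo)%E.

Let tail (mu : borel_measure) (x : R) := mu [set` `]x, 1]].

Let tail_le mu x y : x <= y -> (tail mu y <= tail mu x)%E.
Proof.
move=> xy; apply: le_measure; rewrite ?inE//.
by move=> z /=; rewrite !in_itv/= => /andP[yz ->]; rewrite (le_lt_trans xy).
Qed.

Let mtail mu : measurable_fun I01 (tail mu).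
Proof.
have -> : tail mu = (fun x => - (- tail mu x))%E by apply/funext => x; rewrite oppeK.
apply: measurableT_comp => //.
apply: nondecreasing_emeasurable_itv => x y _ _ xy.
by rewrite leeN2; exact: tail_le.
Qed.

Let mtailV mu : measurable_fun I01 (fun x : T => ((tail mu x)^-1)%E).
Proof.
apply: nondecreasing_emeasurable_itv => x y _ _ xy.
by rewrite lee_pV2 ?inE//; exact: tail_le.
Qed.

Let mqV : measurable_fun I01 (fun x : T => (q x)^-1).
Proof.
apply: nondecreasing_measurable_itv => x y; rewrite !in_itv/= => xI yI xy.
rewrite lef_pV2 ?posrE ?q_gt0//.
by rewrite -lee_fin -!nuq//; exact: tail_le.
Qed.

Let mg : measurable_fun setT g.
Proof.
have mI : measurable I01 by [].
have h : measurable_fun I01 (fun x : T => ((q x)^-1 ^+ 2)%:E).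
  by apply/measurable_EFinP; exact: measurable_funX.
exact: (measurable_restrictT _ mI).1 h.
Qed.

Let g0 x : (0 <= g x)%E.
Proof. by rewrite /g patchE; case: ifPn => // _; rewrite lee_fin sqr_ge0. Qed.

Lemma xi_integral (gam : R -> R) (D : R) (mu : borel_measure) :
  has_parisi_form gam D mu ->
  (\int[mu]_(x in [set` `[0%R, 1%R]]) (derive1 xi x)%:E
   = \int[leb]_(t in I01) ((derive1 xi t)%:E * (gam t)%:E)
     + D%:E * (derive1 xi 1)%:E)%E.
Proof.
move=> muf; rewrite integral_mkcond.
have mC : measurable C01 by [].
rewrite (parisi_form_integral muf); last 2 first.
- have h : measurable_fun C01 (fun x : T => (derive1 xi x)%:E).
    by apply: measurable_funTS; exact/measurable_EFinP.
  exact: (measurable_restrictT _ mC).1 h.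
- move=> x; rewrite patchE; case: ifPn => // /[!inE]/=; rewrite in_itv/= => xI.
  by rewrite lee_fin xi1_ge0.
congr (_ + _)%E; last first.
  by rewrite patchE mem_set//= in_itv/= ler01 lexx.
apply: eq_integral => x; rewrite inE/= in_itv/= => /andP[x0 x1].
by rewrite patchE mem_set//= in_itv/= x0 ltW.
Qed.

(** On the density of mu the comparison is layer_cake_le, thanks to P_le; on the atom at 1 it
    is the equality P1. *)
Lemma xi_integral_ge (gam : R -> R) (D : R) (mu : borel_measure) :
  has_parisi_form gam D mu ->
  (\int[leb]_(x in I01) (tail mu x * g x)
   <= \int[mu]_(x in [set` `[0%R, 1%R]]) (derive1 xi x)%:E)%E.
Proof.
move=> muf; rewrite (xi_integral muf).
have [TT mP] := tail_tonelli muf mg g0.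
rewrite TT P1; have [[gam0 gamnd _] D0 _] := muf.
apply: leeD => //.
have mI : measurable I01 by [].
pose P' : T -> \bar R := P \_ I01.
pose X' : T -> \bar R := (fun t : T => (derive1 xi t)%:E) \_ I01.
have E (F : T -> \bar R) (y : R) : 0 <= y ->
    (\int[leb]_(t in [set` `[y, 1%R[]) (F \_ I01) t
     = \int[leb]_(t in [set` `[y, 1%R[]) F t)%E.
  move=> y0; apply: eq_integral => t; rewrite inE/= in_itv/= => /andP[yt t1].
  by rewrite patchE mem_set//= in_itv/= t1 (le_trans y0).
have E' (F : T -> \bar R) :
    (\int[leb]_(t in I01) ((F \_ I01) t * (gam t)%:E)
     = \int[leb]_(t in I01) (F t * (gam t)%:E))%E.
  by apply: eq_integral => t tI; rewrite patchE tI.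
rewrite -[leLHS]/(\int[leb]_(t in I01) (P t * (gam t)%:E))%E.
rewrite -(E' P) -(E' (fun t => (derive1 xi t)%:E)); apply: layer_cake_le => //.
- exact: (measurable_restrictT _ mI).1 mP.
- by move=> x; rewrite patchE; case: ifPn => // _; apply: integral_ge0.
- have h : measurable_fun I01 (fun x : T => (derive1 xi x)%:E).
    by apply: measurable_funTS; exact/measurable_EFinP.
  exact: (measurable_restrictT _ mI).1 h.
- move=> x; rewrite patchE; case: ifPn => // /[!inE]/=; rewrite in_itv/= => /andP[x0 x1].
  by rewrite lee_fin xi1_ge0// x0 ltW.
- move=> y y0; rewrite !E//.
  have [y1|y1] := ltP y 1; first by apply: P_le; rewrite y0.
  by rewrite !set_itv_ge// ?bnd_simp -?leNgt// !integral_set0.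
Qed.

Let inv_integral mu :
  (\int[leb]_(x in [set` `[0%R, 1%R]]) ((tail mu x)^-1)
   = \int[leb]_(x in I01) ((tail mu x)^-1))%E.
Proof. by rewrite -integral_itv_bndo_bndc//; exact: mtailV. Qed.

Let sum_integral mu :
  (\int[leb]_(x in I01) (tail mu x * g x + (tail mu x)^-1)
   = \int[leb]_(x in I01) (tail mu x * g x) + \int[leb]_(x in I01) ((tail mu x)^-1))%E.
Proof.
rewrite ge0_integralD//.
- by move=> x _; rewrite mule_ge0.
- by apply: emeasurable_funM => //; exact: measurable_funTS.
- by move=> x _; rewrite inve_ge0.
Qed.

(** The inequality t / q^2 + 1 / t >= 2 / q, with equality only at t = q. The deficit d is an
    extended real because t may be 0 or infinite. *)
Let pointwise (t : \bar R) x : 0 <= x < 1 -> (0 <= t)%E ->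
  exists2 d : \bar R, (0 <= d)%E &
   (t * g x + t^-1 = d + (2 * (q x)^-1)%:E)%E /\ (d = 0 -> t = (q x)%:E)%E.
Proof.
move=> xI; have qx := q_gt0 xI.
have -> : g x = ((q x)^-1 ^+ 2)%:E by rewrite /g patchE mem_set//= in_itv.
have g1 : (0 < (((q x)^-1) ^+ 2)%:E)%E by rewrite lte_fin exprn_gt0// invr_gt0.
case: t => [t| |]// t0.
- rewrite inver; case: eqP => [->|/eqP tn0].
    by exists +oo%E => //; split => //; rewrite mul0e add0e.
  have tp : 0 < t by rewrite lt_neqAle eq_sym tn0 -lee_fin.
  exists ((t - q x) ^+ 2 * (t^-1 * (q x)^-1 ^+ 2))%:E.
    by rewrite lee_fin mulr_ge0 ?sqr_ge0// mulr_ge0 ?invr_ge0 ?sqr_ge0// ltW.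
  split.
    rewrite -EFinM -!EFinD; congr EFin; field.
    by rewrite tn0 gt_eqF.
  move=> [] /eqP; rewrite mulf_eq0 => /orP[|].
    by rewrite sqrf_eq0 subr_eq0 => /eqP ->.
  by rewrite gt_eqF// mulr_gt0 ?invr_gt0// exprn_gt0// invr_gt0.
- exists +oo%E => //; split => //.
  by rewrite gt0_mulye// invey addye.
Qed.

Let J := (\int[leb]_(x in I01) (2 * (q x)^-1)%:E)%E.

Let J_fin : (J \is a fin_num)%E.
Proof.
rewrite /J ge0_fin_numE; last first.
  apply: integral_ge0 => x /=; rewrite in_itv/= => xI.
  by rewrite lee_fin mulr_ge0// invr_ge0 ltW// q_gt0.
under eq_integral do rewrite EFinM.
rewrite ge0_integralZl//; last 2 first.
- exact/measurable_EFinP.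
- by move=> x /=; rewrite in_itv/= => xI; rewrite lee_fin invr_ge0 ltW// q_gt0.
by rewrite lte_mul_pinfty.
Qed.

Lemma functional_candidate :
  parisi_functional xi nu = ((2^-1)%:E * J)%E.
Proof.
rewrite /parisi_functional; congr (_ * _)%E.
rewrite -/(tail nu) inv_integral.
have -> : (\int[nu]_(x in [set` `[0%R, 1%R]]) (derive1 xi x)%:E
   = \int[leb]_(x in I01) (tail nu x * g x))%E.
  by rewrite (xi_integral nuf) (tail_tonelli nuf mg g0).1 P1 Pgamma.
rewrite -sum_integral; apply: eq_integral => x; rewrite inE/= in_itv/= => xI.
rewrite /tail nuq// /g patchE mem_set//= ?in_itv//=.
have qx := q_gt0 xI.
rewrite inver gt_eqF// -EFinM -EFinD; congr EFin; field.
by rewrite gt_eqF.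
Qed.

Lemma functional_ge mu : class_K mu ->
  (J <= \int[leb]_(x in I01) (tail mu x * g x + (tail mu x)^-1))%E /\
  ((2^-1)%:E * \int[leb]_(x in I01) (tail mu x * g x + (tail mu x)^-1)
     <= parisi_functional xi mu)%E.
Proof.
move=> [gam [D muf]]; split.
  apply: ge0_le_integral => //.
  - move=> x /=; rewrite in_itv/= => xI.
    by rewrite lee_fin mulr_ge0// invr_ge0 ltW// q_gt0.
  - apply/measurable_EFinP; exact: measurable_funM.
  - apply: emeasurable_funD => //; apply: emeasurable_funM => //.
    exact: measurable_funTS.
  - move=> x /=; rewrite in_itv/= => xI.
    have [d d0 [-> _]] := pointwise xI (measure_ge0 mu [set` `]x, 1]]).
    by rewrite leeDr.
rewrite /parisi_functional lee_pmul2l//.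
rewrite sum_integral -/(tail mu) inv_integral; apply: leeD => //.
exact: xi_integral_ge muf.
Qed.

(** Another minimizer attains equality almost everywhere in the pointwise inequality, so its
    tail is q on a dense set; it is monotone and q is continuous, hence it is q everywhere. *)
Lemma tail_unique mu : class_K mu ->
  parisi_functional xi mu = parisi_functional xi nu ->
  forall x, 0 < x < 1 -> tail mu x = (q x)%:E.
Proof.
move=> muK; rewrite functional_candidate => FE.
have [J1 J2] := functional_ge muK.
have JE : (\int[leb]_(x in I01) (tail mu x * g x + (tail mu x)^-1) = J)%E.
  apply/eqP; rewrite eq_le J1 andbT.
  by move: J2; rewrite FE lee_pmul2l.
pose d x := (tail mu x * g x + (tail mu x)^-1 - (2 * (q x)^-1)%:E)%E.
have dP x : 0 <= x < 1 -> (0 <= d x)%E /\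
   (tail mu x * g x + (tail mu x)^-1 = d x + (2 * (q x)^-1)%:E)%E /\
   (d x = 0 -> tail mu x = (q x)%:E)%E.
  move=> xI; have [e e0 [E1 E2]] := pointwise xI (measure_ge0 mu [set` `]x, 1]]).
  by rewrite /d [X in (X - _)%E]E1 addeK// -E1.
have md : measurable_fun I01 d.
  apply: emeasurable_funB; last by apply/measurable_EFinP; exact: measurable_funM.
  apply: emeasurable_funD => //; apply: emeasurable_funM => //.
  exact: measurable_funTS.
have d0 : (\int[leb]_(x in I01) d x = 0)%E.
  have : (\int[leb]_(x in I01) d x + J = J)%E.
    rewrite -{2}JE -ge0_integralD//.
    - by apply: eq_integral => x; rewrite inE/= in_itv/= => /dP[_ [-> _]].
    - by move=> x /=; rewrite in_itv/= => /dP[].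
    - move=> x /=; rewrite in_itv/= => xI.
      by rewrite lee_fin mulr_ge0// invr_ge0 ltW// q_gt0.
    - by apply/measurable_EFinP; exact: measurable_funM.
  by move=> E; rewrite -[LHS](addeK _ J_fin) E subee.
have : ae_eq leb I01 d (cst 0)%E.
  apply/ae_eq_integral_abs => //; rewrite -[RHS]d0; apply: eq_integral => x.
  by rewrite inE/= in_itv/= => /dP[? _]; rewrite gee0_abs.
move=> [N [mN N0 Nsub]].
(* the exceptional null set contains no interval *)
have dense u v : 0 <= u -> u < v -> v <= 1 ->
    exists2 z, u < z < v & tail mu z = (q z)%:E.
  move=> u0 uv v1; apply: contrapT => /forall2NP H.
  have : (leb ([set` `]u, v[] : set T) <= leb N)%E.
    apply: le_measure; rewrite ?inE//.
    move=> z /=; rewrite in_itv/= => /andP[uz zv]; apply: Nsub => /=.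
    have zI : 0 <= z < 1 by rewrite (le_trans u0 (ltW uz)) (lt_le_trans zv).
    move=> /(_ _)H'; case: (H z); first by rewrite uz zv.
    by apply; apply: (dP _ zI).2.2; apply: H'; rewrite in_itv/=.
  rewrite N0; apply/negP; rewrite -ltNge.
  have -> : leb ([set` `]u, v[] : set T) = (v - u)%:E.
    apply: etrans; first exact: (lebesgue_measure_itv `]u, v[).
    by rewrite /= lte_fin uv EFinB.
  by rewrite lte_fin subr_gt0.
move=> x /andP[x0 x1].
have tfin u : 0 < u < 1 -> tail mu u \is a fin_num.
  move=> /andP[u0 u1]; have [z /andP[z0 zu] Ez] := dense 0 u (lexx _) u0 (ltW u1).
  rewrite ge0_fin_numE//; apply: (le_lt_trans (tail_le mu (ltW zu))).
  by rewrite Ez ltry.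
rewrite -(fineK (tfin x _)) ?x0//; congr EFin; apply/eqP; rewrite eq_le.
have cqx := @cq x.
apply/andP; split; apply/ler_addgt0Pr => e e0.
- have /cqx : nbhs (q x) (ball (q x) e) by exact: nbhsx_ballx.
  move=> [r /= r0 Hr].
  have m0 : Num.max 0 (x - r) < x by rewrite gt_max x0/= ltrBlDr ltrDl.
  have [|z /andP[z0 zx] Ez] := dense (Num.max 0 (x - r)) x _ m0 (ltW x1).
    by rewrite le_max lexx.
  move: z0; rewrite gt_max => /andP[z0 zr].
  have xz : `|x - z| < r by rewrite ger0_norm ?subr_ge0 ?(ltW zx)//; lra.
  have : `|q x - q z| < e by exact: Hr z xz.
  rewrite ltr_norml => /andP[qz _].
  have : (tail mu x <= (q z)%:E)%E by rewrite -Ez; exact/tail_le/ltW.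
  by rewrite -(fineK (tfin x _)) ?x0// lee_fin => ?; lra.
- have /cqx : nbhs (q x) (ball (q x) e) by exact: nbhsx_ballx.
  move=> [r /= r0 Hr].
  have m0 : x < Num.min 1 (x + r) by rewrite lt_min x1/= ltrDl.
  have [|z /andP[zx z0] Ez] := dense x (Num.min 1 (x + r)) (ltW x0) m0 _.
    by rewrite ge_min lexx.
  move: z0; rewrite lt_min => /andP[z1 zr].
  have xz : `|x - z| < r by rewrite ler0_norm ?subr_le0 ?(ltW zx)//; lra.
  have : `|q x - q z| < e by exact: Hr z xz.
  rewrite ltr_norml => /andP[_ qz].
  have : ((q z)%:E <= tail mu x)%E by rewrite -Ez; exact/tail_le/ltW.
  by rewrite -(fineK (tfin x _)) ?x0// lee_fin => ?; lra.
Qed.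

(** Weak duality: the integral of xi' is bounded below by a linear functional of the tail,
    exactly so at nu, and the sum of this functional with the inverse of the tail is minimized
    pointwise by q. *)
Lemma parisi_measure_criterion : is_parisi_measure xi nu.
Proof.
have nuK : class_K nu by exists gamma, Delta.
split => // mu muK.
  have [J1 J2] := functional_ge muK; rewrite functional_candidate.
  by apply: le_trans J2; rewrite lee_pmul2l.
move=> E A mA; have [gam [D muf]] := muK.
apply/esym; apply: (tails_determine muf nuf _ _ mA).
- by move=> x xI; rewrite -/(tail mu x) tail_unique// nuq//; case/andP: xI => /ltW -> ->.
- by rewrite nuq ?ltry// lexx ltr01.
Qed.

End Criterion.

(** * Candidates whose density has at most one interior jump *)

Section FTC.
Context {R : realType}.
Notation leb := (@lebesgue_measure R).
Notation T := (measurableTypeR R).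

Lemma measurable_continuous_itv (f : R -> R) (b c : R) :
  (forall x, b <= x <= c -> {for x, continuous f}) ->
  measurable_fun ([set` `[b, c[] : set T) f.
Proof.
move=> cf; apply: (@measurable_funS _ _ _ _ [set` `[b, c]]) => //.
  by move=> x /=; rewrite !in_itv/= => /andP[-> /ltW].
apply: subspace_continuous_measurable_fun => //.
by apply: continuous_in_subspaceT => x; rewrite inE/= in_itv/=; exact: cf.
Qed.

Lemma integral_derivative (F f : R -> R) (b c : R) : b <= c ->
  (forall x, b <= x <= c -> is_derive x 1 F (f x)) ->
  (forall x, b <= x <= c -> {for x, continuous f}) ->
  (\int[leb]_(x in [set` `[b, c[]) (f x)%:E = (F c - F b)%:E)%E.
Proof.
rewrite le_eqVlt => /predU1P[->|bc] dF cf.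
  by rewrite set_itv_ge ?bnd_simp ?ltxx// integral_set0 subrr.
have cW : {within [set` `[b, c]], continuous f}.
  apply: continuous_in_subspaceT => x; rewrite inE/= in_itv/=; exact: cf.
rewrite integral_itv_bndo_bndc; last first.
  by apply/measurable_EFinP; exact: measurable_continuous_itv.
rewrite (@continuous_FTC2 _ f F)//.
- have cF x : b <= x <= c -> {for x, continuous F}.
    move=> xI; apply: differentiable_continuous; apply/derivable1_diffP.
    by have [] := dF x xI.
  split.
  + move=> x; rewrite in_itv/= => /andP[bx xc].
    by have [] := dF x; rewrite ?(ltW bx) ?(ltW xc).
  + by apply: cvg_at_right_filter; apply: cF; rewrite lexx ltW.
  + by apply: cvg_at_left_filter; apply: cF; rewrite lexx ltW.
- move=> x; rewrite in_itv/= => /andP[bx xc]; rewrite derive1E.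
  by apply: derive_val; apply: dF; rewrite (ltW bx) (ltW xc).
Qed.

End FTC.

Section TwoStep.
Context {R : realType}.
Notation leb := (@lebesgue_measure R).
Notation T := (measurableTypeR R).
Notation borel_measure := {measure set (measurableTypeR R) -> \bar R}.
Notation I01 := ([set` `[(0:R), (1:R)[] : set (measurableTypeR R)).

Variables (a m0 m1 D : R).
Hypotheses (a01 : 0 < a < 1) (m0_gt0 : 0 < m0) (m01 : m0 <= m1) (D_gt0 : 0 < D).

Definition step_density (x : R) : R := if x < a then m0 else m1.
Definition step_tail (x : R) : R :=
  D + m0 * Num.max 0 (a - x) + m1 * (1 - Num.max a x).

Let m1_gt0 : 0 < m1. Proof. exact: lt_le_trans m01. Qed.
Let m0_ge0 : 0 <= m0. Proof. exact: ltW. Qed.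
Let m1_ge0 : 0 <= m1. Proof. exact: ltW. Qed.
Let D_ge0 : 0 <= D. Proof. exact: ltW. Qed.
Let m10_ge0 : 0 <= m1 - m0. Proof. by rewrite subr_ge0. Qed.

Let mI0 : measurable ([set` `[(0:R), a[] : set T). Proof. by []. Qed.
Let mI1 : measurable ([set` `[a, (1:R)[] : set T). Proof. by []. Qed.

Let step_measure : borel_measure :=
  measure_add (measure_add (mscale (NngNum m0_ge0) (mrestr leb mI0))
                           (mscale (NngNum m1_ge0) (mrestr leb mI1)))
              (mscale (NngNum D_ge0) \d_(1%R : T)).

(** The measure with distribution function step_density. When m0 = m1 the atom at a has no
    mass, whence the number (m0 < m1) + 1 of points in the support. *)
Let jump_measure : borel_measure :=
  measure_add (mscale (NngNum m0_ge0) \d_(0%R : T))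
              (mscale (NngNum m10_ge0) \d_(a : T)).

Lemma step_density_nd : nondecreasing_fun step_density.
Proof.
move=> x y xy; rewrite /step_density.
case: ltP => [xa|ax]; case: ltP => [ya|ay] //.
by move: (le_lt_trans (le_trans ax xy) ya); rewrite ltxx.
Qed.

Lemma step_density_admissible : admissible_density step_density.
Proof.
split.
- by move=> x _; rewrite /step_density; case: ifP.
- by move=> x y _ _; exact: step_density_nd.
- move=> x _; apply: cvg_near_cst.
  have [xa|ax] := ltP x a.
    near=> y; rewrite /step_density xa.
    by rewrite ifT//; near: y; exact: nbhs_right_lt.
  near=> y; have xy : x < y by near: y; exact: nbhs_right_gt.
  by rewrite /step_density !ifF// ltNge ?ax// (le_trans ax (ltW xy)).
Unshelve. all: by end_near. Qed.

Lemma step_integral (A : set T) : measurable A ->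
  (\int[leb]_(x in A `&` I01) (step_density x)%:E
   = m0%:E * leb (A `&` [set` `[0%R, a[]) + m1%:E * leb (A `&` [set` `[a, 1%R[]))%E.
Proof.
move=> mA; case/andP: (a01) => a0 a1.
have -> : A `&` I01 = (A `&` [set` `[(0:R), a[]) `|` (A `&` [set` `[a, (1:R)[]).
  apply/seteqP; split => x /=; rewrite !in_itv/=.
    move=> [Ax /andP[x0 x1]]; have [xa|ax] := ltP x a.
      by left; rewrite x0.
    by right.
  move=> [[Ax /andP[x0 xa]]|[Ax /andP[ax x1]]]; split => //.
    by rewrite x0 (lt_trans xa).
  by rewrite x1 andbT (le_trans (ltW a0)).
rewrite ge0_integral_setU//=; last 5 first.
- exact: measurableI.
- exact: measurableI.
- apply/measurable_EFinP; apply: nondecreasing_measurable.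
    by apply: measurableU; exact: measurableI.
  exact: step_density_nd.
- by move=> x _; rewrite lee_fin /step_density; case: ifP.
- apply/disj_setPS => x /= [[_ ]]; rewrite !in_itv/= => /andP[_ xa] [_ /andP[ax _]].
  by move: (lt_le_trans xa ax); rewrite ltxx.
congr (_ + _)%E.
  rewrite (eq_integral (cst m0%:E)); last first.
    by move=> x; rewrite inE/= in_itv/= => -[_ /andP[_ xa]]; rewrite /step_density xa.
  by rewrite integral_cst//; exact: measurableI.
rewrite (eq_integral (cst m1%:E)); last first.
  move=> x; rewrite inE/= in_itv/= => -[_ /andP[ax _]].
  by rewrite /step_density ltNge ax.
by rewrite integral_cst//; exact: measurableI.
Qed.

Lemma step_measureE A : step_measure A =
  (m0%:E * leb (A `&` [set` `[0%R, a[]) + m1%:E * leb (A `&` [set` `[a, 1%R[])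
   + D%:E * \d_(1%R : T) A)%E.
Proof.
apply: etrans; first exact: measure_addE.
by congr (_ + _)%E; apply: etrans; first exact: measure_addE.
Qed.

Lemma jump_measureE A : jump_measure A =
  (m0%:E * \d_(0%R : T) A + (m1 - m0)%:E * \d_(a : T) A)%E.
Proof. by apply: etrans; first exact: measure_addE. Qed.

Lemma step_measure_form : has_parisi_form step_density D step_measure.
Proof.
split => //; first exact: step_density_admissible.
by move=> A mA; rewrite step_integral// step_measureE.
Qed.

Lemma step_tailE x : 0 <= x < 1 ->
  step_measure [set` `]x, 1]] = (step_tail x)%:E.
Proof.
move=> /andP[x0 x1]; case/andP: (a01) => a0 a1.
rewrite step_measureE.
rewrite diracE mem_set/= ?in_itv/= ?x1 ?lexx// mule1.
have [ax|xa] := leP a x.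
  rewrite [X in (m0%:E * leb X)%E](_ : _ = set0); last first.
    apply/seteqP; split => t //=; rewrite !in_itv/= => -[/andP[xt _] /andP[_ ta]].
    by move: (lt_trans (lt_le_trans ta ax) xt); rewrite ltxx.
  rewrite measure0 mule0 add0e.
  rewrite [X in (m1%:E * leb X)%E](_ : _ = [set` `]x, 1%R[]); last first.
    apply/seteqP; split => t /=; rewrite !in_itv/=.
      by move=> [/andP[-> _] /andP[_ ->]].
    by move=> /andP[xt t1]; rewrite xt t1 (ltW t1) (le_trans ax (ltW xt)).
  have -> : leb ([set` `]x, 1%R[] : set T) = (1 - x)%:E.
    apply: etrans; first exact: (lebesgue_measure_itv `]x, (1:R)[).
    by rewrite /= lte_fin x1 EFinB.
  rewrite -EFinM -EFinD /step_tail (max_r ax) max_l ?subr_le0//.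
  by congr EFin; ring.
rewrite [X in (m0%:E * leb X)%E](_ : _ = [set` `]x, a[]); last first.
  apply/seteqP; split => t /=; rewrite !in_itv/=.
    by move=> [/andP[-> _] /andP[_ ->]].
  move=> /andP[xt ta]; rewrite xt ta (le_trans x0 (ltW xt)).
  by rewrite (ltW (lt_trans ta a1)).
rewrite [X in (m1%:E * leb X)%E](_ : _ = [set` `[a, 1%R[]); last first.
  apply/seteqP; split => t /=; rewrite !in_itv/=.
    by move=> [_ ->].
  by move=> /andP[at_ t1]; rewrite at_ t1 (ltW t1) (lt_le_trans xa at_).
have -> : leb ([set` `]x, a[] : set T) = (a - x)%:E.
  apply: etrans; first exact: (lebesgue_measure_itv `]x, a[).
  by rewrite /= lte_fin xa EFinB.
have -> : leb ([set` `[a, 1%R[] : set T) = (1 - a)%:E.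
  apply: etrans; first exact: (lebesgue_measure_itv `[a, (1:R)[).
  by rewrite /= lte_fin a1 EFinB.
rewrite -!EFinM -!EFinD /step_tail (max_l (ltW xa)) max_r ?subr_ge0 ?(ltW xa)//.
by congr EFin; ring.
Qed.

Lemma jump_measure_cdf : has_cdf_on_01 jump_measure step_density.
Proof.
case/andP: (a01) => a0 a1.
split.
  rewrite jump_measureE !diracE !memNset ?mule0 ?adde0//=.
    by rewrite in_itv/= (ltW a0) a1; apply.
  by rewrite in_itv/= lexx ltr01; apply.
move=> x; rewrite in_itv/= => /andP[x0 x1].
rewrite jump_measureE !diracE mem_set/= ?in_itv/= ?lexx ?x0// mule1.
rewrite /step_density; have [xa|ax] := ltP x a.
  rewrite memNset ?mule0 ?adde0//= in_itv/= => /andP[_ /(lt_le_trans xa)].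
  by rewrite ltxx.
rewrite mem_set/= ?in_itv/= ?(ltW a0)// mule1 -EFinD; congr EFin; ring.
Qed.

Lemma jump_measure_support :
  (support_on_01 jump_measure #= `I_(m0 < m1)%R.+1)%card.
Proof.
case/andP: (a01) => a0 a1.
have jE (U : set R) : jump_measure (U `&` [set` `[0%R, 1%R[])
    = (m0%:E * (((0 : R) \in U)%:R)%:E + (m1 - m0)%:E * ((a \in U)%:R)%:E)%E.
  rewrite jump_measureE !diracE; congr (_ * (nat_of_bool _)%:R%:E + _ * (nat_of_bool _)%:R%:E)%E.
    by apply/idP/idP; rewrite !inE/= in_itv/= lexx ltr01 => // -[].
  by apply/idP/idP; rewrite !inE/= in_itv/= (ltW a0) a1 => // -[].
have cl (x : R) : open (~` [set x]).
  exact/closed_openC/accessible_closed_set1/hausdorff_accessible/Rhausdorff.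
have s0 : support_on_01 jump_measure 0.
  split; first by rewrite in_itv/= lexx ltr01.
  move=> U _ U0; rewrite jE mem_set//= mule1 -EFinM -EFinD lte_fin.
  by rewrite ltr_pwDl// mulr_ge0.
have sa : m0 < m1 -> support_on_01 jump_measure a.
  move=> m01'; split; first by rewrite in_itv/= ltW.
  move=> U _ Ua; rewrite jE [a \in U]mem_set//= mule1 -EFinM -EFinD lte_fin.
  by rewrite ltr_pwDr ?subr_gt0// mulr_ge0.
have s1 x : support_on_01 jump_measure x -> x = 0 \/ (m0 < m1 /\ x = a).
  move=> [_ H]; have [->|x0] := eqVneq x 0; first by left.
  right; move: m01; rewrite le_eqVlt => /predU1P[E|lt].
    have := H (~` [set 0]) (cl 0); rewrite jE -E subrr mul0e adde0 memNset ?mule0 ?ltxx.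
      by move=> h; exfalso; apply: (notF (h _)); apply/eqP.
    by apply; exact: erefl.
  split=> //; apply: contrapT => xa.
  have := H (~` [set 0] `&` ~` [set a]) (openI (cl 0) (cl a)).
  rewrite jE !memNset/= ?mule0 ?adde0 ?ltxx.
  - by move=> h; exfalso; apply: (notF (h _)); split => //; apply/eqP.
  - by move=> [_]; apply.
  - by move=> [h _]; apply: h.
have [lt|ge] := ltP m0 m1.
  rewrite (_ : support_on_01 jump_measure = [set` [fset (0 : R); a]%fset]).
    by apply/card_eq_fsetP; rewrite cardfs2 lt_eqF.
  apply/seteqP; split => x /=.
    by move=> /s1[->|[_ ->]]; rewrite !inE eqxx ?orbT.
  by rewrite !inE => /orP[/eqP ->|/eqP ->] //; exact: sa.
rewrite (_ : support_on_01 jump_measure = [set 0]).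
  exact: card_set1.
apply/seteqP; split => x /=; last by move=> ->.
by move=> /s1[->//|[h _]]; move: (lt_le_trans h ge); rewrite ltxx.
Qed.

Variable xi : R -> R.
Variable xi1 : R -> R.
Hypothesis dxi : forall x : R, is_derive x 1 xi (xi1 x).
Hypothesis cxi1 : continuous xi1.
Hypothesis xi1_ge0 : forall x, 0 <= x <= 1 -> 0 <= xi1 x.

Variables P0 P1 p0 p1 : R -> R.
Hypothesis dP0 : forall x, 0 <= x <= a -> is_derive x 1 P0 (p0 x).
Hypothesis dP1 : forall x, a <= x <= 1 -> is_derive x 1 P1 (p1 x).
Hypothesis dp0 : forall x, 0 <= x <= a ->
  is_derive x 1 p0 ((D + m1 * (1 - a) + m0 * (a - x))^-1 ^+ 2).
Hypothesis dp1 : forall x, a <= x <= 1 ->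
  is_derive x 1 p1 ((D + m1 * (1 - x))^-1 ^+ 2).
Hypothesis p00 : p0 0 = 0.
Hypothesis p0a : p0 a = p1 a.
Hypothesis p11 : p1 1 = xi1 1.
Hypothesis P00 : P0 0 = xi 0.
Hypothesis P0a : P0 a = P1 a.
Hypothesis P11 : P1 1 = xi 1.
Hypothesis Pxia : m0 < m1 -> P0 a = xi a.
Hypothesis P0_ge : forall x, 0 <= x <= a -> xi x <= P0 x.
Hypothesis P1_ge : forall x, a <= x <= 1 -> xi x <= P1 x.

Let q := step_tail.

Let derive1_xi : derive1 xi = xi1.
Proof.
by apply/funext => x; rewrite derive1E; apply: derive_val.
Qed.

Let q_left x : x <= a -> q x = D + m1 * (1 - a) + m0 * (a - x).
Proof.
by move=> xa; rewrite /q /step_tail max_r ?subr_ge0// max_l//; ring.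
Qed.

Let q_right x : a <= x -> q x = D + m1 * (1 - x).
Proof.
by move=> ax; rewrite /q /step_tail max_l ?subr_le0// max_r//; ring.
Qed.

Let q_ge x : x <= 1 -> D <= q x.
Proof.
move=> x1; case/andP: a01 => a0 a1; have [xa|ax] := leP x a.
  rewrite q_left// -addrA lerDl addr_ge0// mulr_ge0// subr_ge0//; exact: ltW.
by rewrite q_right ?(ltW ax)// lerDl mulr_ge0// subr_ge0.
Qed.

Let cq : continuous q.
Proof.
move=> x; rewrite /q /step_tail.
have c1 : {for x, continuous (fun y : R => Num.max 0 (a - y))}.
  apply: continuous_max; first exact: cvg_cst.
  by apply: cvgB; [exact: cvg_cst|exact: cvg_id].
have c2 : {for x, continuous (fun y : R => Num.max a y)}.
  by apply: continuous_max; [exact: cvg_cst|exact: cvg_id].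
apply: cvgD; first (apply: cvgD; first exact: cvg_cst).
  by apply: cvgM; [exact: cvg_cst|exact: c1].
apply: cvgM; first exact: cvg_cst.
by apply: cvgB; [exact: cvg_cst|exact: c2].
Qed.

Let p (x : R) := if x < a then p0 x else p1 x.

Let cder (F : R -> R) (x df : R) : is_derive x 1 F df -> {for x, continuous F}.
Proof.
by move=> dF; apply: differentiable_continuous; apply/derivable1_diffP; case: dF.
Qed.

(** The integrands met here are given by different formulas on both sides of a. *)
Let split_integral (f f0 f1 F0 F1 : R -> R) b c : 0 <= b -> b <= c -> c <= 1 ->
  (forall x, 0 <= x < a -> f x = f0 x) -> (forall x, a <= x < 1 -> f x = f1 x) ->
  (forall x, 0 <= x <= a -> is_derive x 1 F0 (f0 x)) ->
  (forall x, 0 <= x <= a -> {for x, continuous f0}) ->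
  (forall x, a <= x <= 1 -> is_derive x 1 F1 (f1 x)) ->
  (forall x, a <= x <= 1 -> {for x, continuous f1}) ->
  F0 a = F1 a -> (forall x, b <= x < c -> 0 <= f x) ->
  (\int[leb]_(x in [set` `[b, c[]) (f x)%:E
   = ((if c < a then F0 c else F1 c) - (if b < a then F0 b else F1 b))%:E)%E.
Proof.
move=> b0 bc c1 fE0 fE1 dF0 cf0 dF1 cf1 Fa f_ge.
have left_ u v : 0 <= u -> u <= v -> v <= a ->
    (\int[leb]_(x in [set` `[u, v[]) (f x)%:E = (F0 v - F0 u)%:E)%E.
  move=> u0 uv va; apply: etrans; last (apply: (@integral_derivative _ F0 f0) => //).
  - apply: eq_integral => x; rewrite inE/= in_itv/= => /andP[ux xv].
    by rewrite fE0// (le_trans u0)//= (lt_le_trans xv).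
  - by move=> x /andP[ux xv]; apply: dF0; rewrite (le_trans u0)//= (le_trans xv).
  - by move=> x /andP[ux xv]; apply: cf0; rewrite (le_trans u0)//= (le_trans xv).
have right_ u v : a <= u -> u <= v -> v <= 1 ->
    (\int[leb]_(x in [set` `[u, v[]) (f x)%:E = (F1 v - F1 u)%:E)%E.
  move=> u0 uv va; apply: etrans; last (apply: (@integral_derivative _ F1 f1) => //).
  - apply: eq_integral => x; rewrite inE/= in_itv/= => /andP[ux xv].
    by rewrite fE1// (le_trans u0)//= (lt_le_trans xv).
  - by move=> x /andP[ux xv]; apply: dF1; rewrite (le_trans u0)//= (le_trans xv).
  - by move=> x /andP[ux xv]; apply: cf1; rewrite (le_trans u0)//= (le_trans xv).
have [ba|ab] := ltP b a; last first.
  by rewrite ltNge (le_trans ab bc)/= right_.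
have [ca|ac] := ltP c a; first by rewrite left_// ltW.
have U : [set` `[b, c[] = ([set` `[b, a[] : set T) `|` [set` `[a, c[].
  apply/seteqP; split => x /=; rewrite !in_itv/=.
    by move=> /andP[bx xc]; have [xa|ax] := ltP x a; [left; rewrite bx|right].
  move=> [/andP[bx xa]|/andP[ax xc]]; first by rewrite bx (lt_le_trans xa).
  by rewrite xc (le_trans (ltW ba)).
rewrite U ge0_integral_setU//=; last 3 first.
- apply/measurable_funU => //; split; apply/measurable_EFinP.
    apply: (eq_measurable_fun f0).
      move=> x; rewrite inE/= in_itv/= => /andP[bx xa].
      by rewrite fE0// (le_trans b0).
    apply: measurable_continuous_itv => x /andP[bx xa].
    by apply: cf0; rewrite (le_trans b0).
  apply: (eq_measurable_fun f1).
    move=> x; rewrite inE/= in_itv/= => /andP[ax xc].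
    by rewrite fE1// ax (lt_le_trans xc).
  apply: measurable_continuous_itv => x /andP[ax xc].
  by apply: cf1; rewrite ax (le_trans xc).
- move=> x [|] /=; rewrite in_itv/= => /andP[bx xa]; rewrite lee_fin f_ge//.
    by rewrite bx (lt_le_trans xa).
  by rewrite xa (le_trans (ltW ba)).
- apply/disj_setPS => x /= []; rewrite !in_itv/= => /andP[_ xa] /andP[ax _].
  by move: (lt_le_trans xa ax); rewrite ltxx.
rewrite (left_ b a b0 (ltW ba) (lexx _)) (right_ a c (lexx _) ac c1) -EFinD.
by congr EFin; rewrite Fa; ring.
Qed.

Let inv_sq_continuous (A B b x : R) : A + B * (b - x) != 0 ->
  {for x, continuous (fun y : R => (A + B * (b - y))^-1 ^+ 2)}.
Proof.
move=> n0.
have h : {for x, continuous (fun y : R => (A + B * (b - y))^-1)}.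
  apply: cvgV => //; apply: cvgD; first exact: cvg_cst.
  apply: cvgM; first exact: cvg_cst.
  by apply: cvgB; [exact: cvg_cst|exact: cvg_id].
rewrite (_ : (fun y => _) = (fun y : R => (A + B * (b - y))^-1 * (A + B * (b - y))^-1)).
  by apply: cvgM; exact: h.
by apply/funext => y; rewrite expr2.
Qed.

Let gq : T -> \bar R := (fun x : T => ((q x)^-1 ^+ 2)%:E) \_ I01.

Let pE (t : R) : 0 <= t <= 1 ->
  (\int[leb]_(x in [set` `[0%R, t[]) gq x = (p t)%:E)%E.
Proof.
move=> /andP[t0 t1]; case/andP: (a01) => a0 a1.
rewrite (eq_integral (fun x : T => ((q x)^-1 ^+ 2)%:E)); last first.
  move=> x; rewrite inE/= in_itv/= => /andP[x0 xt].
  by rewrite /gq patchE mem_set//= in_itv/= x0 (lt_le_trans xt).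
rewrite (@split_integral (fun x => (q x)^-1 ^+ 2)
  (fun x => (D + m1 * (1 - a) + m0 * (a - x))^-1 ^+ 2)
  (fun x => (D + m1 * (1 - x))^-1 ^+ 2) p0 p1)//.
- by rewrite /p a0 p00 subr0.
- by move=> x /andP[x0 xa]; rewrite q_left// ltW.
- by move=> x /andP[ax x1]; rewrite q_right.
- move=> x /andP[x0 xa]; apply: inv_sq_continuous.
  by rewrite -q_left// gt_eqF// (lt_le_trans D_gt0)// q_ge// (le_trans xa) ?ltW.
- move=> x /andP[ax x1]; apply: inv_sq_continuous.
  by rewrite -q_right// gt_eqF// (lt_le_trans D_gt0)// q_ge.
- by move=> x _; rewrite sqr_ge0.
Qed.

Let p_ge0 t : 0 <= t <= 1 -> 0 <= p t.
Proof.
move=> tI; rewrite -lee_fin -pE//; apply: integral_ge0 => x _.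
by rewrite /gq patchE; case: ifPn => // _; rewrite lee_fin sqr_ge0.
Qed.

Let p_left x : x < a -> p x = p0 x. Proof. by rewrite /p => ->. Qed.
Let p_right x : a <= x -> p x = p1 x. Proof. by rewrite /p ltNge => ->. Qed.
Let d_left x : x < a -> step_density x = m0.
Proof. by rewrite /step_density => ->. Qed.
Let d_right x : a <= x -> step_density x = m1.
Proof. by rewrite /step_density ltNge => ->. Qed.

Let density_integral (f0 f1 F0 F1 : R -> R) :
  (forall x, 0 <= x <= a -> is_derive x 1 F0 (f0 x)) ->
  (forall x, 0 <= x <= a -> {for x, continuous f0}) ->
  (forall x, a <= x <= 1 -> is_derive x 1 F1 (f1 x)) ->
  (forall x, a <= x <= 1 -> {for x, continuous f1}) ->
  (forall x, 0 <= x <= 1 -> 0 <= (if x < a then f0 x else f1 x)) ->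
  F0 a = F1 a ->
  (\int[leb]_(x in I01) ((if x < a then f0 x else f1 x)%:E * (step_density x)%:E)
   = (m1 * (F1 1 - F1 a) + m0 * (F0 a - F0 0))%:E)%E.
Proof.
move=> dF0 cf0 dF1 cf1 f_ge Fa; case/andP: (a01) => a0 a1.
under eq_integral do rewrite -EFinM.
have H0 x : 0 <= x <= a -> is_derive x 1 (fun x => m0 * F0 x) (m0 * f0 x).
  by move=> xI; have := dF0 x xI => ?; apply: is_derive_eq; rewrite /GRing.scale/=; ring.
have H1 x : a <= x <= 1 ->
    is_derive x 1 (fun x => m1 * F1 x + (m0 - m1) * F1 a) (m1 * f1 x).
  move=> xI; have := dF1 x xI => ?; apply: is_derive_eq.
  by rewrite /GRing.scale/=; ring.
rewrite (@split_integral _ (fun x => m0 * f0 x) (fun x => m1 * f1 x)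
   (fun x => m0 * F0 x) (fun x => m1 * F1 x + (m0 - m1) * F1 a))//.
- rewrite a0 ltNge (ltW a1)/= Fa; congr EFin; ring.
- by move=> x /andP[x0 xa]; rewrite d_left// xa mulrC.
- by move=> x /andP[ax x1]; rewrite d_right// ltNge ax mulrC.
- by move=> x xI; apply: cvgM; [exact: cvg_cst|exact: cf0].
- by move=> x xI; apply: cvgM; [exact: cvg_cst|exact: cf1].
- rewrite Fa; ring.
- move=> x /andP[x0 x1]; rewrite mulr_ge0//; first by rewrite f_ge// x0 ltW.
  by rewrite /step_density; case: ifP.
Qed.

(** P0 and P1 are the two pieces of the double primitive of the inverse square of the tail, and
    p0 and p1 those of its derivative. The comparison of integrals of derivatives over [y, 1[
    becomes P >= xi, because both sides agree at 1. A single statement covers densities without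
    jump, for which a is an arbitrary subdivision point. *)
Lemma step_kRSB : is_kRSB xi (m0 < m1)%R.+1.
Proof.
case/andP: (a01) => a0 a1.
exists step_measure, step_density, D, jump_measure; split.
- apply: (parisi_measure_criterion step_measure_form _ _ cq) => //.
  + rewrite derive1_xi; exact: continuous_measurable_fun.
  + by rewrite derive1_xi.
  + by move=> x /andP[x0 x1]; rewrite (lt_le_trans D_gt0)// q_ge// ltW.
  + exact: step_tailE.
  + move=> y /andP[y0 y1].
    rewrite (eq_integral (fun x : T => (p x)%:E)); last first.
      move=> x; rewrite inE/= in_itv/= => /andP[yx x1]; apply: pE.
      by rewrite (le_trans y0)//= ltW.
    rewrite (@split_integral p p0 p1 P0 P1) ?(ltW y1)//; last 5 first.
    * by move=> x /andP[_ xa]; exact: p_left.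
    * by move=> x /andP[xa _]; exact: p_right.
    * by move=> x xI; exact: (cder (dp0 xI)).
    * by move=> x xI; exact: (cder (dp1 xI)).
    * move=> x /andP[yx x1]; apply: p_ge0; by rewrite (le_trans y0)//= ltW.
    rewrite derive1_xi (@integral_derivative _ xi xi1) ?(ltW y1)//; last first.
      by move=> x _; exact: cxi1.
    rewrite ltNge (ltW a1)/= P11 lee_fin lerD2l lerN2.
    case: ltP => ya; first by apply: P0_ge; rewrite y0 ltW.
    by apply: P1_ge; rewrite ya ltW.
  + by rewrite derive1_xi -p11 pE ?ler01 ?lexx// p_right// ltW.
  + rewrite derive1_xi.
    rewrite (eq_integral
      (fun x : T => (if x < a then p0 x else p1 x)%:E * (step_density x)%:E)%E); last first.
      move=> x; rewrite inE/= in_itv/= => /andP[x0 x1].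
      by congr (_ * _)%E; apply: pE; rewrite x0 ltW.
    rewrite (@density_integral p0 p1 P0 P1)//; last 2 first.
    * by move=> x xI; exact: (cder (dp0 xI)).
    * by move=> x xI; exact: (cder (dp1 xI)).
    rewrite [RHS](eq_integral
      (fun x : T => (if x < a then xi1 x else xi1 x)%:E * (step_density x)%:E)%E); last first.
      by move=> x _; rewrite if_same.
    rewrite (@density_integral xi1 xi1 xi xi)//; last 3 first.
    * by move=> x _; exact: cxi1.
    * by move=> x _; exact: cxi1.
    * by move=> x xI; rewrite if_same xi1_ge0.
    congr EFin; rewrite P11 P00 -P0a.
    move: m01; rewrite le_eqVlt => /predU1P[->|/Pxia ->//]; ring.
  + apply: (@le_lt_trans _ _ (\int[leb]_(x in I01) (D^-1)%:E)%E).
      apply: ge0_le_integral => //.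
      * move=> x /=; rewrite in_itv/= => /andP[_ x1].
        by rewrite lee_fin invr_ge0 (le_trans D_ge0)// q_ge// ltW.
      * apply/measurable_EFinP; apply: measurable_continuous_itv => x /andP[_ x1].
        apply: cvgV; last exact: cq.
        by rewrite gt_eqF// (lt_le_trans D_gt0)// q_ge.
      * move=> x /=; rewrite in_itv/= => /andP[_ x1].
        by rewrite lee_fin lef_pV2 ?posrE ?q_ge ?(ltW x1)// (lt_le_trans D_gt0)// q_ge// ltW.
    rewrite integral_cst//.
    rewrite [X in (_ * X)%E](_ : _ = 1%E) ?mule1 ?ltry//.
    apply: etrans; first exact: (lebesgue_measure_itv `[(0:R), 1[).
    by rewrite /= lte_fin ltr01 -EFinB subr0.
- exact: step_measure_form.
- exact: jump_measure_cdf.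
- exact: jump_measure_support.
Qed.

End TwoStep.

(** * Calculus and the series of -ln (1 - u) - u *)

Section Calculus.
Context {R : realType}.
Implicit Types (f df : R -> R) (a b x y : R).

Lemma is_derive_continuous f x d : is_derive x 1 f d -> {for x, continuous f}.
Proof.
by move=> df; apply: differentiable_continuous; apply/derivable1_diffP; case: df.
Qed.

Lemma within_continuous f a b :
  (forall x, a <= x <= b -> {for x, continuous f}) -> {within `[a, b], continuous f}.
Proof.
by move=> cf; apply: continuous_in_subspaceT => x; rewrite inE/= in_itv/=; exact: cf.
Qed.

Lemma mean_value f df a b : a < b ->
  (forall x, a <= x <= b -> is_derive x 1 f (df x)) ->
  exists2 x, a < x < b & f b - f a = df x * (b - a).
Proof.
move=> ab dfx; have [||x] := @MVT R f df a b ab.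
- by move=> x; rewrite in_itv/= => /andP[ax xb]; apply: dfx; rewrite !ltW.
- by apply: within_continuous => x xI; exact: is_derive_continuous (dfx x xI).
by rewrite in_itv/=; exists x.
Qed.

Lemma derive_pos_lt f df a b : a < b ->
  (forall x, a <= x <= b -> is_derive x 1 f (df x)) ->
  (forall x, a < x < b -> 0 < df x) -> f a < f b.
Proof.
move=> ab dfx pos; have [x xI E] := mean_value ab dfx.
by rewrite -subr_gt0 E mulr_gt0 ?pos// subr_gt0.
Qed.

Lemma derive_neg_lt f df a b : a < b ->
  (forall x, a <= x <= b -> is_derive x 1 f (df x)) ->
  (forall x, a < x < b -> df x < 0) -> f b < f a.
Proof.
move=> ab dfx neg; have [x xI E] := mean_value ab dfx.
by rewrite -subr_lt0 E pmulr_llt0 ?neg// subr_gt0.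
Qed.

Lemma derive_ge0_le f df a b : a <= b ->
  (forall x, a <= x <= b -> is_derive x 1 f (df x)) ->
  (forall x, a < x < b -> 0 <= df x) -> f a <= f b.
Proof.
rewrite le_eqVlt => /predU1P[->//|ab] dfx pos; have [x xI E] := mean_value ab dfx.
by rewrite -subr_ge0 E mulr_ge0 ?pos// subr_ge0 ltW.
Qed.

Lemma derive_le0_le f df a b : a <= b ->
  (forall x, a <= x <= b -> is_derive x 1 f (df x)) ->
  (forall x, a < x < b -> df x <= 0) -> f b <= f a.
Proof.
rewrite le_eqVlt => /predU1P[->//|ab] dfx neg; have [x xI E] := mean_value ab dfx.
by rewrite -subr_le0 E pmulr_lle0 ?neg// subr_gt0.
Qed.

Lemma intermediate_value f a b v : a <= b ->
  (forall x, a <= x <= b -> {for x, continuous f}) ->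
  (f a <= v <= f b) \/ (f b <= v <= f a) ->
  exists2 x, a <= x <= b & f x = v.
Proof.
move=> ab cf H; have [||x] := @IVT R f a b v ab.
- exact: within_continuous.
- by rewrite ge_min le_max; case: H => /andP[-> ->]; rewrite ?orbT.
by rewrite in_itv/=; exists x.
Qed.

Lemma is_derive_exprn (n : nat) (x : R) :
  is_derive x 1 (fun y : R => y ^+ n) (n%:R * x ^+ n.-1).
Proof.
apply: DeriveDef; first exact: exprn_derivable.
by rewrite exp_derive /GRing.scale/= mulr1.
Qed.

Lemma is_derive_inv f x d : f x != 0 -> is_derive x 1 f d ->
  is_derive x 1 (fun y => (f y)^-1) (- d / (f x) ^+ 2).
Proof.
move=> fx0 df; have := is_deriveV fx0 df.
by move=> h; apply: is_derive_eq; rewrite /GRing.scale/= mulrC mulrN mulNr.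
Qed.

Lemma rise_derive f df a b : a < b ->
  (forall x, a <= x <= b -> is_derive x 1 f (df x)) -> f a < f b ->
  exists2 x, a < x < b & 0 < df x.
Proof.
move=> ab dfx; have [x xI E] := mean_value ab dfx.
by rewrite -subr_gt0 E pmulr_lgt0 ?subr_gt0//; exists x.
Qed.

Lemma fall_derive f df a b : a < b ->
  (forall x, a <= x <= b -> is_derive x 1 f (df x)) -> f b < f a ->
  exists2 x, a < x < b & df x < 0.
Proof.
move=> ab dfx; have [x xI E] := mean_value ab dfx.
by rewrite -subr_lt0 E pmulr_llt0 ?subr_gt0//; exists x.
Qed.

Lemma inv_sqr_lt x y : 0 < x -> 0 < y -> (x^-1 ^+ 2 < y^-1 ^+ 2) = (y < x).
Proof. by move=> x0 y0; rewrite ltr_pXn2r ?nnegrE ?invr_ge0 ?ltW// ltf_pV2. Qed.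

(** The last crossing, rather than any crossing, gives the sign of f - v up to b. *)
Lemma last_crossing f a b v : a <= b ->
  (forall x, a <= x <= b -> {for x, continuous f}) -> v <= f a -> f b < v ->
  exists c, [/\ a <= c, c < b, f c = v & forall x, c < x <= b -> f x < v].
Proof.
move=> ab cf fa fb; pose S : set R := [set x | a <= x <= b /\ v <= f x].
have Sa : S a by rewrite /S/= lexx ab.
have hS : has_sup S by split; [exists a|exists b => x [/andP[]]].
have ac : a <= sup S by apply: ub_le_sup => //; case: hS.
have cb : sup S <= b by apply: ge_sup => [|x [/andP[]]//]; exists a.
have after x : sup S < x <= b -> f x < v.
  move=> /andP[cx xb]; rewrite ltNge; apply/negP => fx.
  have : x <= sup S.
    by apply: ub_le_sup; [case: hS|split => //; rewrite xb (le_trans ac)// ltW].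
  by apply/negP; rewrite -ltNge.
have fc : v <= f (sup S).
  rewrite leNgt; apply/negP => fc.
  have cfc : {for sup S, continuous f} by apply: cf; rewrite ac cb.
  have : \forall t \near sup S, f t < v by exact: (cvgr_lt _ cfc _ fc).
  move=> [e /= e0 He].
  have [x [xI fx] ex] := sup_adherent e0 hS.
  have xc : x <= sup S by apply: ub_le_sup; [case: hS|split].
  have : f x < v by apply: He; rewrite /= ger0_norm ?subr_ge0//; lra.
  by apply/negP; rewrite -leNgt.
have fbc : f b <= v <= f (sup S) by rewrite (ltW fb).
have [|z /andP[cz zb] fz] := intermediate_value cb _ (or_intror fbc).
  by move=> x /andP[cx xb]; apply: cf; rewrite xb (le_trans ac).
have zc : z = sup S.
  apply/le_anti; rewrite cz andbT leNgt; apply/negP => h.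
  by have := after z; rewrite h zb fz ltxx => /(_ isT).
exists (sup S); split => //; last by rewrite -zc.
by rewrite lt_neqAle cb andbT; apply/eqP => h; move: fb; rewrite -h; lra.
Qed.

End Calculus.

Section LogSeries.
Context {R : realType}.
Implicit Types u t : R.

(** The series of u^n / n over n >= 2. Its derivative vanishes at 0 and its second derivative is
    (1 - u)^(-2), the inverse square of a linear function. *)
Definition logser u : R := - ln (1 - u) - u.

Lemma is_derive_logser u : u < 1 -> is_derive u 1 logser (u / (1 - u)).
Proof.
move=> u1; have u1' : 0 < 1 - u by rewrite subr_gt0.
have d1 : is_derive u 1 (fun y : R => 1 - y) (-1).
  by apply: is_derive_eq; ring.
have d2 := @is_derive1_comp R (@ln R) (fun y : R => 1 - y) u _ _ (is_derive1_ln u1') d1.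
rewrite /logser; apply: is_derive_eq.
rewrite /GRing.scale/=; field.
by rewrite gt_eqF.
Qed.

Lemma logser0 : logser 0 = 0. Proof. by rewrite /logser !subr0 ln1 oppr0. Qed.

Lemma logser_gt u : 0 < u < 1 -> u ^+ 2 / 2 < logser u.
Proof.
move=> /andP[u0 u1].
have := @derive_pos_lt R (fun y => logser y - y ^+ 2 / 2) (fun y => y ^+ 2 / (1 - y)) 0 u u0.
rewrite logser0 expr0n/= mul0r subr0 subr_gt0; apply.
- move=> x /andP[x0 xu]; have x1 : x < 1 by exact: le_lt_trans u1.
  have ? := is_derive_logser x1; have ? := is_derive_exprn 2 x.
  by apply: is_derive_eq; rewrite /GRing.scale/=; field; rewrite subr_eq0 gt_eqF.
- move=> x /andP[x0 xu]; rewrite divr_gt0 ?exprn_gt0// subr_gt0.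
  exact: lt_trans u1.
Qed.

Lemma logser_gt0 u : 0 < u < 1 -> 0 < logser u.
Proof.
move=> u01; apply: lt_trans (logser_gt u01); case/andP: u01 => u0 _.
by rewrite divr_gt0// exprn_gt0.
Qed.

Lemma logser_lt u : 0 < u < 1 -> logser u < u ^+ 2 / (1 - u).
Proof.
move=> /andP[u0 u1].
have := @derive_pos_lt R (fun y => y ^+ 2 / (1 - y) - logser y)
  (fun y => y / (1 - y) ^+ 2) 0 u u0.
rewrite logser0 expr0n/= mul0r subrr subr_gt0; apply.
- move=> x /andP[x0 xu]; have x1 : x < 1 by exact: le_lt_trans u1.
  have n0 : 1 - x != 0 by rewrite subr_eq0 gt_eqF.
  have ? := is_derive_logser x1; have ? := is_derive_exprn 2 x.
  have d1 : is_derive x 1 (fun y : R => 1 - y) (-1) by apply: is_derive_eq; ring.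
  have ? := @is_derive_inv R (fun y => 1 - y) x _ n0 d1.
  apply: is_derive_eq.
  by rewrite /GRing.scale/=; field; rewrite subr_eq0 gt_eqF.
- move=> x /andP[x0 xu]; rewrite divr_gt0 ?exprn_gt0// subr_gt0.
  exact: lt_trans u1.
Qed.

(** This inequality is what makes cratio increasing. *)
Lemma logser_logconvex u : 0 < u < 1 -> u ^+ 2 < (2 - u) * logser u.
Proof.
move=> /andP[u0 u1].
have := @derive_pos_lt R (fun y => (2 - y) * logser y - y ^+ 2)
  (fun y => y ^+ 2 / (1 - y) - logser y) 0 u u0.
rewrite logser0 expr0n/= mulr0 subrr subr_gt0; apply.
- move=> x /andP[x0 xu]; have x1 : x < 1 by exact: le_lt_trans u1.
  have ? := is_derive_logser x1; have ? := is_derive_exprn 2 x.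
  apply: is_derive_eq.
  by rewrite /GRing.scale/=; field; rewrite subr_eq0 gt_eqF.
- move=> x /andP[x0 xu]; rewrite subr_gt0 logser_lt// x0.
  exact: lt_trans u1.
Qed.

Lemma logser_lt_half u : 0 < u < 1 -> 2 * (1 - u) * logser u < u ^+ 2.
Proof.
move=> /andP[u0 u1].
have := @derive_pos_lt R (fun y => y ^+ 2 - 2 * (1 - y) * logser y)
  (fun y => 2 * logser y) 0 u u0.
rewrite logser0 expr0n/= mulr0 subrr subr_gt0; apply.
- move=> x /andP[x0 xu]; have x1 : x < 1 by exact: le_lt_trans u1.
  have ? := is_derive_logser x1; have ? := is_derive_exprn 2 x.
  apply: is_derive_eq.
  by rewrite /GRing.scale/=; field; rewrite subr_eq0 gt_eqF.
- move=> x /andP[x0 xu]; rewrite mulr_gt0// logser_gt0// x0.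
  exact: lt_trans u1.
Qed.

(** The local exponent u R'(u) / R(u) of R = logser. *)
Definition cratio u := u ^+ 2 / ((1 - u) * logser u).

Lemma is_derive_cratio u : 0 < u < 1 ->
  is_derive u 1 cratio
    (u * ((2 - u) * logser u - u ^+ 2) / ((1 - u) * logser u) ^+ 2).
Proof.
move=> u01; have /andP[u0 u1] := u01.
have R0 : logser u != 0 by rewrite gt_eqF// logser_gt0.
have n0 : 1 - u != 0 by rewrite subr_eq0 gt_eqF.
have nn : (1 - u) * logser u != 0 by rewrite mulf_neq0.
have ? := is_derive_logser u1; have ? := is_derive_exprn 2 u.
have d1 : is_derive u 1 (fun y : R => (1 - y) * logser y) (u - logser u).
  by apply: is_derive_eq; rewrite /GRing.scale/=; field.
have ? := @is_derive_inv R (fun y => (1 - y) * logser y) u _ nn d1.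
apply: is_derive_eq.
by rewrite /GRing.scale/=; field; rewrite R0 n0.
Qed.

Lemma cratio_lt u v : 0 < u -> u < v -> v < 1 -> cratio u < cratio v.
Proof.
move=> u0 uv v1; apply: (derive_pos_lt uv).
  by move=> x /andP[ux xv]; apply: is_derive_cratio; rewrite (lt_le_trans u0)//= (le_lt_trans xv).
move=> x /andP[ux xv]; have x01 : 0 < x < 1.
  by rewrite (lt_trans u0)//= (lt_trans xv).
case/andP: (x01) => x0 x1.
have R0 := logser_gt0 x01; have R1 := logser_logconvex x01.
by rewrite divr_gt0 ?exprn_gt0 ?mulr_gt0// subr_gt0.
Qed.

Lemma cratio_ltE u v : 0 < u < 1 -> 0 < v < 1 -> (cratio u < cratio v) = (u < v).
Proof.
move=> /andP[u0 u1] /andP[v0 v1]; case: (ltgtP u v) => [uv|vu|->].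
- exact: cratio_lt.
- by apply/negbTE; rewrite -leNgt ltW// cratio_lt.
- by rewrite ltxx.
Qed.

Lemma cratio_leE u v : 0 < u < 1 -> 0 < v < 1 -> (cratio u <= cratio v) = (u <= v).
Proof. by move=> u01 v01; rewrite !leNgt cratio_ltE. Qed.

Lemma cratio_gt2 u : 0 < u < 1 -> 2 < cratio u.
Proof.
move=> u01; case/andP: (u01) => u0 u1.
have R0 := logser_gt0 u01.
rewrite /cratio ltr_pdivlMr; last by rewrite mulr_gt0// subr_gt0.
by rewrite mulrA; exact: logser_lt_half.
Qed.

(** cratio increases from 2 to infinity; for targets above 3 the search can start at 1 / 4. *)
Lemma cratio_surj t : 3 <= t -> exists2 u, 0 < u < 1 & cratio u = t.
Proof.
move=> t3.
have q01 : 0 < (4^-1 : R) < 1 by rewrite invr_gt0 invf_lt1// ltr1n andbT.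
have lo : cratio 4^-1 <= t.
  apply: le_trans t3.
  rewrite /cratio ler_pdivrMr; last first.
    by rewrite mulr_gt0 ?logser_gt0// subr_gt0; case/andP: q01.
  have := logser_gt q01; lra.
(* u = 1 - exp (- tau) makes 1 / (1 - u) exponentially larger than logser u *)
pose tau := 8 * t.
have tau0 : 0 < tau by rewrite /tau; lra.
pose v := 1 - expR (- tau).
have ev : expR (- tau) <= tau^-1.
  rewrite expRN lef_pV2 ?posrE ?expR_gt0//.
  by have := expR_ge1Dx tau; lra.
have tauV : tau^-1 <= 24^-1 by rewrite lef_pV2 ?posrE// /tau; lra.
have v01 : 0 < v < 1.
  have := expR_gt0 (- tau); rewrite /v => ?; apply/andP; split; lra.
have hi : t <= cratio v.
  rewrite /cratio ler_pdivlMr; last first.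
    by rewrite mulr_gt0 ?logser_gt0// subr_gt0; case/andP: v01.
  have Rv : logser v <= tau.
    have E : 1 - v = expR (- tau) by rewrite /v; ring.
    rewrite /logser E expRK opprK; case/andP: v01; lra.
  have E1 : expR (- tau) * tau ^+ 2 <= 4.
    have := expR_gt0 (tau / 2); have := expR_ge1Dx (tau / 2) => h1 h2.
    have -> : expR (- tau) = (expR (tau / 2) ^- 2).
      by rewrite expRN; congr (_^-1); rewrite -expRM_natl; congr expR; field.
    rewrite mulrC ler_pdivrMr ?exprn_gt0//; nra.
  have -> : 1 - v = expR (- tau) by rewrite /v; ring.
  have E0 := expR_gt0 (- tau).
  have E2 : expR (- tau) * logser v <= expR (- tau) * tau by rewrite ler_pM2l.
  have E3 : t * (expR (- tau) * logser v) <= t * (expR (- tau) * tau).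
    by rewrite ler_pM2l//; lra.
  apply: (le_trans E3).
  have -> : t * (expR (- tau) * tau) = (expR (- tau) * tau ^+ 2) / 8.
    by rewrite /tau; field.
  have : (23 / 24) ^+ 2 <= v ^+ 2.
    by rewrite ler_pXn2r ?nnegrE// /v; lra.
  lra.
have [|||u uI E] := @intermediate_value R cratio 4^-1 v t.
- by rewrite /v; lra.
- move=> x /andP[x0 xv]; apply: is_derive_continuous; apply: is_derive_cratio.
  case/andP: v01 => _ v1; rewrite (le_lt_trans xv v1) andbT.
  by apply: lt_le_trans x0; case/andP: q01.
- by left; rewrite lo hi.
exists u => //; case/andP: uI => x0 xv; case/andP: v01 => _ v1.
rewrite (le_lt_trans xv v1) andbT.
by apply: lt_le_trans x0; case/andP: q01.
Qed.

Variables p s : R.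

(** This is (theta - p) (theta - s) logser, where theta = u d/du: it vanishes when the local
    second-order behaviour of logser is that of a combination of u^p and u^s. *)
Definition curv u : R := u ^+ 2 * (2 - u) / (1 - u) ^+ 2
  - (s + p) * (u ^+ 2 / (1 - u)) + s * p * logser u.

Let quad u := 4 - 3 * u + u ^+ 2 - (s + p) * ((2 - u) * (1 - u)) + s * p * (1 - u) ^+ 2.

Lemma curvE u : 0 < u < 1 ->
  curv u = logser u * (cratio u * (1 + (1 - u)^-1) - (s + p) * cratio u + s * p).
Proof.
move=> u01; have /andP[u0 u1] := u01; rewrite /curv /cratio; field.
by rewrite gt_eqF ?logser_gt0//= subr_eq0 gt_eqF.
Qed.

(** With c = cratio, the quotient curv / logser is (c - p) (c - s) + u c', and c increases. *)
Lemma curv_gt0 u : 0 < u < 1 -> 0 <= (cratio u - p) * (cratio u - s) -> 0 < curv u.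
Proof.
move=> u01 cps; have /andP[u0 u1] := u01; rewrite curvE// pmulr_rgt0 ?logser_gt0//.
have c0 : 2 < cratio u := cratio_gt2 u01.
have c1 : cratio u < 1 + (1 - u)^-1.
  have -> : 1 + (1 - u)^-1 = (2 - u) / (1 - u).
    by field; rewrite subr_eq0 gt_eqF.
  rewrite /cratio ltr_pdivrMr; last by rewrite mulr_gt0 ?logser_gt0// subr_gt0.
  rewrite mulrA divfK ?subr_eq0 ?gt_eqF//.
  exact: logser_logconvex.
nra.
Qed.

Lemma is_derive_curv u : u < 1 ->
  is_derive u 1 curv (u * quad u / (1 - u) ^+ 3).
Proof.
move=> u1; have n0 : 1 - u != 0 by rewrite subr_eq0 gt_eqF.
have n2 : (1 - u) ^+ 2 != 0 by rewrite expf_neq0.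
have ? := is_derive_logser u1; have ? := is_derive_exprn 2 u.
have d1 : is_derive u 1 (fun y : R => 1 - y) (-1) by apply: is_derive_eq; ring.
have ? := @is_derive_inv R (fun y => 1 - y) u _ n0 d1.
have d2 : is_derive u 1 (fun y : R => (1 - y) ^+ 2) (- 2 * (1 - u)).
  rewrite (_ : (fun y : R => (1 - y) ^+ 2) = (fun y : R => (1 - y) * (1 - y))); last first.
    by apply/funext => y; rewrite expr2.
  by apply: is_derive_eq; rewrite /GRing.scale/=; ring.
have ? := @is_derive_inv R (fun y => (1 - y) ^+ 2) u _ n2 d2.
apply: is_derive_eq.
by rewrite /GRing.scale/= /quad; field.
Qed.

Lemma curv0 : curv 0 = 0.
Proof. by rewrite /curv logser0 expr0n/= !mul0r !mulr0 subrr addr0. Qed.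

(** The derivative of curv is u quad u / (1 - u)^3. By Rolle's theorem, starting from the zero
    of curv at 0, the quadratic polynomial quad would have three zeros; but quad 1 = 2. *)
Let curv_three_zeros x1 x2 x3 : 0 < x1 -> x1 < x2 -> x2 < x3 -> x3 < 1 ->
  curv x1 = 0 -> curv x2 = 0 -> curv x3 = 0 -> False.
Proof.
move=> x10 x12 x23 x31 E1 E2 E3.
have zero a b : 0 <= a -> a < b -> b < 1 -> curv a = 0 -> curv b = 0 ->
    exists2 z, a < z < b & quad z = 0.
  move=> a0 ab b1 Ea Eb.
  have [|z zI] := @mean_value R curv (fun u => u * quad u / (1 - u) ^+ 3) a b ab.
    by move=> x /andP[ax xb]; apply: is_derive_curv; exact: le_lt_trans b1.
  rewrite Ea Eb subrr => /esym/eqP E0; exists z => //.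
  case/andP: zI => az zb; have z0 : 0 < z by exact: le_lt_trans az.
  have z1 : z < 1 by exact: lt_trans b1.
  move: E0; rewrite !mulf_eq0 subr_eq0 gt_eqF//= invr_eq0 expf_eq0/= subr_eq0.
  by rewrite [1 == z]gt_eqF// (gt_eqF ab) !orbF => /eqP.
have x11 : x1 < 1 by lra.
have x21 : x2 < 1 by lra.
have [z1 /andP[? ?] Z1] := zero 0 x1 (lexx _) x10 x11 curv0 E1.
have [z2 /andP[? ?] Z2] := zero x1 x2 (ltW x10) x12 x21 E1 E2.
have [z3 /andP[? ?] Z3] := zero x2 x3 (ltW (lt_trans x10 x12)) x23 x31 E2 E3.
pose A := 1 + s * p - (s + p).
pose B := 3 * (s + p) - 3 - 2 * (s * p).
pose C := 4 - 2 * (s + p) + s * p.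
have qE z : quad z = A * z ^+ 2 + B * z + C by rewrite /quad /A /B /C; ring.
have D12 : A * (z1 + z2) + B = 0.
  have : (A * (z1 + z2) + B) * (z1 - z2) = quad z1 - quad z2 by rewrite !qE; ring.
  rewrite Z1 Z2 subrr => /eqP; rewrite mulf_eq0 subr_eq0 => /orP[/eqP //|/eqP ?]; exfalso; lra.
have D23 : A * (z2 + z3) + B = 0.
  have : (A * (z2 + z3) + B) * (z2 - z3) = quad z2 - quad z3 by rewrite !qE; ring.
  rewrite Z2 Z3 subrr => /eqP; rewrite mulf_eq0 subr_eq0 => /orP[/eqP //|/eqP ?]; exfalso; lra.
have A0 : A = 0.
  have z13 : z3 - z1 != 0 by rewrite gt_eqF// subr_gt0; lra.
  have : A * (z3 - z1) = 0 by lra.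
  by move=> /eqP; rewrite mulf_eq0 (negPf z13) orbF => /eqP.
have B0 : B = 0 by move: D12; rewrite A0; lra.
have C0 : C = 0 by move: Z1; rewrite qE A0 B0; lra.
by move: A0 B0 C0; rewrite /A /B /C; lra.
Qed.

(** curv is positive where the local exponent of logser is p or s, so it has a zero on each side
    of us, and no further one. *)
Lemma curv_pattern us : 3 <= p -> p < s -> 0 < us < 1 -> curv us < 0 ->
  exists kb ka, [/\ 0 < kb, kb < us, us < ka, ka < 1 &
    [/\ forall u, 0 < u < kb -> 0 < curv u,
        forall u, kb < u < ka -> curv u < 0,
        forall u, ka < u < 1 -> 0 < curv u &
        curv kb = 0 /\ curv ka = 0]].
Proof.
move=> p3 ps us01 neg.
have cc x : x < 1 -> {for x, continuous curv}.
  by move=> x1; exact: is_derive_continuous (is_derive_curv x1).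
have [kp kp01 Ep] := cratio_surj p3.
have [ks ks01 Es] := cratio_surj (le_trans p3 (ltW ps)).
have Mp : 0 < curv kp by apply: curv_gt0; rewrite // Ep subrr mul0r.
have Ms : 0 < curv ks by apply: curv_gt0; rewrite // Es subrr mulr0.
have cus : p < cratio us < s.
  have : ~ (0 <= (cratio us - p) * (cratio us - s)).
    by move=> /(curv_gt0 us01) h; move: (lt_trans h neg); rewrite ltxx.
  move=> /negP; rewrite -ltNge => h; apply/andP; split; nra.
have kpu : kp < us by rewrite -cratio_ltE// Ep; case/andP: cus.
have kus : us < ks by rewrite -cratio_ltE// Es; case/andP: cus.
case/andP: us01 => us0 us1; case/andP: kp01 => kp0 kp1; case/andP: ks01 => ks0 ks1.
have [||kb kbI Eb] := @intermediate_value R curv kp us 0 (ltW kpu).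
- by move=> x /andP[_ xu]; apply: cc; exact: le_lt_trans us1.
- by right; rewrite !ltW.
have [||ka kaI Ea] := @intermediate_value R curv us ks 0 (ltW kus).
- by move=> x /andP[_ xu]; apply: cc; exact: le_lt_trans ks1.
- by left; rewrite !ltW.
case/andP: kbI => kb1 kb2; case/andP: kaI => ka1 ka2.
have kbu : kb < us by rewrite lt_neqAle kb2 andbT; apply/eqP => E; move: neg; rewrite -E Eb ltxx.
have kua : us < ka by rewrite lt_neqAle ka1 andbT; apply/eqP => E; move: neg; rewrite E Ea ltxx.
have kpb : kp < kb by rewrite lt_neqAle kb1 andbT; apply/eqP => E; move: Mp; rewrite E Eb ltxx.
have kas : ka < ks by rewrite lt_neqAle ka2 andbT; apply/eqP => E; move: Ms; rewrite -E Ea ltxx.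
exists kb, ka; split => //; try lra.
(* a further sign change would give a third zero *)
have nz x : 0 < x -> x < 1 -> x != kb -> x != ka -> curv x != 0.
  move=> x0 x1 xb xa; apply/eqP => E.
  have [x_b|b_x|] := ltgtP x kb; last by move/eqP; rewrite (negPf xb).
    by apply: (@curv_three_zeros x kb ka) => //; lra.
  have [x_a|a_x|] := ltgtP x ka; last by move/eqP; rewrite (negPf xa).
    by apply: (@curv_three_zeros kb x ka) => //; lra.
  by apply: (@curv_three_zeros kb ka x) => //; lra.
have same x y : 0 < x -> x < y -> y < 1 ->
    (forall z, x <= z <= y -> z != kb /\ z != ka) -> (0 < curv x) = (0 < curv y).
  move=> x0 xy y1 H.
  have nzz z : x <= z <= y -> curv z != 0.
    move=> zI; have [h1 h2] := H z zI; case/andP: zI => xz zy.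
    by apply: nz => //; lra.
  have hx : curv x != 0 by apply: nzz; lra.
  have hy : curv y != 0 by apply: nzz; lra.
  have cxy z : x <= z <= y -> {for z, continuous curv}.
    by move=> /andP[_ zy]; apply: cc; lra.
  apply/idP/idP => h; rewrite lt_neqAle eq_sym ?hx ?hy/= leNgt; apply/negP => h'.
    have [|z zI /eqP] := @intermediate_value R curv x y 0 (ltW xy) cxy.
      by right; rewrite !ltW.
    by rewrite (negPf (nzz z zI)).
  have [|z zI /eqP] := @intermediate_value R curv x y 0 (ltW xy) cxy.
    by left; rewrite !ltW.
  by rewrite (negPf (nzz z zI)).
split=> // u /andP[u1 u2].
- have [->//|] := eqVneq u kp; rewrite neq_lt => /orP[h|h].
    by rewrite (same u kp)//; try lra; move=> z /andP[? ?]; split; apply/eqP => ?; lra.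
  by rewrite -(same kp u)//; try lra; move=> z /andP[? ?]; split; apply/eqP => ?; lra.
- have nzu : curv u != 0 by apply: nz; try lra; apply/eqP => ?; lra.
  rewrite lt_neqAle nzu leNgt/=; apply/negP => h.
  move: neg; apply/negP; rewrite -leNgt ltW//.
  have [->//|] := eqVneq us u; rewrite neq_lt => /orP[h'|h'].
    by rewrite (same us u)//; try lra; move=> z /andP[? ?]; split; apply/eqP => ?; lra.
  by rewrite -(same u us)//; try lra; move=> z /andP[? ?]; split; apply/eqP => ?; lra.
- have [->//|] := eqVneq u ks; rewrite neq_lt => /orP[h|h].
    by rewrite (same u ks)//; try lra; move=> z /andP[? ?]; split; apply/eqP => ?; lra.
  by rewrite -(same ks u)//; try lra; move=> z /andP[? ?]; split; apply/eqP => ?; lra.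
Qed.

End LogSeries.

(** * Comparing a rescaled log series with the mixture *)

Section MixtureRatio.
Context {R : realType}.
Variables p s : nat.
Hypotheses (p_gt2 : (2 < p)%N) (p_lt_s : (p < s)%N).
Implicit Types lam kap x : R.

Notation mix := (@mixture R p s).
Notation pr := (p%:R : R).
Notation sr := (s%:R : R).
Notation curvps := (@curv R pr sr).

Let pr3 : 3 <= pr. Proof. by rewrite ler_nat. Qed.
Let psr : pr < sr. Proof. by rewrite ltr_nat. Qed.

(** The share of the monomial x^p in the value of the mixture at x. By mixture_scale it is also the
    weight of the mixture rescaled from [0, x] to [0, 1]. *)
Definition weight lam x := lam * x ^+ p / mix lam x.
(** The local exponent x xi'(x) / xi(x) of the mixture xi. *)
Definition mexp lam x := sr - (sr - pr) * weight lam x.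

Lemma mixture_gt0 lam x : 0 <= lam <= 1 -> 0 < x -> 0 < mix lam x.
Proof.
move=> /andP[l0 l1] x0; rewrite /mixture.
have xp : 0 < x ^+ p by rewrite exprn_gt0.
have xs : 0 < x ^+ s by rewrite exprn_gt0.
have [->|ln0] := eqVneq lam 0; first by rewrite mul0r add0r subr0 mul1r.
have lp : 0 < lam by rewrite lt_neqAle eq_sym ln0.
by rewrite ltr_pwDl ?mulr_gt0// mulr_ge0 ?subr_ge0// ltW.
Qed.

Lemma mixture1 lam : mix lam 1 = 1.
Proof. by rewrite /mixture !expr1n; ring. Qed.

Lemma weight1 lam : weight lam 1 = lam.
Proof. by rewrite /weight mixture1 expr1n; field. Qed.

Lemma weight_bounds lam x : 0 <= lam <= 1 -> 0 < x -> 0 <= weight lam x <= 1.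
Proof.
move=> l01 x0; have m0 := mixture_gt0 l01 x0; case/andP: l01 => l0 l1.
have xs : 0 <= x ^+ s by rewrite exprn_ge0// ltW.
have xp : 0 <= x ^+ p by rewrite exprn_ge0// ltW.
apply/andP; split; first by rewrite /weight divr_ge0 ?mulr_ge0// ltW.
by rewrite /weight ler_pdivrMr// mul1r /mixture lerDl mulr_ge0// subr_ge0.
Qed.

Lemma mixture_scale lam y x : 0 <= lam <= 1 -> 0 < y ->
  mix lam (x * y) = mix lam y * mix (weight lam y) x.
Proof.
move=> l01 y0; have m0 := mixture_gt0 l01 y0; move: (m0).
rewrite /weight /mixture !exprMn => ?; field.
by rewrite gt_eqF.
Qed.

Lemma mixture_le lam mu x : lam <= mu -> 0 <= x <= 1 -> mix lam x <= mix mu x.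
Proof.
move=> lm /andP[x0 x1]; rewrite /mixture.
have : x ^+ s <= x ^+ p by rewrite ler_wiXn2l// ltnW.
nra.
Qed.

Lemma is_derive_exprn_div n x : x != 0 ->
  is_derive x 1 (fun y : R => y ^+ n) (n%:R * x ^+ n / x).
Proof.
move=> x0; have h := is_derive_exprn n x; apply: is_derive_eq.
by case: n {h} => [|n]; rewrite ?mul0r//= exprS -mulrA [x * _]mulrC mulfK.
Qed.

Lemma is_derive_mixture lam x : x != 0 ->
  is_derive x 1 (mix lam) ((lam * pr * x ^+ p + (1 - lam) * sr * x ^+ s) / x).
Proof.
move=> x0; have ? := is_derive_exprn_div p x0; have ? := is_derive_exprn_div s x0.
rewrite /mixture; apply: is_derive_eq; rewrite /GRing.scale/=; field.
by [].
Qed.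

Lemma is_derive_logserM kap x : kap * x < 1 ->
  is_derive x 1 (fun y => logser (kap * y)) (kap * (kap * x / (1 - kap * x))).
Proof.
move=> k1; have d := is_derive_logser k1.
have d1 : is_derive x 1 (fun y : R => kap * y) kap.
  by apply: is_derive_eq; rewrite /GRing.scale/=; ring.
have h := @is_derive1_comp R logser (fun y : R => kap * y) x _ _ d d1.
by apply: is_derive_eq; rewrite mulrC.
Qed.

(** Up to a positive factor this is the derivative of x -> logser (kap x) / mixture x. The
    normalization makes its own derivative a positive multiple of curv (kap x). *)
Definition tilt lam kap x :=
  lam * ((kap * x) ^+ 2 / (1 - kap * x) - pr * logser (kap * x)) / x ^+ s
  + (1 - lam) * ((kap * x) ^+ 2 / (1 - kap * x) - sr * logser (kap * x)) / x ^+ p.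

Lemma tiltE lam kap x : 0 <= lam <= 1 -> 0 < x -> 0 < kap * x < 1 ->
  tilt lam kap x = logser (kap * x) * mix lam x / (x ^+ s * x ^+ p)
                   * (cratio (kap * x) - mexp lam x).
Proof.
move=> l01 x0 k01; have m0 := mixture_gt0 l01 x0; move: (m0).
rewrite /tilt /mexp /weight /mixture /cratio => ?.
have xp : x ^+ p != 0 by rewrite gt_eqF// exprn_gt0.
have xs : x ^+ s != 0 by rewrite gt_eqF// exprn_gt0.
have L0 : logser (kap * x) != 0 by rewrite gt_eqF// logser_gt0.
have k1 : 1 - kap * x != 0 by case/andP: k01 => _ h; rewrite gt_eqF// subr_gt0.
by field; rewrite xp xs L0 k1 gt_eqF.
Qed.

Lemma tilt_gt0 lam kap x : 0 <= lam <= 1 -> 0 < x -> 0 < kap * x < 1 ->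
  (0 < tilt lam kap x) = (mexp lam x < cratio (kap * x)).
Proof.
move=> l01 x0 k01; rewrite tiltE// pmulr_rgt0 ?subr_gt0//.
by rewrite divr_gt0 ?mulr_gt0 ?exprn_gt0 ?logser_gt0 ?mixture_gt0.
Qed.

Lemma tilt_le0 lam kap x : 0 <= lam <= 1 -> 0 < x -> 0 < kap * x < 1 ->
  (tilt lam kap x <= 0) = (cratio (kap * x) <= mexp lam x).
Proof. by move=> *; rewrite leNgt tilt_gt0// -leNgt. Qed.

Lemma tilt_eq0 lam kap x : 0 <= lam <= 1 -> 0 < x -> 0 < kap * x < 1 ->
  tilt lam kap x = 0 <-> cratio (kap * x) = mexp lam x.
Proof.
move=> l01 x0 k01; rewrite tiltE//; split; last by move=> ->; rewrite subrr mulr0.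
move=> /eqP; rewrite mulf_eq0 subr_eq0 => /orP[|/eqP //].
by rewrite gt_eqF// divr_gt0 ?mulr_gt0 ?exprn_gt0 ?logser_gt0 ?mixture_gt0.
Qed.

Lemma is_derive_tilt lam kap x : 0 < x -> kap * x < 1 ->
  is_derive x 1 (tilt lam kap)
    (curvps (kap * x) * (lam / x ^+ s + (1 - lam) / x ^+ p) / x).
Proof.
move=> x0 k1.
have xn0 : x != 0 by rewrite gt_eqF.
have xp : x ^+ p != 0 by rewrite expf_neq0.
have xs : x ^+ s != 0 by rewrite expf_neq0.
have n0 : 1 - kap * x != 0 by rewrite gt_eqF// subr_gt0.
have ? := is_derive_logserM k1; have ? := is_derive_exprn 2 x.
have d1 : is_derive x 1 (fun y : R => 1 - kap * y) (- kap).
  by apply: is_derive_eq; rewrite /GRing.scale/=; ring.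
have d2 : is_derive x 1 (fun y : R => (kap * y) ^+ 2) (2 * kap ^+ 2 * x).
  rewrite (_ : (fun y : R => (kap * y) ^+ 2) = (fun y : R => kap ^+ 2 * y ^+ 2)); last first.
    by apply/funext => y; rewrite exprMn.
  by apply: is_derive_eq; rewrite /GRing.scale/=; ring.
have ? := @is_derive_inv R (fun y => 1 - kap * y) x _ n0 d1.
have dp := is_derive_exprn_div p xn0; have ds := is_derive_exprn_div s xn0.
have ? := @is_derive_inv R (fun y => y ^+ p) x _ xp dp.
have ? := @is_derive_inv R (fun y => y ^+ s) x _ xs ds.
rewrite /tilt; apply: is_derive_eq.
rewrite /GRing.scale/= /curv; field.
by rewrite xn0 xp xs n0.
Qed.

Definition mratio lam kap x := logser (kap * x) / mix lam x.

Lemma is_derive_mratio lam kap x : 0 <= lam <= 1 -> 0 < x -> kap * x < 1 ->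
  is_derive x 1 (mratio lam kap)
    (tilt lam kap x * (x ^+ s * x ^+ p / x / (mix lam x) ^+ 2)).
Proof.
move=> l01 x0 k1; have m0 := mixture_gt0 l01 x0.
have xn0 : x != 0 by rewrite gt_eqF.
have mn0 : mix lam x != 0 by rewrite gt_eqF.
have xp : x ^+ p != 0 by rewrite expf_neq0.
have xs : x ^+ s != 0 by rewrite expf_neq0.
have n0 : 1 - kap * x != 0 by rewrite gt_eqF// subr_gt0.
have ? := is_derive_logserM k1.
have ? := @is_derive_inv R (mix lam) x _ mn0 (is_derive_mixture lam xn0).
rewrite /mratio; apply: is_derive_eq.
move: mn0; rewrite /GRing.scale/= /tilt /mixture => mn0; field.
by rewrite xn0 xp xs n0 mn0.
Qed.

Let fac_gt0 lam x : 0 <= lam <= 1 -> 0 < x -> 0 < x ^+ s * x ^+ p / x / (mix lam x) ^+ 2.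
Proof. by move=> l01 x0; rewrite !divr_gt0 ?mulr_gt0 ?exprn_gt0// mixture_gt0. Qed.

Let wt_gt0 lam x : 0 <= lam <= 1 -> 0 < x -> 0 < (lam / x ^+ s + (1 - lam) / x ^+ p) / x.
Proof.
move=> l01 x0; have m0 := mixture_gt0 l01 x0.
have -> : (lam / x ^+ s + (1 - lam) / x ^+ p) / x = mix lam x / (x * x ^+ s * x ^+ p).
  rewrite /mixture; field.
  by rewrite !expf_neq0 ?(gt_eqF x0)//= gt_eqF.
by rewrite divr_gt0 ?mulr_gt0 ?exprn_gt0.
Qed.

Lemma tilt_incr lam kap a b : 0 <= lam <= 1 -> 0 < a -> a < b -> 0 < kap -> kap * b < 1 ->
  (forall x, a < x < b -> 0 < curvps (kap * x)) -> tilt lam kap a < tilt lam kap b.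
Proof.
move=> l01 a0 ab k0 k1 pos.
apply: (@derive_pos_lt R (tilt lam kap) (fun x =>
  curvps (kap * x) * (lam / x ^+ s + (1 - lam) / x ^+ p) / x) a b ab).
  move=> x /andP[ax xb]; apply: is_derive_tilt; first exact: lt_le_trans ax.
  by apply: le_lt_trans k1; rewrite ler_pM2l.
move=> x /andP[ax xb]; rewrite -mulrA mulr_gt0 ?pos ?ax ?wt_gt0//.
exact: lt_trans ax.
Qed.

Lemma tilt_decr lam kap a b : 0 <= lam <= 1 -> 0 < a -> a < b -> 0 < kap -> kap * b < 1 ->
  (forall x, a < x < b -> curvps (kap * x) < 0) -> tilt lam kap b < tilt lam kap a.
Proof.
move=> l01 a0 ab k0 k1 neg.
apply: (@derive_neg_lt R (tilt lam kap) (fun x =>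
  curvps (kap * x) * (lam / x ^+ s + (1 - lam) / x ^+ p) / x) a b ab).
  move=> x /andP[ax xb]; apply: is_derive_tilt; first exact: lt_le_trans ax.
  by apply: le_lt_trans k1; rewrite ler_pM2l.
move=> x /andP[ax xb]; rewrite -mulrA pmulr_llt0 ?neg ?ax ?wt_gt0//.
exact: lt_trans ax.
Qed.

Lemma mratio_noninc lam kap a b : 0 <= lam <= 1 -> 0 < a -> a <= b -> 0 < kap -> kap * b < 1 ->
  (forall x, a < x < b -> tilt lam kap x <= 0) -> mratio lam kap b <= mratio lam kap a.
Proof.
move=> l01 a0 ab k0 k1 neg; apply: (derive_le0_le ab).
  move=> x /andP[ax xb]; apply: is_derive_mratio => //; first exact: lt_le_trans ax.
  by apply: le_lt_trans k1; rewrite ler_pM2l.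
move=> x /andP[ax xb]; rewrite pmulr_lle0 ?neg ?ax// fac_gt0//.
exact: lt_trans ax.
Qed.

Lemma mratio_decr lam kap a b : 0 <= lam <= 1 -> 0 < a -> a < b -> 0 < kap -> kap * b < 1 ->
  (forall x, a < x < b -> tilt lam kap x < 0) -> mratio lam kap b < mratio lam kap a.
Proof.
move=> l01 a0 ab k0 k1 neg; apply: (derive_neg_lt ab).
  move=> x /andP[ax xb]; apply: is_derive_mratio => //; first exact: lt_le_trans ax.
  by apply: le_lt_trans k1; rewrite ler_pM2l.
move=> x /andP[ax xb]; rewrite pmulr_llt0 ?neg ?ax// fac_gt0//.
exact: lt_trans ax.
Qed.

Lemma mratio_incr lam kap a b : 0 <= lam <= 1 -> 0 < a -> a < b -> 0 < kap -> kap * b < 1 ->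
  (forall x, a < x < b -> 0 < tilt lam kap x) -> mratio lam kap a < mratio lam kap b.
Proof.
move=> l01 a0 ab k0 k1 pos; apply: (derive_pos_lt ab).
  move=> x /andP[ax xb]; apply: is_derive_mratio => //; first exact: lt_le_trans ax.
  by apply: le_lt_trans k1; rewrite ler_pM2l.
move=> x /andP[ax xb]; rewrite mulr_gt0 ?pos ?ax// fac_gt0//.
exact: lt_trans ax.
Qed.

End MixtureRatio.

(** * The weights for which one slope does not suffice *)

Section FailureSet.
Context {R : realType}.
Variables p s : nat.
Hypotheses (p_gt2 : (2 < p)%N) (p_lt_s : (p < s)%N).
Implicit Types lam kap x k : R.

Notation mix := (@mixture R p s).
Notation pr := (p%:R : R).
Notation sr := (s%:R : R).
Notation curvps := (@curv R pr sr).
Notation tilt := (@tilt R p s).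
Notation mratio := (@mratio R p s).
Notation mexp := (@mexp R p s).
Notation weight := (@weight R p s).

Let pr3 : 3 <= pr. Proof. by rewrite ler_nat. Qed.
Let psr : pr < sr. Proof. by rewrite ltr_nat. Qed.

Variables kb ka : R.
Hypotheses (kb_gt0 : 0 < kb) (kb_lt_ka : kb < ka) (ka_lt1 : ka < 1).
Hypothesis curv_left : forall u, 0 < u < kb -> 0 < curvps u.
Hypothesis curv_mid : forall u, kb < u < ka -> curvps u < 0.
Hypothesis curv_right : forall u, ka < u < 1 -> 0 < curvps u.

(** The tilt increases up to its zero b, so the ratio decreases up to b. *)
Lemma tangent_below lam kap b x : 0 <= lam <= 1 -> 0 < kap -> kap * b <= kb ->
  tilt lam kap b = 0 -> 0 < x <= b -> mratio lam kap b <= mratio lam kap x.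
Proof.
move=> l01 k0 kbb tb /andP[x0 xb].
have [? ? ?] := And3 kb_gt0 kb_lt_ka ka_lt1; have k1 : kap * b < 1 by lra.
apply: mratio_noninc => // y /andP[xy yb]; rewrite -tb ltW//.
apply: tilt_incr => //; first exact: lt_trans xy.
move=> z /andP[yz zb]; apply: curv_left; apply/andP; split.
  by rewrite mulr_gt0//; lra.
by apply: lt_le_trans kbb; rewrite ltr_pM2l.
Qed.

(** The degenerate contact kap a = kb: beyond a the tilt is nonpositive, first because curv is
    negative, then because the tilt increases towards its value at 1. *)
Lemma mratio_inflection lam kap a : 0 <= lam <= 1 -> 0 < kap < 1 -> 0 < a < 1 ->
  kap * a = kb -> tilt lam kap a = 0 -> tilt lam kap 1 <= 0 ->
  mratio lam kap 1 < mratio lam kap a.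
Proof.
have [? ? ?] := And3 kb_gt0 kb_lt_ka ka_lt1.
move=> l01 /andP[k0 k1] /andP[a0 a1] E ta t1.
have kx x : a <= x -> x <= 1 -> 0 < kap * x < 1.
  move=> ax x1; rewrite mulr_gt0//=; last by lra.
  by apply: le_lt_trans k1; rewrite ger_pMr.
have neg x : a < x -> x < 1 -> kap * x <= ka -> tilt lam kap x < 0.
  move=> ax x1 xka; rewrite -ta; apply: tilt_decr => //.
    by have /andP[] := kx x (ltW ax) (ltW x1).
  move=> y /andP[ay yx]; apply: curv_mid; rewrite -E ltr_pM2l// ay/=.
  by apply: lt_le_trans xka; rewrite ltr_pM2l.
have nonpos x : a < x < 1 -> tilt lam kap x <= 0.
  move=> /andP[ax x1]; have [xka|kax] := leP (kap * x) ka; first by rewrite ltW// neg.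
  apply: le_trans t1; rewrite ltW//; apply: tilt_incr => //; try lra.
  move=> y /andP[xy y1]; apply: curv_right; apply/andP; split.
    by apply: lt_trans kax _; rewrite ltr_pM2l.
  by have /andP[] := kx y (ltW (lt_trans ax xy)) (ltW y1).
pose b := Num.min 1 (ka / kap).
have ab : a < b by rewrite lt_min a1/= ltr_pdivlMr// mulrC E.
have b1 : b <= 1 by rewrite ge_min lexx.
have bk : kap * b <= ka by rewrite mulrC -ler_pdivlMr// ge_min lexx orbT.
apply: (@le_lt_trans _ _ (mratio lam kap b)).
  apply: mratio_noninc => //; try lra.
  by move=> x /andP[bx x1]; apply: nonpos; rewrite x1 (lt_trans ab).
apply: mratio_decr => //.
  by have /andP[] := kx b (ltW ab) b1.
move=> x /andP[ax xb]; apply: neg => //; first exact: lt_le_trans b1.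
by apply: le_trans bk; rewrite ler_pM2l// ltW.
Qed.

Let tilt1 lam k : 0 <= lam <= 1 -> 0 < k < 1 -> cratio k = mexp lam 1 -> tilt lam k 1 = 0.
Proof. by move=> l01 k01 E; apply/tilt_eq0; rewrite // mulr1. Qed.

Lemma no_failure lam k x : 0 <= lam <= 1 -> 0 < k -> k <= kb -> cratio k = mexp lam 1 ->
  0 < x <= 1 -> logser k * mix lam x <= logser (k * x).
Proof.
have [? ? ?] := And3 kb_gt0 kb_lt_ka ka_lt1.
move=> l01 k0 kkb E x01; have k1 : k < 1 by lra.
have t1 : tilt lam k 1 = 0 by apply: tilt1; rewrite ?k0.
have := tangent_below l01 k0 _ t1 x01; rewrite mulr1 => /(_ kkb).
rewrite /mratio mixture1 mulr1 divr1 ler_pdivlMr//.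
by apply: mixture_gt0 => //; case/andP: x01.
Qed.

(** Beyond ka / k the tilt increases towards its zero at 1. *)
Lemma tilt_le0_right lam k x : 0 <= lam <= 1 -> 0 < k < 1 -> cratio k = mexp lam 1 ->
  0 < x < 1 -> ka <= k * x -> tilt lam k x <= 0.
Proof.
have [? ? ?] := And3 kb_gt0 kb_lt_ka ka_lt1.
move=> l01 k01 E /andP[x0 x1] kax; rewrite -(tilt1 l01 k01 E) ltW//.
case/andP: k01 => k0 k1.
apply: tilt_incr => //; first by rewrite mulr1.
move=> y /andP[xy y1]; apply: curv_right; apply/andP; split.
  by apply: le_lt_trans kax _; rewrite ltr_pM2l.
by apply: lt_trans k1; rewrite gtr_pMr.
Qed.

Lemma no_failure_right lam k x : 0 <= lam <= 1 -> 0 < k < 1 -> cratio k = mexp lam 1 ->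
  0 < x <= 1 -> ka <= k * x -> logser k * mix lam x <= logser (k * x).
Proof.
have [? ? ?] := And3 kb_gt0 kb_lt_ka ka_lt1.
move=> l01 k01 E /andP[x0 x1] kax; case/andP: (k01) => k0 k1.
have := @mratio_noninc R p s lam k x 1 l01 x0 x1 k0.
rewrite mulr1 => /(_ k1); rewrite /mratio mixture1 mulr1 divr1 ler_pdivlMr; last first.
  by apply: mixture_gt0.
apply=> y /andP[xy y1]; apply: tilt_le0_right => //.
  by rewrite y1 (lt_trans x0).
by apply: le_trans kax _; rewrite ler_pM2l// ltW.
Qed.

(** Between kb / k and 1 the tilt decreases to its zero at 1, so the ratio increases to its end
    value. *)
Lemma failure_mid lam k : 0 <= lam <= 1 -> kb < k -> k <= ka -> cratio k = mexp lam 1 ->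
  exists2 x, 0 < x < 1 & logser (k * x) < logser k * mix lam x.
Proof.
have [? ? ?] := And3 kb_gt0 kb_lt_ka ka_lt1.
move=> l01 kbk kka E; have k0 : 0 < k by lra. have k1 : k < 1 by lra.
have k01 : 0 < k < 1 by rewrite k0.
have b1 : kb / k < 1 by rewrite ltr_pdivrMr// mul1r.
have b0 : 0 < kb / k by rewrite divr_gt0.
have bk : k * (kb / k) = kb by field; rewrite gt_eqF.
exists (kb / k); first by rewrite b0.
have := @mratio_incr R p s lam k (kb / k) 1 l01 b0 b1 k0.
rewrite mulr1 => /(_ k1); rewrite /mratio mixture1 mulr1 divr1 ltr_pdivrMr; last first.
  exact: mixture_gt0.
apply=> x /andP[bx x1]; rewrite -(tilt1 l01 k01 E); apply: tilt_decr => //.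
- exact: lt_trans bx.
- by rewrite mulr1.
- move=> y /andP[xy y1]; apply: curv_mid; apply/andP; split.
    by rewrite -bk ltr_pM2l// (lt_trans bx).
  by apply: lt_le_trans kka; rewrite gtr_pMr.
Qed.

(** A dip cannot occur beyond k' / k, so rescaling [0, k' / k] to [0, 1] keeps it visible. The
    rescaled mixture has a weight of at most lam', and increasing the weight increases the
    mixture. *)
Lemma failure_mono lam k lam' k' x : 0 <= lam <= 1 -> 0 <= lam' <= 1 ->
  0 < k < 1 -> ka <= k' -> k' < k ->
  cratio k = mexp lam 1 -> cratio k' = mexp lam' 1 ->
  0 < x < 1 -> logser (k * x) < logser k * mix lam x ->
  exists2 x', 0 < x' < 1 & logser (k' * x') < logser k' * mix lam' x'.
Proof.
have [? ? ?] := And3 kb_gt0 kb_lt_ka ka_lt1.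
move=> l01 l01' k01 kak' k'k E E' /andP[x0 x1] F.
case/andP: (k01) => k0 k1; have k'0 : 0 < k' by lra.
have kx : k * x < k'.
  rewrite ltNge; apply/negP => h; move: F; apply/negP; rewrite -leNgt.
  by apply: (no_failure_right l01 k01 E _ (le_trans kak' h)); rewrite x0 ltW.
pose y := k' / k.
have y0 : 0 < y by rewrite divr_gt0.
have y1 : y < 1 by rewrite ltr_pdivrMr// mul1r.
have ky : k * y = k' by rewrite /y; field; rewrite gt_eqF.
have My := mixture_gt0 p s l01 y0.
have Ry : logser k * mix lam y <= logser k'.
  rewrite -[X in _ <= logser X]ky; apply: (no_failure_right l01 k01 E); last by rewrite ky.
  by rewrite y0 ltW.
have wy : weight lam y <= lam'.
  have : tilt lam k y <= 0 by apply: (tilt_le0_right l01 k01 E); rewrite ?y0 ?ky.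
  rewrite tilt_le0 ?ky ?k'0//=; last by lra.
  have d : 0 < sr - pr by rewrite subr_gt0.
  by rewrite E' /mexp weight1 => h; rewrite -(ler_pM2l d); lra.
exists (x / y).
  by rewrite divr_gt0//= ltr_pdivrMr// mul1r /y ltr_pdivlMr// mulrC.
have -> : k' * (x / y) = k * x by rewrite /y; field; rewrite !gt_eqF.
apply: (lt_le_trans F).
have xy01 : 0 <= x / y <= 1.
  apply/andP; split; first by rewrite divr_ge0// ltW.
  by rewrite ler_pdivrMr// mul1r /y ler_pdivlMr// mulrC ltW.
have -> : mix lam x = mix lam y * mix (weight lam y) (x / y).
  by rewrite -mixture_scale// divfK// gt_eqF.
rewrite mulrA.
have W := weight_bounds p s l01 y0.
have m0 : 0 <= mix (weight lam y) (x / y).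
  by rewrite ltW// mixture_gt0// divr_gt0.
have mm := mixture_le p_lt_s wy xy01.
have L0 : 0 <= logser k' by rewrite ltW// logser_gt0// k'0; lra.
apply: (@le_trans _ _ (logser k' * mix (weight lam y) (x / y))).
  by rewrite ler_wpM2r.
by rewrite ler_wpM2l.
Qed.

(** The ratio has an interior minimum a below its value at 1. At a with k a >= ka there would be no
    dip, k a = kb is excluded by mratio_inflection, and for k a between kb and ka the ratio would
    decrease further. *)
Lemma failure_tangent lam k xf : 0 <= lam <= 1 -> kb < k -> k < 1 -> cratio k = mexp lam 1 ->
  0 < xf < 1 -> logser (k * xf) < logser k * mix lam xf ->
  exists a, [/\ 0 < a < 1, tilt lam k a = 0, k * a < kb &
                logser (k * a) < logser k * mix lam a].
Proof.
have [? ? ?] := And3 kb_gt0 kb_lt_ka ka_lt1.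
move=> l01 kbk k1 E /andP[xf0 xf1] F; have k0 : 0 < k by lra.
have k01 : 0 < k < 1 by rewrite k0.
have Rk := logser_gt0 k01.
have m1 : mratio lam k 1 = logser k by rewrite /mratio mulr1 mixture1 divr1.
have mf : mratio lam k xf < mratio lam k 1.
  by rewrite m1 /mratio ltr_pdivrMr// mixture_gt0.
(* below e the ratio exceeds its value at 1, since logser u > u^2 / 2 and p > 2 *)
pose e := k ^+ 2 / (2 * logser k).
have e0 : 0 < e by rewrite divr_gt0 ?exprn_gt0 ?mulr_gt0.
have e1 : e < 1.
  by rewrite ltr_pdivrMr ?mulr_gt0// mul1r; have := logser_gt k01; lra.
have small x : 0 < x -> x <= e -> mratio lam k 1 < mratio lam k x.
  move=> x0 xe; have x1 : x < 1 by lra.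
  rewrite m1 /mratio ltr_pdivlMr; last exact: mixture_gt0.
  have kx01 : 0 < k * x < 1.
    by rewrite mulr_gt0//=; apply: lt_trans k1; rewrite gtr_pMr.
  apply: le_lt_trans (logser_gt kx01).
  have mx : mix lam x <= x ^+ 3.
    rewrite /mixture; have : x ^+ p <= x ^+ 3 by rewrite ler_wiXn2l// ltW.
    have : x ^+ s <= x ^+ 3.
      by rewrite ler_wiXn2l ?(ltW x0) ?(ltW x1)//; exact: leq_trans (ltnW p_lt_s).
    case/andP: l01; nra.
  apply: (@le_trans _ _ (logser k * x ^+ 3)); first by rewrite ler_pM2l.
  move: xe; rewrite /e ler_pdivlMr ?mulr_gt0// => xe.
  have -> : (k * x) ^+ 2 / 2 = x ^+ 2 * (k ^+ 2 / 2) by field.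
  have -> : logser k * x ^+ 3 = x ^+ 2 * (x * logser k) by ring.
  by rewrite ler_pM2l ?exprn_gt0//; lra.
have exf : e < xf.
  by rewrite ltNge; apply/negP => /(small xf xf0); apply/negP; rewrite -leNgt ltW.
have kx x : e <= x <= 1 -> 0 < x /\ k * x < 1.
  move=> /andP[ex x1]; split; first lra.
  by apply: le_lt_trans k1; rewrite ger_pMr.
have dm x : e <= x <= 1 -> is_derive x 1 (mratio lam k)
    (tilt lam k x * (x ^+ s * x ^+ p / x / (mix lam x) ^+ 2)).
  by move=> /kx[x0 x1]; apply: is_derive_mratio.
have [a aI amin] : exists2 a, a \in `[e, 1] &
    forall t, t \in `[e, 1] -> mratio lam k a <= mratio lam k t.
  apply: EVT_min; first exact: ltW.
  by apply: within_continuous => x /dm; exact: is_derive_continuous.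
move: aI; rewrite in_itv/= => /andP[ea a1'].
have af : mratio lam k a <= mratio lam k xf by apply: amin; rewrite in_itv/= (ltW exf) (ltW xf1).
have a0 : 0 < a by lra.
have ea' : e < a.
  rewrite lt_neqAle ea andbT; apply/eqP => h; have := small a a0; rewrite -h lexx => /(_ isT).
  by rewrite h; lra.
have a1 : a < 1.
  by rewrite lt_neqAle a1' andbT; apply/eqP => h; move: af mf; rewrite h => ? ?; lra.
have ta : tilt lam k a = 0.
  have aI : a \in `]e, 1[ by rewrite in_itv/= ea'.
  have [|t tI|d E0] := @derive1_at_min R (mratio lam k) e 1 a (ltW e1) _ aI.
  - move=> x; rewrite in_itv/= => /andP[ex x1].
    have xI : e <= x <= 1 by rewrite (ltW ex) (ltW x1).
    by have [] := dm x xI.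
  - by apply: amin; move: tI; rewrite !in_itv/= => /andP[/ltW -> /ltW ->].
  have := @derive_val _ _ _ _ _ _ _ (dm a _); rewrite ea a1' => /(_ isT).
  rewrite E0 => /esym/eqP; rewrite mulf_eq0 => /orP[/eqP//|].
  by rewrite gt_eqF// !divr_gt0 ?mulr_gt0 ?exprn_gt0// mixture_gt0.
have Fa : logser (k * a) < logser k * mix lam a.
  by rewrite -ltr_pdivrMr ?mixture_gt0// -/(mratio lam k a) -m1; lra.
exists a; split => //; first by rewrite a0.
have kak : k * a < k by rewrite gtr_pMr.
rewrite ltNge; apply/negP => h.
have [ka_le|ka_gt] := leP ka (k * a).
  have := @no_failure_right lam k a l01 k01 E; rewrite a0 a1' => /(_ isT ka_le); lra.
move: h; rewrite le_eqVlt => /predU1P[h|h].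
  have := @mratio_inflection lam k a l01 k01; rewrite a0 a1 => /(_ isT (esym h) ta).
  by rewrite (tilt1 l01 k01 E) lexx => /(_ isT); lra.
pose b := Num.min 1 (ka / k).
have ab : a < b by rewrite lt_min a1/= ltr_pdivlMr// mulrC.
have b1 : b <= 1 by rewrite ge_min lexx.
have bk : k * b <= ka by rewrite mulrC -ler_pdivlMr// ge_min lexx orbT.
have : mratio lam k b < mratio lam k a.
  apply: mratio_decr => //; first by lra.
  move=> x /andP[ax xb]; rewrite -ta; apply: tilt_decr => //.
    by apply: lt_trans ka_lt1; apply: lt_le_trans bk; rewrite ltr_pM2l.
  move=> y /andP[ay yx]; apply: curv_mid; apply/andP; split.
    by apply: lt_trans h _; rewrite ltr_pM2l.
  by apply: lt_le_trans bk; rewrite ltr_pM2l//; exact: lt_trans xb.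
by apply/negP; rewrite -leNgt; apply: amin; rewrite in_itv/= b1 andbT; lra.
Qed.

End FailureSet.

Section FailureInterval.
Context {R : realType}.
Variables p s : nat.
Hypotheses (p_gt2 : (2 < p)%N) (p_lt_s : (p < s)%N).
Implicit Types lam kap x k : R.

Notation mix := (@mixture R p s).
Notation pr := (p%:R : R).
Notation sr := (s%:R : R).
Notation curvps := (@curv R pr sr).
Notation tilt := (@tilt R p s).
Notation mexp := (@mexp R p s).
Notation weight := (@weight R p s).

Let pr3 : 3 <= pr. Proof. by rewrite ler_nat. Qed.
Let psr : pr < sr. Proof. by rewrite ltr_nat. Qed.
Let dps : 0 < sr - pr. Proof. by rewrite subr_gt0 ltr_nat. Qed.

(** The one-slope candidate logser (k x) / logser k whose slope at 1 is that of the mixture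
    dips below the mixture. *)
Definition fails lam := exists k, [/\ 0 < k < 1, cratio k = mexp lam 1 &
  exists x, 0 < x < 1 /\ logser (k * x) < logser k * mix lam x].

Lemma mexp1 lam : mexp lam 1 = sr - (sr - pr) * lam.
Proof. by rewrite /mexp weight1. Qed.

Lemma mexp_weight lam x : mexp lam x = mexp (weight lam x) 1.
Proof. by rewrite mexp1. Qed.

Lemma mexp1_lt lam mu : (mexp lam 1 < mexp mu 1) = (mu < lam).
Proof. by rewrite !mexp1 ltrD2l ltrN2 ltr_pM2l. Qed.

Lemma mexp1_le lam mu : (mexp lam 1 <= mexp mu 1) = (mu <= lam).
Proof. by rewrite !leNgt mexp1_lt. Qed.

Lemma mexp_surj lam x : 0 <= lam <= 1 -> 0 < x ->
  exists2 k, 0 < k < 1 & cratio k = mexp lam x.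
Proof.
move=> l01 x0; apply: cratio_surj; rewrite mexp_weight mexp1.
by have [? ?] := (pr3, dps); have /andP[? ?] := weight_bounds p s l01 x0; nra.
Qed.

Variables kb ka : R.
Hypotheses (kb_gt0 : 0 < kb) (kb_lt_ka : kb < ka) (ka_lt1 : ka < 1).
Hypothesis curv_left : forall u, 0 < u < kb -> 0 < curvps u.
Hypothesis curv_mid : forall u, kb < u < ka -> curvps u < 0.
Hypothesis curv_right : forall u, ka < u < 1 -> 0 < curvps u.
Hypothesis curv_kb : curvps kb = 0.

(** The weight for which the parameter k of the one-slope candidate is kb. *)
Definition crit_weight := (sr - cratio kb) / (sr - pr).

Let kb01 : 0 < kb < 1. Proof. by rewrite kb_gt0 (lt_trans kb_lt_ka). Qed.

Lemma mexp_crit_weight : mexp crit_weight 1 = cratio kb.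
Proof. by rewrite mexp1 /crit_weight; field; rewrite gt_eqF. Qed.

Lemma crit_weight01 : 0 < crit_weight < 1.
Proof.
have d := dps; have Mb := curv_kb.
have : ~ (0 <= (cratio kb - pr) * (cratio kb - sr)).
  by move=> /(curv_gt0 kb01); rewrite Mb ltxx.
move=> /negP; rewrite -ltNge => h.
have ? := psr.
have [c0 c1] : pr < cratio kb /\ cratio kb < sr.
  by split; rewrite ltNge; apply/negP => c; move: h; apply/negP; rewrite -leNgt; nra.
by rewrite /crit_weight divr_gt0 ?subr_gt0//= ltr_pdivrMr// mul1r; lra.
Qed.

Lemma not_fails_right lam : crit_weight <= lam <= 1 -> ~ fails lam.
Proof.
move=> /andP[bl l1] [k [k01 Ek [x [/andP[x0 x1]]]]].
have l01 : 0 <= lam <= 1 by have /andP[? _] := crit_weight01; rewrite l1 andbT; lra.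
have kkb : k <= kb by rewrite -cratio_leE// Ek -mexp_crit_weight mexp1_le.
case/andP: k01 => k0 _; apply/negP; rewrite -leNgt.
by apply: (no_failure kb_gt0 kb_lt_ka ka_lt1 curv_left l01 k0 kkb Ek); rewrite x0 ltW.
Qed.

(** While k <= ka failure is automatic; for larger k it is inherited by failure_mono. *)
Lemma fails_up lam0 lam : 0 <= lam0 -> fails lam0 -> lam0 < lam -> lam < crit_weight -> fails lam.
Proof.
move=> l0 [k0 [k001 E0 [x [x01 F]]]] ll lb.
have /andP[b0 b1] := crit_weight01.
have l01 : 0 <= lam <= 1 by apply/andP; split; lra.
have l01' : 0 <= lam0 <= 1 by apply/andP; split; lra.
have [k k01 E] := mexp_surj l01 ltr01.
have kbk : kb < k by rewrite -cratio_ltE// E -mexp_crit_weight mexp1_lt.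
exists k; split => //; have [kka|kak] := leP k ka.
  have [y y01 Fy] := failure_mid kb_gt0 kb_lt_ka ka_lt1 curv_mid l01 kbk kka E.
  by exists y.
have kk0 : k < k0 by rewrite -cratio_ltE// E E0 mexp1_lt.
have [y y01 Fy] := failure_mono p_lt_s kb_gt0 kb_lt_ka ka_lt1 curv_right l01' l01 k001
  (ltW kak) kk0 E0 E x01 F.
by exists y.
Qed.

Lemma fails_tangent lam : 0 <= lam <= 1 -> fails lam -> exists k a,
  [/\ kb < k < 1, cratio k = mexp lam 1, 0 < a < 1, tilt lam k a = 0 &
      k * a < kb /\ logser (k * a) < logser k * mix lam a].
Proof.
move=> l01 Fl; have [k [k01 E [x [x01 F]]]] := Fl.
have kbk : kb < k.
  rewrite ltNge; apply/negP => kkb; apply: (not_fails_right _ Fl).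
  by case/andP: (l01) => _ ->; rewrite andbT -mexp1_le -E mexp_crit_weight cratio_leE.
have /andP[k0 k1] := k01.
have [a [a01 ta kab Fa]] := failure_tangent p_gt2 p_lt_s kb_gt0 kb_lt_ka ka_lt1
  curv_mid curv_right l01 kbk k1 E x01 F.
by exists k, a; split => //; rewrite kbk.
Qed.

(** At the tangency the share of x^p is at least crit_weight, so lam a^p is not small compared
    with logser (k a) > (k a)^2 / 2, although a^p <= a^2: failing weights stay away from 0. *)
Lemma fails_ge ks lam : 0 < ks < 1 -> cratio ks = sr -> 0 <= lam <= 1 -> fails lam ->
  crit_weight * kb ^+ 2 / (2 * logser ks) <= lam.
Proof.
move=> ks01 Es l01 Fl; have /andP[b0 b1] := crit_weight01.
have [k [a [/andP[kbk k1] E /andP[a0 a1] ta [kab Fa]]]] := fails_tangent l01 Fl.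
have k0 : 0 < k by apply: lt_trans kbk.
have k01 : 0 < k < 1 by rewrite k0.
have ka01 : 0 < k * a < 1 by rewrite mulr_gt0//= (lt_trans kab)//; case/andP: kb01.
have m0 := mixture_gt0 p s l01 a0.
have wb : crit_weight <= weight lam a.
  rewrite -mexp1_le -mexp_weight mexp_crit_weight; have := tilt_eq0 p s l01 a0 ka01.
  by move=> [/(_ ta) <- _]; rewrite cratio_leE// ltW.
have lp : crit_weight * mix lam a <= lam * a ^+ 2.
  have ap : a ^+ p <= a ^+ 2 by apply: ler_wiXn2l; [exact: ltW|exact: ltW|exact: ltnW].
  have : crit_weight * mix lam a <= lam * a ^+ p by rewrite -ler_pdivlMr.
  by case/andP: l01 => l0 _; nra.
have kks : k <= ks.
  by rewrite -cratio_leE// E Es mexp1; case/andP: l01 => l0 _; have := dps; nra.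
have Rk := logser_gt0 k01.
have Rks : logser k <= logser ks.
  apply: (derive_ge0_le kks) => x /andP[kx xk].
    by apply: is_derive_logser; apply: le_lt_trans xk _; case/andP: ks01.
  have x0 : 0 < x by exact: lt_trans kx.
  by rewrite divr_ge0 ?ltW// subr_gt0 (lt_trans xk)//; case/andP: ks01.
have G1 := logser_gt ka01.
have G2 : k ^+ 2 * a ^+ 2 / 2 < logser k * mix lam a by rewrite -exprMn; exact: lt_trans Fa.
have G3 : crit_weight * (k ^+ 2 * a ^+ 2 / 2) < logser k * (lam * a ^+ 2).
  apply: (@lt_le_trans _ _ (crit_weight * (logser k * mix lam a))); first by rewrite ltr_pM2l.
  by rewrite mulrCA ler_pM2l.
have G4 : crit_weight * k ^+ 2 < 2 * logser k * lam.
  rewrite -(ltr_pM2r (exprn_gt0 2 a0)).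
  have -> : crit_weight * k ^+ 2 * a ^+ 2 = 2 * (crit_weight * (k ^+ 2 * a ^+ 2 / 2)) by field.
  have -> : 2 * logser k * lam * a ^+ 2 = 2 * (logser k * (lam * a ^+ 2)) by ring.
  by rewrite ltr_pM2l.
have Rks0 : 0 < 2 * logser ks by rewrite mulr_gt0// (lt_le_trans Rk).
rewrite ler_pdivrMr// [lam * _]mulrC.
have G5 : 2 * logser k * lam <= 2 * logser ks * lam.
  by case/andP: l01 => l0 _; rewrite ler_wpM2r// ler_pM2l.
have G6 : crit_weight * kb ^+ 2 <= crit_weight * k ^+ 2.
  by rewrite ler_pM2l// ler_pXn2r ?nnegrE// ltW.
lra.
Qed.

(** A dip at a fixed x persists when k, which determines the weight, increases slightly. *)
Lemma fails_open lam : 0 < lam <= 1 -> fails lam ->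
  exists2 lam', 0 <= lam' < lam & fails lam'.
Proof.
move=> /andP[l0 l1] [k [k01 E [x [x01 F]]]].
have /andP[k0 k1] := k01; have /andP[x0 x1] := x01; have d := dps.
pose lamk (t : R) := (sr - cratio t) / (sr - pr).
pose f (t : R) := logser t * mix (lamk t) x - logser (t * x).
have lamkk : lamk k = lam by rewrite /lamk E mexp1; field; rewrite gt_eqF.
have fk : 0 < f k by rewrite /f lamkk subr_gt0.
have cf : {for k, continuous f}.
  have dc := is_derive_cratio k01; have dl := is_derive_logser k1.
  have kx1 : x * k < 1 by apply: lt_trans k1; rewrite gtr_pMl.
  have dx := is_derive_logserM kx1.
  have cl : {for k, continuous (fun t : R => logser (x * t))} := is_derive_continuous dx.
  have cl' : {for k, continuous (fun t : R => logser (t * x))}.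
    rewrite (_ : (fun t : R => _) = (fun t : R => logser (x * t)))//.
    by apply/funext => t; rewrite mulrC.
  have c1 : {for k, continuous lamk}.
    apply: cvgM; last exact: cvg_cst.
    by apply: cvgB; [exact: cvg_cst|exact: is_derive_continuous dc].
  have c2 : {for k, continuous (fun t => mix (lamk t) x)}.
    rewrite /mixture; apply: cvgD; apply: cvgM; try exact: cvg_cst; first exact: c1.
    by apply: cvgB; [exact: cvg_cst|exact: c1].
  apply: cvgB; first by apply: cvgM; [exact: is_derive_continuous dl|exact: c2].
  exact: cl'.
have : \forall t \near k, 0 < f t by exact: (cvgr_gt _ cf _ fk).
move=> [r /= r0 Hr].
(* move slightly to the right of k, keeping the weight nonnegative *)
have [ks ks01 Es] := cratio_surj (le_trans pr3 (ltW psr)).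
have kks : k < ks by rewrite -cratio_ltE// E Es mexp1; nra.
pose t := Num.min ks (k + r / 2).
have kt : k < t by rewrite lt_min kks/= ltrDl divr_gt0.
have tks : t <= ks by rewrite ge_min lexx.
have t01 : 0 < t < 1.
  by rewrite (lt_trans k0)//= (le_lt_trans tks)//; case/andP: ks01.
exists (lamk t).
  apply/andP; split.
    by rewrite divr_ge0 ?(ltW d)// subr_ge0 -Es cratio_leE.
  by rewrite -[ltRHS]lamkk /lamk ltr_pM2r ?invr_gt0// ltrD2l ltrN2 cratio_ltE.
exists t; split => //.
  by rewrite mexp1 /lamk; field; rewrite gt_eqF.
exists x; split => //; rewrite -subr_gt0; apply: Hr.
rewrite /= ltr0_norm ?subr_lt0// opprB ltrBlDr.
apply: (@le_lt_trans _ _ (k + r / 2)); first by rewrite ge_min lexx orbT.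
by rewrite addrC ltrD2r ltr_pdivrMr// ltr_pMr// ltr1n.
Qed.

(** lam12 is the infimum of the failing weights, positive by fails_ge and not attained by
    fails_open. *)
Lemma failure_interval lamS kS : 0 < lamS < 1 -> 0 < kS < 1 -> cratio kS = mexp lamS 1 ->
  kb < kS < ka ->
  exists lam12, [/\ 0 < lam12, lam12 < lamS, lamS < crit_weight,
    forall lam, 0 <= lam <= 1 -> lam <= lam12 \/ crit_weight <= lam -> ~ fails lam &
    forall lam, lam12 < lam < crit_weight -> fails lam].
Proof.
move=> /andP[S0 S1] kS01 ES /andP[kbS Ska]; have /andP[b0 b1] := crit_weight01.
have SI : 0 <= lamS <= 1 by rewrite !ltW.
have Sb : lamS < crit_weight by rewrite -mexp1_lt mexp_crit_weight -ES cratio_ltE.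
have FS : fails lamS.
  exists kS; split => //.
  have [y y01 Fy] := failure_mid kb_gt0 kb_lt_ka ka_lt1 curv_mid SI kbS (ltW Ska) ES.
  by exists y.
pose A : set R := [set lam | 0 <= lam <= 1 /\ fails lam].
have [ks ks01 Es] := cratio_surj (le_trans pr3 (ltW psr)).
pose eps := crit_weight * kb ^+ 2 / (2 * logser ks).
have eps0 : 0 < eps.
  by apply: divr_gt0; rewrite mulr_gt0 ?exprn_gt0 ?logser_gt0 ?kb_gt0.
have hA : has_inf A.
  split; first by exists lamS.
  by exists eps => lam [l01 Fl]; exact: (fails_ge ks01 Es).
have epsi : eps <= inf A.
  by apply: lb_le_inf => [|lam [l01 Fl]]; [exists lamS|exact: (fails_ge ks01 Es)].
have i0 : 0 < inf A by exact: lt_le_trans epsi.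
have iS : inf A < lamS.
  have [|lam' /andP[l'0 l'S] Fl'] := @fails_open lamS _ FS; first by rewrite S0 ltW.
  apply: (le_lt_trans _ l'S); apply: ge_inf; first by case: hA.
  by split => //; rewrite l'0/=; lra.
exists (inf A); split => //.
- move=> lam l01 [li|bl] Fl; last by apply: (not_fails_right _ Fl); rewrite bl; case/andP: l01.
  have [l0|l0] := ltP 0 lam; last first.
    by have := fails_ge ks01 Es l01 Fl; rewrite -/eps; lra.
  have [|lam' /andP[l'0 l'S] Fl'] := @fails_open lam _ Fl; first by rewrite l0; case/andP: l01.
  have : inf A <= lam'.
    apply: ge_inf; first by case: hA.
    by split => //; rewrite l'0/=; case/andP: l01; lra.
  by lra.
- move=> lam /andP[il lb].
  have [lam0 [/andP[l00 _] F0] l0l] := inf_lt hA.1 il.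
  exact: (fails_up l00 F0).
Qed.

End FailureInterval.

(** * One-step minimizers *)

Section MixtureDerivatives.
Context {R : realType}.
Variables p s : nat.
Hypotheses (p_gt2 : (2 < p)%N) (p_lt_s : (p < s)%N).
Implicit Types lam x k : R.

Notation mix := (@mixture R p s).
Notation pr := (p%:R : R).
Notation sr := (s%:R : R).
Notation mexp := (@mexp R p s).

Definition dmix lam x : R :=
  lam * (pr * x ^+ p.-1) + (1 - lam) * (sr * x ^+ s.-1).

Lemma is_derive_mix lam x : is_derive x 1 (mix lam) (dmix lam x).
Proof.
have ? := is_derive_exprn p x; have ? := is_derive_exprn s x.
by rewrite /mixture; apply: is_derive_eq; rewrite /GRing.scale/= /dmix; ring.
Qed.

Lemma continuous_dmix lam : continuous (dmix lam).
Proof.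
move=> x; have d1 := is_derive_exprn p.-1 x; have d2 := is_derive_exprn s.-1 x.
apply: cvgD; apply: cvgM; try exact: cvg_cst;
  by apply: cvgM; [exact: cvg_cst|exact: is_derive_continuous d1 ||
                                   exact: is_derive_continuous d2].
Qed.

Lemma dmix_ge0 lam x : 0 <= lam <= 1 -> 0 <= x -> 0 <= dmix lam x.
Proof.
move=> /andP[l0 l1] x0; rewrite /dmix addr_ge0// !mulr_ge0 ?ler0n ?exprn_ge0//.
by rewrite subr_ge0.
Qed.

Lemma mixture0 lam : mix lam 0 = 0.
Proof.
have p0 : (0 < p)%N by exact: ltn_trans p_gt2.
have s0 : (0 < s)%N by exact: ltn_trans p_lt_s.
by rewrite /mixture !expr0n (gtn_eqF p0) (gtn_eqF s0) !mulr0 addr0.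
Qed.

Lemma dmixE lam x : 0 <= lam <= 1 -> 0 < x -> dmix lam x = mix lam x * mexp lam x / x.
Proof.
move=> l01 x0; have m0 := mixture_gt0 p s l01 x0; move: m0.
rewrite /dmix /mexp /weight /mixture => m0.
have p0 : (0 < p)%N by exact: ltn_trans p_gt2.
have s0 : (0 < s)%N by exact: ltn_trans p_lt_s.
have -> : x ^+ p.-1 = x ^+ p / x by rewrite -[in RHS](prednK p0) exprSr mulfK// gt_eqF.
have -> : x ^+ s.-1 = x ^+ s / x by rewrite -[in RHS](prednK s0) exprSr mulfK// gt_eqF.
by field; rewrite (gt_eqF x0) gt_eqF.
Qed.

Lemma dmix1 lam : dmix lam 1 = mexp lam 1.
Proof. by rewrite /dmix !expr1n mexp1; ring. Qed.

Lemma is_derive_dlogserM k c x : k * x < 1 ->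
  is_derive x 1 (fun y => c * (k * (k * y / (1 - k * y)))) (c * (k / (1 - k * x)) ^+ 2).
Proof.
move=> k1; have n0 : 1 - k * x != 0 by rewrite gt_eqF// subr_gt0.
have d1 : is_derive x 1 (fun y : R => 1 - k * y) (- k).
  by apply: is_derive_eq; rewrite /GRing.scale/=; ring.
have ? := @is_derive_inv R (fun y => 1 - k * y) x _ n0 d1.
by apply: is_derive_eq; rewrite /GRing.scale/=; field.
Qed.

(** The tail is sqrt (logser k) (1 - k x) / k, and the double primitive of its inverse square is
    logser (k x) / logser k. *)
Lemma one_step lam : 0 <= lam <= 1 -> ~ fails p s lam -> is_kRSB (mix lam) 1.
Proof.
move=> l01 nf; have [k k01 E] := mexp_surj p_gt2 p_lt_s l01 ltr01.
have /andP[k0 k1] := k01; have Rk := logser_gt0 k01.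
have kx x : x <= 1 -> k * x < 1.
  by move=> x1; apply: le_lt_trans k1; rewrite ger_pMr.
have nk : 1 - k != 0 by rewrite gt_eqF// subr_gt0.
pose m := Num.sqrt (logser k).
have m0 : 0 < m by rewrite sqrtr_gt0.
have mm : m ^+ 2 = logser k by rewrite sqr_sqrtr// ltW.
pose D := (1 - k) * m / k.
have D0 : 0 < D by rewrite divr_gt0// mulr_gt0// subr_gt0.
pose P x := (logser k)^-1 * logser (k * x).
pose dP x := (logser k)^-1 * (k * (k * x / (1 - k * x))).
have P1 : P 1 = mix lam 1 by rewrite /P mulr1 mixture1 mulVf// gt_eqF.
have P0 : P 0 = mix lam 0 by rewrite /P mulr0 logser0 mulr0 mixture0.
have ge x : 0 <= x <= 1 -> mix lam x <= P x.
  move=> /andP[x0 x1]; move: x0; rewrite le_eqVlt => /predU1P[<-|x0]; first by rewrite P0.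
  move: x1; rewrite le_eqVlt => /predU1P[->|x1]; first by rewrite P1.
  rewrite /P mulrC ler_pdivlMr// mulrC leNgt; apply/negP => F.
  by apply: nf; exists k; split => //; exists x; rewrite x0.
have dPx x : x <= 1 -> is_derive x 1 P (dP x).
  move=> /kx x1; have ? := is_derive_logserM x1.
  by apply: is_derive_eq; rewrite /GRing.scale/= /dP; ring.
have ddP x : x <= 1 -> is_derive x 1 dP ((D + m * (1 - x))^-1 ^+ 2).
  move=> /kx x1; have d := is_derive_dlogserM (logser k)^-1 x1.
  apply: is_derive_eq; have nx : 1 - k * x != 0 by rewrite gt_eqF// subr_gt0.
  have -> : D + m * (1 - x) = m * (1 - k * x) / k by rewrite /D; field; rewrite gt_eqF.
  by rewrite -mm; field; rewrite nx !gt_eqF.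
(* the slopes on both sides agree, so the subdivision point is arbitrary *)
have h01 : 0 < (2^-1 : R) < 1 by rewrite invr_gt0 invf_lt1// ltr0n ltr1n.
have -> : 1%N = (m < m)%R.+1 by rewrite ltxx.
apply: (@step_kRSB R 2^-1 m m D h01 m0 (lexx _) D0 (mix lam) (dmix lam)
  (is_derive_mix lam) (@continuous_dmix lam) _ P P dP dP).
- by move=> x /andP[x0 _]; exact: dmix_ge0.
- by move=> x /andP[_ xh]; apply: dPx; have /andP[_ /ltW] := h01; exact: (le_trans xh).
- by move=> x /andP[_]; exact: dPx.
- move=> x /andP[_ xh]; have x1 : x <= 1 by have /andP[_ /ltW] := h01; exact: (le_trans xh).
  by apply: is_derive_eq (ddP x x1) _; congr (_ ^-1 ^+ 2); ring.
- by move=> x /andP[_]; exact: ddP.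
- by rewrite /dP mulr0 mul0r !mulr0.
- by [].
- rewrite dmix1 -E /dP /cratio; field.
  by rewrite nk gt_eqF.
- exact: P0.
- by [].
- exact: P1.
- by rewrite ltxx.
- by move=> x /andP[x0 xh]; apply: ge; rewrite x0; have /andP[_ /ltW] := h01; exact: (le_trans xh).
- move=> x /andP[xh x1]; apply: ge; rewrite x1 andbT.
  by have /andP[/ltW h0 _] := h01; exact: (le_trans h0).
Qed.

End MixtureDerivatives.

(** * The inverse square root of the second derivative of the mixture *)

Section InverseRootCurvature.
Context {R : realType}.
Variables p s : nat.
Hypotheses (p_gt2 : (2 < p)%N) (p_lt_s : (p < s)%N).
Implicit Types lam x k : R.

Notation mix := (@mixture R p s).
Notation dmix := (@dmix R p s).
Notation pr := (p%:R : R).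
Notation sr := (s%:R : R).
Notation mexp := (@mexp R p s).
Notation weight := (@weight R p s).

Let pr3 : 3 <= pr. Proof. by rewrite ler_nat. Qed.
Let psr : pr < sr. Proof. by rewrite ltr_nat. Qed.

Lemma weight_decr lam x y : 0 < lam < 1 -> 0 < x -> x < y -> weight lam y < weight lam x.
Proof.
move=> /andP[l0 l1] x0 xy; have y0 : 0 < y by exact: lt_trans xy.
have l01 : 0 <= lam <= 1 by rewrite !ltW.
have [mx my] := (mixture_gt0 p s l01 x0, mixture_gt0 p s l01 y0).
rewrite /weight ltr_pdivrMr// mulrAC ltr_pdivlMr// /mixture.
have s0 : s = (p + (s - p))%N by rewrite subnKC// ltnW.
have lt : x ^+ (s - p) < y ^+ (s - p).
  by rewrite ltr_pXn2r ?nnegrE ?(ltW x0) ?(ltW y0)// subn_gt0.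
have [px py] : 0 < x ^+ p /\ 0 < y ^+ p by rewrite !exprn_gt0.
have E z : z ^+ s = z ^+ p * z ^+ (s - p) by rewrite -exprD -s0.
rewrite !E -subr_gt0.
have -> : lam * x ^+ p * (lam * y ^+ p + (1 - lam) * (y ^+ p * y ^+ (s - p))) -
  lam * y ^+ p * (lam * x ^+ p + (1 - lam) * (x ^+ p * x ^+ (s - p))) =
  lam * (1 - lam) * (x ^+ p * y ^+ p) * (y ^+ (s - p) - x ^+ (s - p)) by ring.
by rewrite !mulr_gt0 ?subr_gt0.
Qed.

Lemma mexp_lt lam x y : 0 < lam < 1 -> 0 < x -> 0 < y -> (mexp lam x < mexp lam y) = (x < y).
Proof.
move=> l01 x0 y0; have d : 0 < sr - pr by rewrite subr_gt0 psr.
rewrite /mexp ltrD2l ltrN2 ltr_pM2l//.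
case: (ltgtP x y) => [xy|yx|->]; first exact: weight_decr.
- by apply/negbTE; rewrite -leNgt ltW// weight_decr.
- by rewrite ltxx.
Qed.

Lemma mexp_inj lam x y : 0 < lam < 1 -> 0 < x -> 0 < y -> mexp lam x = mexp lam y -> x = y.
Proof.
move=> l01 x0 y0 E; apply/le_anti.
by rewrite !leNgt -(mexp_lt l01 y0 x0) -(mexp_lt l01 x0 y0) E ltxx.
Qed.

Let is_derive_bin al be x : x != 0 ->
  is_derive x 1 (fun y : R => al * y ^+ p + be * y ^+ s)
    ((al * pr * x ^+ p + be * sr * x ^+ s) / x).
Proof.
move=> x0; have ? := is_derive_exprn_div p x0; have ? := is_derive_exprn_div s x0.
by apply: is_derive_eq; rewrite /GRing.scale/=; field.
Qed.

Let bin_gt0 lam al be x : 0 < lam < 1 -> 0 < x -> 0 < al -> 0 < be ->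
  0 < lam * al * x ^+ p + (1 - lam) * be * x ^+ s.
Proof.
move=> /andP[l0 l1] x0 al0 be0.
by rewrite addr_gt0// !mulr_gt0 ?subr_gt0 ?exprn_gt0.
Qed.

(** This is x^2 xi''(x) for the mixture xi; euler3 and euler4 are its images under x d/dx. *)
Definition euler2 lam x := lam * (pr * (pr - 1)) * x ^+ p + (1 - lam) * (sr * (sr - 1)) * x ^+ s.
Let euler3 lam x :=
  lam * (pr * (pr - 1)) * pr * x ^+ p + (1 - lam) * (sr * (sr - 1)) * sr * x ^+ s.
Let euler4 lam x :=
  lam * (pr * (pr - 1)) * pr * pr * x ^+ p + (1 - lam) * (sr * (sr - 1)) * sr * sr * x ^+ s.

Lemma euler2_gt0 lam x : 0 < lam < 1 -> 0 < x -> 0 < euler2 lam x.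
Proof.
have [? ?] := (pr3, psr); move=> l01 x0; apply: bin_gt0 => //.
  by rewrite mulr_gt0//; lra.
by rewrite mulr_gt0//; lra.
Qed.

Definition ddmix lam x : R :=
  lam * (pr * (p.-1%:R * x ^+ p.-2)) + (1 - lam) * (sr * (s.-1%:R * x ^+ s.-2)).

Lemma is_derive_dmix lam x : is_derive x 1 (dmix lam) (ddmix lam x).
Proof.
have ? := is_derive_exprn p.-1 x; have ? := is_derive_exprn s.-1 x.
by rewrite /dmix; apply: is_derive_eq; rewrite /GRing.scale/= /ddmix; ring.
Qed.

Lemma ddmixE lam x : 0 < x -> ddmix lam x = euler2 lam x / x ^+ 2.
Proof.
move=> x0; have xn : x != 0 by rewrite gt_eqF.
have h n : (2 < n)%N -> n.-1%:R * x ^+ n.-2 = (n%:R - 1) * x ^+ n / x ^+ 2.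
  case: n => [|[|n]]// _; rewrite /= -[in RHS]addn1 natrD addrK.
  by rewrite -[n.+1]addn1 -addnA exprD; field.
rewrite /ddmix !h//; last exact: ltn_trans p_lt_s.
by rewrite /euler2; field.
Qed.

Lemma ddmix_gt0 lam x : 0 < lam < 1 -> 0 < x -> 0 < ddmix lam x.
Proof. by move=> l01 x0; rewrite ddmixE// divr_gt0 ?euler2_gt0 ?exprn_gt0. Qed.

(** The function xi''^(-1/2). When P'' = q^(-2), comparing it with the linear tail q is
    comparing P'' with xi''. *)
Definition invroot lam x := x * expR (- (ln (euler2 lam x) / 2)).
Definition dinvroot lam x :=
  expR (- (ln (euler2 lam x) / 2)) * (1 - euler3 lam x / (2 * euler2 lam x)).
(** Spol arises here: 3 xi'''^2 - 2 xi'' xi'''' is xi^2 Spol (weight x) up to a power of x. *)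
Definition ddinvroot lam x := expR (- (ln (euler2 lam x) / 2)) / (4 * x * euler2 lam x ^+ 2)
  * (mix lam x ^+ 2 * Spol pr sr (weight lam x)).

Lemma invroot_gt0 lam x : 0 < x -> 0 < invroot lam x.
Proof. by move=> x0; rewrite mulr_gt0// expR_gt0. Qed.

Lemma invroot_sqr lam x : 0 < lam < 1 -> 0 < x ->
  ddmix lam x = (invroot lam x)^-1 ^+ 2.
Proof.
move=> l01 x0; rewrite ddmixE// /invroot; have c0 := euler2_gt0 l01 x0.
have E : expR (- (ln (euler2 lam x) / 2)) ^+ 2 = (euler2 lam x)^-1.
  rewrite -expRM_natl (_ : _ * _ = - ln (euler2 lam x)); last by field.
  by rewrite expRN lnK.
by rewrite exprVn exprMn E; field; rewrite !gt_eqF.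
Qed.

Let is_derive_expln lam x : 0 < lam < 1 -> 0 < x ->
  is_derive x 1 (fun y => expR (- (ln (euler2 lam y) / 2)))
    (- expR (- (ln (euler2 lam x) / 2)) * (euler3 lam x / (2 * euler2 lam x)) / x).
Proof.
move=> l01 x0; have c0 := euler2_gt0 l01 x0; have xn : x != 0 by rewrite gt_eqF.
have cn : euler2 lam x != 0 by rewrite gt_eqF.
have d2 := is_derive_bin (lam * (pr * (pr - 1))) ((1 - lam) * (sr * (sr - 1))) xn.
have d3 := @is_derive1_comp R (@ln R) (euler2 lam) x _ _ (is_derive1_ln c0) d2.
have d4 : is_derive x 1 (fun y => - (ln (euler2 lam y) / 2))
    (- (euler3 lam x / (2 * euler2 lam x)) / x).
  apply: is_derive_eq; rewrite /GRing.scale/= /euler3; field.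
  by rewrite xn cn.
have d5 := @is_derive1_comp R (@expR R) (fun y => - (ln (euler2 lam y) / 2)) x _ _
  (is_derive_expR _) d4.
by apply: is_derive_eq; ring.
Qed.

Lemma is_derive_invroot lam x : 0 < lam < 1 -> 0 < x ->
  is_derive x 1 (invroot lam) (dinvroot lam x).
Proof.
move=> l01 x0; have c0 := euler2_gt0 l01 x0; have xn : x != 0 by rewrite gt_eqF.
have cn : euler2 lam x != 0 by rewrite gt_eqF.
have ? := is_derive_expln l01 x0.
rewrite /invroot; apply: is_derive_eq; rewrite /GRing.scale/= /dinvroot; field.
by rewrite xn cn.
Qed.

Lemma is_derive_dinvroot lam x : 0 < lam < 1 -> 0 < x ->
  is_derive x 1 (dinvroot lam) (ddinvroot lam x).
Proof.
move=> l01 x0; have c0 := euler2_gt0 l01 x0; have xn : x != 0 by rewrite gt_eqF.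
have cn : euler2 lam x != 0 by rewrite gt_eqF.
have ? := is_derive_expln l01 x0.
have d2 := is_derive_bin (lam * (pr * (pr - 1))) ((1 - lam) * (sr * (sr - 1))) xn.
have d2' : is_derive x 1 (euler2 lam) (euler3 lam x / x) by exact: d2.
have d3 : is_derive x 1 (euler3 lam) (euler4 lam x / x).
  exact: (is_derive_bin (lam * (pr * (pr - 1)) * pr) ((1 - lam) * (sr * (sr - 1)) * sr) xn).
have d4 : is_derive x 1 (fun y => 2 * euler2 lam y) (2 * (euler3 lam x / x)).
  by apply: is_derive_eq; rewrite /GRing.scale/=; ring.
have n4 : 2 * euler2 lam x != 0 by rewrite mulf_neq0// gt_eqF.
have ? := @is_derive_inv R (fun y => 2 * euler2 lam y) x _ n4 d4.
have l01' : 0 <= lam <= 1 by case/andP: l01 => ? ?; rewrite !ltW.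
have m0 := mixture_gt0 p s l01' x0.
have E : mix lam x ^+ 2 * Spol pr sr (weight lam x) =
   3 * euler3 lam x ^+ 2 - 2 * euler2 lam x * euler3 lam x - 2 * euler2 lam x * euler4 lam x.
  move: (m0); rewrite /Spol /weight /euler2 /euler3 /euler4 /mixture => h; field.
  by rewrite gt_eqF.
rewrite /dinvroot; apply: is_derive_eq; rewrite /GRing.scale/= /ddinvroot E; field.
by rewrite xn cn.
Qed.

Lemma ddinvroot_gt0 lam x : 0 < lam < 1 -> 0 < x ->
  (0 < ddinvroot lam x) = (0 < Spol pr sr (weight lam x)).
Proof.
move=> l01 x0; have c0 := euler2_gt0 l01 x0.
have l01' : 0 <= lam <= 1 by case/andP: l01 => ? ?; rewrite !ltW.
have m0 := mixture_gt0 p s l01' x0.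
rewrite /ddinvroot pmulr_rgt0; last by rewrite divr_gt0 ?expR_gt0 ?mulr_gt0 ?exprn_gt0.
by rewrite pmulr_rgt0 ?exprn_gt0.
Qed.

Lemma ddinvroot_lt0 lam x : 0 < lam < 1 -> 0 < x ->
  (ddinvroot lam x < 0) = (Spol pr sr (weight lam x) < 0).
Proof.
move=> l01 x0; have c0 := euler2_gt0 l01 x0.
have l01' : 0 <= lam <= 1 by case/andP: l01 => ? ?; rewrite !ltW.
have m0 := mixture_gt0 p s l01' x0.
rewrite /ddinvroot pmulr_rlt0; last by rewrite divr_gt0 ?expR_gt0 ?mulr_gt0 ?exprn_gt0.
by rewrite pmulr_rlt0 ?exprn_gt0.
Qed.

End InverseRootCurvature.

(** * Candidates with two slopes *)

Section Arc.
Context {R : realType}.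
Implicit Types A B q m a x : R.

(** The solution of y'' = (q - m (x - a))^(-2) with value A and slope B at a. *)
Definition arc A B q m a x := A + B * (x - a) + logser (m * (x - a) / q) / m ^+ 2.
Definition darc B q m a x := B + (x - a) / (q * (q - m * (x - a))).

Lemma is_derive_arc A B q m a x : 0 < q -> m != 0 -> 0 < q - m * (x - a) ->
  is_derive x 1 (arc A B q m a) (darc B q m a x).
Proof.
move=> q0 mn l0; have qn : q != 0 by rewrite gt_eqF.
have ln : q - m * (x - a) != 0 by rewrite gt_eqF.
have u1 : m * (x - a) / q < 1 by rewrite ltr_pdivrMr// mul1r -subr_gt0.
have d1 : is_derive x 1 (fun y : R => m * (y - a) / q) (m / q).
  by apply: is_derive_eq; rewrite /GRing.scale/=; field.
have d2 := @is_derive1_comp R logser (fun y : R => m * (y - a) / q) x _ _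
  (is_derive_logser u1) d1.
rewrite /arc; apply: is_derive_eq; rewrite /GRing.scale/= /darc; field.
by rewrite mn qn ln.
Qed.

Lemma is_derive_darc B q m a x : 0 < q -> 0 < q - m * (x - a) ->
  is_derive x 1 (darc B q m a) ((q - m * (x - a))^-1 ^+ 2).
Proof.
move=> q0 l0; have qn : q != 0 by rewrite gt_eqF.
have ln : q - m * (x - a) != 0 by rewrite gt_eqF.
have n : q * (q - m * (x - a)) != 0 by rewrite mulf_neq0.
have d1 : is_derive x 1 (fun y : R => q * (q - m * (y - a))) (- (q * m)).
  by apply: is_derive_eq; rewrite /GRing.scale/=; ring.
have ? := @is_derive_inv R (fun y : R => q * (q - m * (y - a))) x _ n d1.
rewrite /darc; apply: is_derive_eq; rewrite /GRing.scale/=; field.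
by rewrite qn ln.
Qed.

Lemma arc_start A B q m a : arc A B q m a a = A.
Proof. by rewrite /arc subrr !mulr0 mul0r logser0 mul0r !addr0. Qed.

Lemma darc_start B q m a : darc B q m a a = B.
Proof. by rewrite /darc subrr mul0r addr0. Qed.

End Arc.

Section TwoStepCandidate.
Context {R : realType}.
Variables p s : nat.
Hypotheses (p_gt2 : (2 < p)%N) (p_lt_s : (p < s)%N).

Implicit Types x y : R.
Notation mix := (@mixture R p s).
Notation dmix := (@dmix R p s).
Notation ddmix := (@ddmix R p s).
Notation pr := (p%:R : R).
Notation sr := (s%:R : R).
Notation mexp := (@mexp R p s).
Notation weight := (@weight R p s).
Notation invroot := (@invroot R p s).
Notation dinvroot := (@dinvroot R p s).
Notation curvps := (@curv R pr sr).

(** Here a is the contact point and k / a the scale of logser on [0, a]. The densities are slope0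
    and slope1, and taila and tail1 are the values of the tail at a and at 1. Contact at a and
    the slope of the mixture at 1 determine all of them; the end value 1 is a further condition. *)
Definition slope0 (lam a k : R) := Num.sqrt (logser k / mix lam a).
Definition taila (lam a k : R) := slope0 lam a k * a * (1 - k) / k.
Definition tail1 (lam a k : R) :=
  (1 - a) / (taila lam a k * (dmix lam 1 - dmix lam a)).
Definition slope1 (lam a k : R) := (taila lam a k - tail1 lam a k) / (1 - a).
Definition left_arc (lam a k x : R) := mix lam a / logser k * logser (k / a * x).
Definition right_arc (lam a k : R) :=
  arc (mix lam a) (dmix lam a) (taila lam a k) (slope1 lam a k) a.

Variables lam a k : R.
Hypotheses (l01 : 0 < lam < 1) (a01 : 0 < a < 1) (k_gt0 : 0 < k) (k_lt_a : k < a).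
Hypothesis ratio_a : cratio k = mexp lam a.

Notation m0 := (slope0 lam a k).
Notation m1 := (slope1 lam a k).
Notation qa := (taila lam a k).
Notation q1 := (tail1 lam a k).
Notation A := (mix lam a).
Notation B := (dmix lam a).
Notation c := (dmix lam 1).
Notation kap := (k / a).

Let l01' : 0 <= lam <= 1. Proof. by case/andP: l01 => ? ?; rewrite !ltW. Qed.
Let a0 : 0 < a. Proof. by case/andP: a01. Qed.
Let a1 : a < 1. Proof. by case/andP: a01. Qed.
Let k1 : k < 1. Proof. exact: lt_trans k_lt_a a1. Qed.
Let k01 : 0 < k < 1. Proof. by rewrite k_gt0 k1. Qed.
Let A0 : 0 < A. Proof. exact: mixture_gt0. Qed.
Let R0 : 0 < logser k. Proof. exact: logser_gt0. Qed.
Let kap0 : 0 < kap. Proof. exact: divr_gt0. Qed.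
Let kap1 : kap < 1. Proof. by rewrite ltr_pdivrMr// mul1r. Qed.

Lemma slope0_gt0 : 0 < m0.
Proof. by rewrite sqrtr_gt0 divr_gt0. Qed.

Lemma logser_slope0 : logser k = m0 ^+ 2 * A.
Proof. by rewrite sqr_sqrtr ?divfK ?gt_eqF// divr_ge0 ?ltW. Qed.

Lemma taila_gt0 : 0 < qa.
Proof. by rewrite divr_gt0// !mulr_gt0 ?slope0_gt0// subr_gt0. Qed.

Lemma dmix_lt x y : 0 < x -> x < y -> dmix lam x < dmix lam y.
Proof.
move=> x0 xy; apply: (derive_pos_lt xy (df := ddmix lam)).
  by move=> z _; exact: is_derive_dmix.
by move=> z /andP[xz _]; apply: ddmix_gt0 => //; exact: lt_trans xz.
Qed.

Let cB : 0 < c - B. Proof. by rewrite subr_gt0 dmix_lt. Qed.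

Lemma tail1_gt0 : 0 < q1.
Proof. by rewrite divr_gt0 ?subr_gt0// mulr_gt0 ?taila_gt0. Qed.

Definition dleft_arc x := A / logser k * (kap * (kap * x / (1 - kap * x))).

Lemma is_derive_left_arc x : x <= 1 -> is_derive x 1 (left_arc lam a k) (dleft_arc x).
Proof.
move=> x1; have kx : kap * x < 1 by apply: le_lt_trans kap1; rewrite ger_pMr.
have ? := is_derive_logserM kx.
by rewrite /left_arc; apply: is_derive_eq; rewrite /GRing.scale/= /dleft_arc; ring.
Qed.

Let left_tail_gt0 x : x <= 1 -> 0 < qa - m0 * (x - a).
Proof.
move=> x1.
have -> : qa - m0 * (x - a) = m0 * (a - k * x) / k by rewrite /taila; field; rewrite gt_eqF.
rewrite divr_gt0// mulr_gt0 ?slope0_gt0// subr_gt0; apply: le_lt_trans k_lt_a.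
by rewrite ger_pMr.
Qed.

Lemma dleft_arcE x : x <= 1 -> dleft_arc x = darc B qa m0 a x.
Proof.
move=> x1.
have BE : B = A * k ^+ 2 / (a * (1 - k) * logser k).
  rewrite dmixE// -ratio_a /cratio; field.
  by rewrite !gt_eqF// subr_gt0.
have h := left_tail_gt0 x1.
have E : qa - m0 * (x - a) = m0 * (a - k * x) / k by rewrite /taila; field; rewrite gt_eqF.
have akx : 0 < a - k * x.
  move: h; rewrite E pmulr_lgt0 ?invr_gt0// pmulr_rgt0//; exact: slope0_gt0.
have sn := slope0_gt0.
rewrite /darc E BE /dleft_arc /taila logser_slope0; field.
by rewrite !gt_eqF// ?subr_gt0.
Qed.

Lemma is_derive_dleft_arc x : x <= 1 ->
  is_derive x 1 dleft_arc ((qa - m0 * (x - a))^-1 ^+ 2).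
Proof.
move=> x1; have kx : kap * x < 1 by apply: le_lt_trans kap1; rewrite ger_pMr.
have h := left_tail_gt0 x1; have sn := slope0_gt0.
have E : qa - m0 * (x - a) = m0 * (a - k * x) / k by rewrite /taila; field; rewrite gt_eqF.
have akx : 0 < a - k * x.
  by move: h; rewrite E pmulr_lgt0 ?invr_gt0// pmulr_rgt0.
apply: is_derive_eq (is_derive_dlogserM (A / logser k) kx) _.
rewrite E logser_slope0; field.
by rewrite !gt_eqF.
Qed.

Lemma dright_end : darc B qa m1 a 1 = c.
Proof.
rewrite /darc.
have -> : qa - m1 * (1 - a) = q1 by rewrite /slope1 divfK ?gt_eqF ?subr_gt0//; ring.
rewrite /tail1; field.
by rewrite !gt_eqF ?taila_gt0// subr_gt0.
Qed.

Hypothesis slope_end : dleft_arc 1 < c.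

(** If the left piece continued to 1 ends with too small a slope, the tail must drop faster
    beyond a. *)
Lemma slope_lt : m0 < m1.
Proof.
have h0 := left_tail_gt0 (lexx 1); have qa0 := taila_gt0.
have l0 : 0 < 1 - a by rewrite subr_gt0.
have [n1 n2] : 0 < qa * (qa - m0 * (1 - a)) /\ 0 < qa * (c - B) by split; exact: mulr_gt0.
move: slope_end; rewrite dleft_arcE// /darc -ltrBrDl (ltr_pdivrMr _ _ n1) => h.
have h' : q1 < qa - m0 * (1 - a).
  rewrite /tail1 (ltr_pdivrMr _ _ n2); apply: (lt_le_trans h).
  by rewrite le_eqVlt; apply/orP; left; apply/eqP; ring.
rewrite /slope1 (ltr_pdivlMr _ _ l0); lra.
Qed.

Let m1_gt0 : 0 < m1. Proof. exact: lt_trans slope0_gt0 slope_lt. Qed.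

Let right_tailE x : qa - m1 * (x - a) = q1 + m1 * (1 - x).
Proof.
have <- : qa - m1 * (1 - a) = q1 by rewrite /slope1 divfK ?gt_eqF ?subr_gt0//; ring.
ring.
Qed.

Let right_tail_gt0 x : x <= 1 -> 0 < qa - m1 * (x - a).
Proof.
move=> x1; rewrite right_tailE ltr_wpDr ?tail1_gt0//.
by rewrite mulr_ge0 ?subr_ge0// ltW.
Qed.

Lemma is_derive_right_arc x : x <= 1 ->
  is_derive x 1 (right_arc lam a k) (darc B qa m1 a x).
Proof.
by move=> x1; apply: is_derive_arc; rewrite ?taila_gt0 ?right_tail_gt0// gt_eqF.
Qed.

Lemma is_derive_dright_arc x : x <= 1 ->
  is_derive x 1 (darc B qa m1 a) ((qa - m1 * (x - a))^-1 ^+ 2).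
Proof. by move=> x1; apply: is_derive_darc; rewrite ?taila_gt0 ?right_tail_gt0. Qed.

Lemma left_arc_end : left_arc lam a k a = A.
Proof. by rewrite /left_arc divfK ?gt_eqF// divfK// gt_eqF. Qed.

(** Beyond a the right tail is the smaller one, so the right arc is the more convex. *)
Lemma left_arc_le_right : left_arc lam a k 1 <= right_arc lam a k 1.
Proof.
have := @derive_ge0_le R (fun x => right_arc lam a k x - left_arc lam a k x)
  (fun x => darc B qa m1 a x - dleft_arc x) a 1 (ltW a1).
rewrite /right_arc arc_start left_arc_end subrr subr_ge0; apply.
- move=> x /andP[_ x1]; have := is_derive_left_arc x1; have := is_derive_right_arc x1.
  by move=> ? ?; apply: is_derive_eq.
- move=> x /andP[ax /ltW x1]; rewrite dleft_arcE// /darc.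
  rewrite opprD addrACA subrr add0r subr_ge0 ler_pM2l ?subr_gt0//.
  have [h0 h1 qa0] := And3 (left_tail_gt0 x1) (right_tail_gt0 x1) taila_gt0.
  rewrite lef_pV2 ?posrE; [|exact: mulr_gt0|exact: mulr_gt0].
  rewrite (ler_pM2l qa0) lerD2l lerN2 ler_pM2r ?subr_gt0//.
  by rewrite ltW// slope_lt.
Qed.

(** The sign of curv k decides whether the candidate is more or less curved than the mixture at
    the contact point. *)
Lemma curvature_gap : qa^-1 ^+ 2 - ddmix lam a = A * curvps k / (a ^+ 2 * logser k).
Proof.
have wE : euler2 p s lam a = A * ((sr + pr - 1) * mexp lam a - sr * pr).
  move: A0; rewrite /euler2 /mexp /weight /mixture => h; field.
  by rewrite gt_eqF.
rewrite ddmixE// wE -ratio_a curvE// /cratio /taila logser_slope0; field.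
by rewrite !gt_eqF ?slope0_gt0// subr_gt0.
Qed.

(** On the right piece gap has the sign of P'' - xi'', where P is the candidate. *)
Let gap x := invroot lam x - (qa - m1 * (x - a)).
Let dgap x := dinvroot lam x + m1.

Let is_derive_gap x : 0 < x -> is_derive x 1 gap (dgap x).
Proof.
move=> x0; have ? := is_derive_invroot p_gt2 p_lt_s l01 x0.
by rewrite /gap; apply: is_derive_eq; rewrite /GRing.scale/= /dgap; ring.
Qed.

Let is_derive_dgap x : 0 < x -> is_derive x 1 dgap (ddinvroot p s lam x).
Proof.
move=> x0; have ? := is_derive_dinvroot p_gt2 p_lt_s l01 x0.
by rewrite /dgap; apply: is_derive_eq; rewrite addr0.
Qed.

Let gap_gt0 x : 0 < x <= 1 -> (0 < gap x) = (ddmix lam x < (qa - m1 * (x - a))^-1 ^+ 2).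
Proof.
move=> /andP[x0 x1]; have [h g] := (right_tail_gt0 x1, @invroot_gt0 R p s lam x x0).
by rewrite invroot_sqr// (inv_sqr_lt g h) /gap subr_gt0.
Qed.

Let gap_lt0 x : 0 < x <= 1 -> (gap x < 0) = ((qa - m1 * (x - a))^-1 ^+ 2 < ddmix lam x).
Proof.
move=> /andP[x0 x1]; have [h g] := (right_tail_gt0 x1, @invroot_gt0 R p s lam x x0).
by rewrite invroot_sqr// (inv_sqr_lt h g) /gap subr_lt0.
Qed.

(** The curvatures agree at a, so gap vanishes there, and it is convex. Then xi' - P', which
    vanishes at a and at 1, can only increase and then decrease; it is positive in between, and
    P ends below xi(1) = 1. *)
Lemma right_arc_lt1 : curvps k = 0 ->
  (forall x, a < x <= 1 -> 0 < Spol pr sr (weight lam x)) -> right_arc lam a k 1 < 1.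
Proof.
move=> cv0 Spos.
have gapa : gap a = 0.
  have E : qa^-1 ^+ 2 = ddmix lam a.
    by apply/eqP; rewrite -subr_eq0 curvature_gap cv0 mulr0 mul0r.
  have aI : 0 < a <= 1 by rewrite a0 ltW.
  apply/le_anti; rewrite !leNgt gap_gt0// gap_lt0// subrr mulr0 subr0 E.
  by rewrite ltxx.
pose f x := dmix lam x - darc B qa m1 a x.
have df x : a <= x <= 1 ->
    is_derive x 1 f (ddmix lam x - (qa - m1 * (x - a))^-1 ^+ 2).
  move=> /andP[_ x1]; have ? := is_derive_dmix p s lam x.
  by have ? := is_derive_dright_arc x1; rewrite /f; apply: is_derive_eq.
have f1 : f 1 = 0 by rewrite /f dright_end subrr.
have fa : f a = 0 by rewrite /f darc_start subrr.
have fpos x : a < x < 1 -> 0 < f x.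
  move=> /andP[ax x1]; rewrite ltNge; apply/negP => fx.
  have [|y1 /andP[ay1 y1x] E1] := mean_value ax (f := f)
      (df := fun x => ddmix lam x - (qa - m1 * (x - a))^-1 ^+ 2).
    by move=> y /andP[ay yx]; apply: df; rewrite ay (le_trans yx)// ltW.
  have y11 : y1 < 1 by exact: lt_trans x1.
  have y10 : 0 < y1 by exact: lt_trans ay1.
  have g1 : 0 <= gap y1.
    rewrite leNgt gap_lt0 ?y10 ?(ltW y11)//; apply/negP => h.
    have : 0 < f x - f a by rewrite E1 mulr_gt0 ?subr_gt0.
    by rewrite fa subr0; apply/negP; rewrite -leNgt.
  have [|y0 /andP[ay0 y01] E2] := mean_value ay1 (f := gap) (df := dgap).
    by move=> y /andP[ay _]; apply: is_derive_gap; exact: lt_le_trans ay.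
  (* from y0 on the convex function gap increases *)
  have dg0 : 0 <= dgap y0.
    by rewrite -(pmulr_lge0 _ (_ : 0 < y1 - a)) ?subr_gt0// -E2 gapa subr0.
  have dgpos y : y0 < y -> y <= 1 -> 0 < dgap y.
    move=> y0y y1'; apply: (le_lt_trans dg0); apply: (derive_pos_lt y0y).
      move=> z /andP[y0z _]; apply: is_derive_dgap.
      by apply: lt_le_trans y0z; exact: lt_trans ay0.
    move=> z /andP[y0z zy]; rewrite ddinvroot_gt0//.
      by apply: Spos; rewrite (lt_trans ay0)//= ltW// (lt_le_trans zy).
    by apply: (lt_trans _ y0z); exact: lt_trans ay0.
  have gpos y : y1 < y -> y <= 1 -> 0 < gap y.
    move=> y1y y1'; apply: (le_lt_trans g1); apply: (derive_pos_lt y1y).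
      by move=> z /andP[y1z _]; apply: is_derive_gap; exact: lt_le_trans y1z.
    move=> z /andP[y1z zy]; apply: dgpos; first exact: lt_trans y1z.
    by rewrite ltW// (lt_le_trans zy).
  have : f 1 < f x.
    apply: (derive_neg_lt x1 (df := fun x => ddmix lam x - (qa - m1 * (x - a))^-1 ^+ 2)).
      by move=> y /andP[xy y1']; apply: df; rewrite y1' andbT ltW// (lt_le_trans ax).
    move=> y /andP[xy y1']; have xy1 : y1 < y by exact: lt_trans xy.
    rewrite subr_lt0 -gap_gt0 ?gpos ?(ltW y1')//.
    by rewrite (lt_trans y10).
  by rewrite f1; apply/negP; rewrite -leNgt.
have := @derive_pos_lt R (fun x => mix lam x - right_arc lam a k x) f a 1 a1.
have -> : right_arc lam a k a = A by exact: arc_start.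
rewrite mixture1 subrr subr_gt0; apply => //.
move=> x /andP[_ x1]; have ? := is_derive_mix p s lam x.
by have ? := is_derive_right_arc x1; apply: is_derive_eq.
Qed.

Hypothesis right_end : right_arc lam a k 1 = 1.

(** Otherwise gap would be negative, positive, negative, positive, negative at five successive
    points, the first one before a. Its second derivative would be negative, positive, negative
    at three successive points, although it has the sign of the convex quadratic polynomial Spol
    at the decreasing quantity weight. *)
Lemma right_arc_ge : 0 < curvps k ->
  (forall w1 w2 w3, w1 < w2 < w3 -> Spol pr sr w1 < 0 -> Spol pr sr w3 < 0 ->
     Spol pr sr w2 <= 0) ->
  forall x, a <= x <= 1 -> mix lam x <= right_arc lam a k x.
Proof.
move=> cv Sconv x /andP[ax x1]; rewrite leNgt; apply/negP => Hx.
have {}ax : a < x.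
  rewrite lt_neqAle ax andbT; apply/eqP => E; move: Hx.
  by rewrite -E /right_arc arc_start ltxx.
have {}x1 : x < 1.
  rewrite lt_neqAle x1 andbT; apply/eqP => E; move: Hx.
  by rewrite E right_end mixture1 ltxx.
pose H x := right_arc lam a k x - mix lam x.
pose dH x := darc B qa m1 a x - dmix lam x.
pose ddH x := (qa - m1 * (x - a))^-1 ^+ 2 - ddmix lam x.
have dHx x' : x' <= 1 -> is_derive x' 1 H (dH x').
  move=> h; have ? := is_derive_mix p s lam x'.
  by have ? := is_derive_right_arc h; apply: is_derive_eq.
have ddHx x' : x' <= 1 -> is_derive x' 1 dH (ddH x').
  move=> h; have ? := is_derive_dmix p s lam x'.
  by have ? := is_derive_dright_arc h; apply: is_derive_eq.
have Ha : H a = 0 by rewrite /H /right_arc arc_start subrr.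
have H1 : H 1 = 0 by rewrite /H right_end mixture1 subrr.
have dHa : dH a = 0 by rewrite /dH darc_start subrr.
have dH1 : dH 1 = 0 by rewrite /dH dright_end subrr.
have Hneg : H x < 0 by rewrite subr_lt0.
have [||z /andP[az zx] dz] := fall_derive ax (f := H) (df := dH).
- by move=> y /andP[_ yx]; apply: dHx; rewrite ltW// (le_lt_trans yx).
- by rewrite Ha.
have z1 : z < 1 by exact: lt_trans x1.
have [||y1 /andP[ay1 y1z] dy1] := fall_derive az (f := dH) (df := ddH).
- by move=> y /andP[_ yx]; apply: ddHx; rewrite ltW// (le_lt_trans yx).
- by rewrite dHa.
have [||z2 /andP[xz2 z21] dz2] := rise_derive x1 (f := H) (df := dH).
- by move=> y /andP[_]; exact: dHx.
- by rewrite H1.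
have zz2 : z < z2 by exact: lt_trans xz2.
have [||y2 /andP[zy2 y2z2] dy2] := rise_derive zz2 (f := dH) (df := ddH).
- by move=> y /andP[_ yx]; apply: ddHx; rewrite ltW// (le_lt_trans yx).
- exact: lt_trans dz2.
have [||y3 /andP[z2y3 y31] dy3] := fall_derive z21 (f := dH) (df := ddH).
- by move=> y /andP[_]; exact: ddHx.
- by rewrite dH1.
have yI y : a < y -> y < 1 -> 0 < y <= 1 by move=> ? /ltW ->; rewrite andbT (lt_trans a0).
have y12 : y1 < y2 by exact: lt_trans zy2.
have y23 : y2 < y3 by exact: lt_trans z2y3.
have y21 : y2 < 1 by exact: lt_trans y31.
have y11 : y1 < 1 by exact: lt_trans y21.
have ay2 : a < y2 by exact: lt_trans y12.
have ay3 : a < y3 by exact: lt_trans y23.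
have g1 : gap y1 < 0 by rewrite (gap_lt0 (yI y1 ay1 y11)) -subr_lt0.
have g2 : 0 < gap y2 by rewrite (gap_gt0 (yI y2 ay2 y21)) -subr_gt0.
have g3 : gap y3 < 0 by rewrite (gap_lt0 (yI y3 ay3 y31)) -subr_lt0.
have ga : 0 < gap a.
  have aI : 0 < a <= 1 by rewrite a0 ltW.
  rewrite (gap_gt0 aI) subrr mulr0 subr0 -subr_gt0 curvature_gap.
  by rewrite divr_gt0// mulr_gt0// exprn_gt0.
(* both slopes agree at 0 and at a, so the tail of the left piece meets invroot between *)
have [xm /andP[xm0 xma] gm] : exists2 xm, 0 < xm < a & gap xm < 0.
  have [|xm xmI E] := mean_value a0 (f := fun x => dleft_arc x - dmix lam x)
      (df := fun x => (qa - m0 * (x - a))^-1 ^+ 2 - ddmix lam x).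
    move=> y /andP[_ ya]; have y1' : y <= 1 by rewrite ltW// (le_lt_trans ya).
    have ? := is_derive_dmix p s lam y; have ? := is_derive_dleft_arc y1'.
    exact: is_derive_eq.
  exists xm => //; case/andP: xmI => xm0 xma.
  have xm1 : xm < 1 by exact: lt_trans a1.
  have d0 : dmix lam 0 = 0.
    have n0 n : (2 < n)%N -> (0 : R) ^+ n.-1 = 0 by case: n => [|[|n]] //= _; rewrite expr0n.
    by rewrite /dmix !n0 ?mulr0 ?addr0// (ltn_trans p_gt2).
  move: E; rewrite dleft_arcE ?(ltW a1)// darc_start subrr /dleft_arc mulr0 mul0r !mulr0.
  rewrite d0 !subr0 => /esym/eqP; rewrite mulf_eq0 (gt_eqF a0) orbF subr_eq0 => /eqP E.
  rewrite gap_lt0 ?xm0 ?(ltW xm1)// -E inv_sqr_lt ?right_tail_gt0 ?left_tail_gt0 ?(ltW xm1)//.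
  rewrite ltrD2l ltrN2 -subr_gt0 -mulrBl nmulr_lgt0 ?subr_lt0 ?slope_lt//.
have dG u v : 0 < u -> forall y, u <= y <= v -> is_derive y 1 gap (dgap y).
  by move=> u0 y /andP[uy _]; apply: is_derive_gap; exact: lt_le_trans uy.
have ddG u v : 0 < u -> forall y, u <= y <= v -> is_derive y 1 dgap (ddinvroot p s lam y).
  by move=> u0 y /andP[uy _]; apply: is_derive_dgap; exact: lt_le_trans uy.
have y10 : 0 < y1 by exact: lt_trans ay1.
have y20 : 0 < y2 by exact: lt_trans y12.
have [t0 /andP[xmt0 t0a] dt0] := rise_derive xma (dG _ _ xm0) (lt_trans gm ga).
have [t1 /andP[at1 t1y] dt1] := fall_derive ay1 (dG _ _ a0) (lt_trans g1 ga).
have [t2 /andP[yt2 t2y] dt2] := rise_derive y12 (dG _ _ y10) (lt_trans g1 g2).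
have [t3 /andP[yt3 t3y] dt3] := fall_derive y23 (dG _ _ y20) (lt_trans g3 g2).
have t00 : 0 < t0 by exact: lt_trans xmt0.
have t10 : 0 < t1 by exact: lt_trans at1.
have t20 : 0 < t2 by exact: lt_trans yt2.
have [s1 /andP[u1 v1] ds1] := fall_derive (lt_trans t0a at1) (ddG _ _ t00) (lt_trans dt1 dt0).
have [s2 /andP[u2 v2] ds2] := rise_derive (lt_trans t1y yt2) (ddG _ _ t10) (lt_trans dt1 dt2).
have [s3 /andP[u3 v3] ds3] := fall_derive (lt_trans t2y yt3) (ddG _ _ t20) (lt_trans dt3 dt2).
have s10 : 0 < s1 by exact: lt_trans u1.
have s20 : 0 < s2 by exact: lt_trans u2.
have s30 : 0 < s3 by exact: lt_trans u3.
have w12 : weight lam s2 < weight lam s1 by apply: weight_decr => //; exact: lt_trans u2.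
have w23 : weight lam s3 < weight lam s2 by apply: weight_decr => //; exact: lt_trans u3.
move: ds1 ds2 ds3; rewrite !ddinvroot_lt0// ddinvroot_gt0// => ds1 ds2 ds3.
have := Sconv _ _ _ _ ds3 ds1 => /(_ (weight lam s2)).
by rewrite w12 w23 => /(_ isT); rewrite leNgt ds2.
Qed.

Lemma two_step : (forall x, 0 < x <= a -> mix lam x <= left_arc lam a k x) ->
  (forall x, a <= x <= 1 -> mix lam x <= right_arc lam a k x) ->
  is_kRSB (mix lam) 2.
Proof.
move=> Lge Rge; have m01 := slope_lt.
have tailL x : q1 + m1 * (1 - a) + m0 * (a - x) = qa - m0 * (x - a).
  by rewrite -right_tailE; ring.
have L0 : left_arc lam a k 0 = mix lam 0.
  by rewrite /left_arc !mulr0 logser0 mulr0 mixture0.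
have -> : 2%N = (m0 < m1)%R.+1 by rewrite m01.
apply: (@step_kRSB R a m0 m1 q1 a01 slope0_gt0 (ltW m01) tail1_gt0 (mix lam) (dmix lam)
  (is_derive_mix p s lam) (@continuous_dmix R p s lam) _
  (left_arc lam a k) (right_arc lam a k) dleft_arc (darc B qa m1 a)).
- by move=> x /andP[x0 _]; exact: dmix_ge0.
- by move=> x /andP[_ xa]; apply: is_derive_left_arc; rewrite (le_trans xa)// ltW.
- by move=> x /andP[_]; exact: is_derive_right_arc.
- move=> x /andP[_ xa]; rewrite tailL; apply: is_derive_dleft_arc.
  by rewrite (le_trans xa)// ltW.
- by move=> x /andP[_]; rewrite -right_tailE; exact: is_derive_dright_arc.
- by rewrite /dleft_arc mulr0 mul0r !mulr0.
- by rewrite dleft_arcE ?(ltW a1)// !darc_start.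
- exact: dright_end.
- exact: L0.
- by rewrite left_arc_end /right_arc arc_start.
- by rewrite right_end mixture1.
- by rewrite left_arc_end.
- move=> x /andP[x0 xa]; move: x0; rewrite le_eqVlt => /predU1P[<-|x0]; first by rewrite L0.
  by apply: Lge; rewrite x0.
- exact: Rge.
Qed.

End TwoStepCandidate.

(** * Closing up the two-slope candidate *)

Section TwoStepExistence.
Context {R : realType}.
Variables p s : nat.
Hypotheses (p_gt2 : (2 < p)%N) (p_lt_s : (p < s)%N).
Implicit Types t x y : R.

Notation mix := (@mixture R p s).
Notation dmix := (@dmix R p s).
Notation pr := (p%:R : R).
Notation sr := (s%:R : R).
Notation mexp := (@mexp R p s).
Notation weight := (@weight R p s).
Notation curvps := (@curv R pr sr).

Let pr3 : 3 <= pr. Proof. by rewrite ler_nat. Qed.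
Let psr : pr < sr. Proof. by rewrite ltr_nat. Qed.
Let dps : 0 < sr - pr. Proof. by rewrite subr_gt0 ltr_nat. Qed.

Variable lam : R.
Hypothesis l01 : 0 < lam < 1.

Let l01' : 0 <= lam <= 1. Proof. by case/andP: l01 => ? ?; rewrite !ltW. Qed.
Let l0 : 0 < lam. Proof. by case/andP: l01. Qed.
Let l1 : 0 < 1 - lam. Proof. by rewrite subr_gt0; case/andP: l01. Qed.

Lemma mexp_gt x : 0 < x -> pr < mexp lam x.
Proof.
move=> x0; have m0 := mixture_gt0 p s l01' x0.
have : weight lam x < 1.
  by rewrite /weight ltr_pdivrMr// mul1r /mixture ltrDl mulr_gt0// exprn_gt0.
by rewrite /mexp; have := dps; nra.
Qed.

(** The point where the local exponent of the mixture is cratio t, so that the left piece with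
    parameter t is tangent to the mixture there. It is explicit because the share of x^p is a
    homographic function of x^(s - p). *)
Definition contact t : R :=
  expR (ln (lam / (1 - lam) * ((cratio t - pr) / (sr - cratio t))) / (sr - pr)).

Lemma contact_gt0 t : 0 < contact t. Proof. exact: expR_gt0. Qed.

Lemma mexp_contact t : pr < cratio t < sr -> mexp lam (contact t) = cratio t.
Proof.
move=> /andP[c1 c2]; set c := cratio t in c1 c2 *.
have [d1 d2] : 0 < c - pr /\ 0 < sr - c by rewrite !subr_gt0.
pose g := lam / (1 - lam) * ((c - pr) / (sr - c)).
have g0 : 0 < g by apply: mulr_gt0; exact: divr_gt0.
have E : contact t ^+ (s - p) = g.
  rewrite -expRM_natl natrB ?(ltnW p_lt_s)// mulrC divfK ?gt_eqF//.
  by rewrite lnK.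
have x0 := contact_gt0 t.
have s0 : s = (p + (s - p))%N by rewrite subnKC// ltnW.
have Es : contact t ^+ s = contact t ^+ p * g by rewrite {1}s0 exprD E.
rewrite /mexp /weight /mixture Es.
have n1 : lam * contact t ^+ p + (1 - lam) * (contact t ^+ p * g) != 0.
  have xp0 := exprn_gt0 p x0; rewrite gt_eqF//.
  by apply: addr_gt0; apply: mulr_gt0 => //; exact: mulr_gt0.
have xp : contact t ^+ p != 0 by rewrite expf_neq0// gt_eqF.
move: n1; have -> : lam * contact t ^+ p + (1 - lam) * (contact t ^+ p * g)
    = lam * contact t ^+ p * ((sr - pr) / (sr - c)).
  by rewrite /g; field; rewrite !gt_eqF.
move=> _; field.
by rewrite xp !gt_eqF.
Qed.

Lemma continuous_contact t : 0 < t < 1 -> pr < cratio t < sr -> {for t, continuous contact}.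
Proof.
move=> t01 /andP[c1 c2].
have cc : {for t, continuous (@cratio R)} := is_derive_continuous (is_derive_cratio t01).
have [d1 d2] : 0 < cratio t - pr /\ 0 < sr - cratio t by rewrite !subr_gt0.
have g0 : 0 < lam / (1 - lam) * ((cratio t - pr) / (sr - cratio t)).
  by apply: mulr_gt0; exact: divr_gt0.
have cl := is_derive_continuous (is_derive1_ln g0).
apply: continuous_cvg; first exact: is_derive_continuous (is_derive_expR _).
apply: cvgM; last exact: cvg_cst.
apply: continuous_cvg; first exact: cl.
apply: cvgM; first exact: cvg_cst.
apply: cvgM; first by apply: cvgB; [exact: cc|exact: cvg_cst].
apply: cvgV; first by rewrite gt_eqF.
by apply: cvgB; [exact: cvg_cst|exact: cc].
Qed.

Section Continuity.
Variable t : R.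
Hypotheses (t01 : 0 < t < 1) (ct : pr < cratio t < sr) (a1 : contact t < 1).

Let a0 := contact_gt0 t.
Let cx := continuous_contact t01 ct.
Let cR : {for t, continuous (@logser R)}.
Proof. by case/andP: t01 => _ h; exact: is_derive_continuous (is_derive_logser h). Qed.

Let cmix : mix lam (contact x) @[x --> t] --> mix lam (contact t).
Proof.
by apply: continuous_cvg; [exact: is_derive_continuous (is_derive_mix _ _ _ _)|exact: cx].
Qed.

Let cdmix : dmix lam (contact x) @[x --> t] --> dmix lam (contact t).
Proof. by apply: continuous_cvg; [exact: continuous_dmix|exact: cx]. Qed.

Let Rt : logser t != 0. Proof. by rewrite gt_eqF// logser_gt0. Qed.

Lemma continuous_left_end : t < contact t ->
  {for t, continuous (fun t => left_arc p s lam (contact t) t 1)}.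
Proof.
move=> ta; have an : contact t != 0 by rewrite gt_eqF.
apply: cvgM; first by apply: cvgM; [exact: cmix|apply: cvgV; [exact: Rt|exact: cR]].
have k1 : t / contact t * 1 < 1 by rewrite mulr1 ltr_pdivrMr// mul1r.
apply: continuous_cvg; first exact: is_derive_continuous (is_derive_logser k1).
apply: cvgM; last exact: cvg_cst.
by apply: cvgM; [exact: cvg_id|apply: cvgV; [exact: an|exact: cx]].
Qed.

Let ctail : taila p s lam (contact x) x @[x --> t] --> taila p s lam (contact t) t.
Proof.
have tn : t != 0 by case/andP: t01 => h _; rewrite gt_eqF.
have mn : mix lam (contact t) != 0 by rewrite gt_eqF// mixture_gt0.
apply: cvgM; last by apply: cvgV; [exact: tn|exact: cvg_id].
apply: cvgM; last by apply: cvgB; [exact: cvg_cst|exact: cvg_id].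
apply: cvgM; last exact: cx.
apply: continuous_cvg; first exact: sqrt_continuous.
by apply: cvgM; [exact: cR|apply: cvgV; [exact: mn|exact: cmix]].
Qed.

Lemma continuous_right_end : t < contact t -> cratio t = mexp lam (contact t) ->
  0 < slope1 p s lam (contact t) t ->
  {for t, continuous (fun t => right_arc p s lam (contact t) t 1)}.
Proof.
move=> ta E m1; have t0 : 0 < t by case/andP: t01.
have a01 : 0 < contact t < 1 by rewrite a0.
have qa0 := taila_gt0 p s l01 a01 t0 ta.
have q10 := tail1_gt0 p_gt2 p_lt_s l01 a01 t0 ta.
have cB : 0 < dmix lam 1 - dmix lam (contact t).
  by rewrite subr_gt0; apply: dmix_lt.
have la : 1 - contact t != 0 by rewrite gt_eqF// subr_gt0.
have cl : (1 - contact x) @[x --> t] --> 1 - contact t.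
  by apply: cvgB; [exact: cvg_cst|exact: cx].
have cq1 : tail1 p s lam (contact x) x @[x --> t] --> tail1 p s lam (contact t) t.
  apply: cvgM; first exact: cl.
  apply: cvgV; first by rewrite gt_eqF// mulr_gt0.
  by apply: cvgM; [exact: ctail|apply: cvgB; [exact: cvg_cst|exact: cdmix]].
have cm1 : slope1 p s lam (contact x) x @[x --> t] --> slope1 p s lam (contact t) t.
  apply: cvgM; first by apply: cvgB; [exact: ctail|exact: cq1].
  by apply: cvgV; [exact: la|exact: cl].
have u1 : slope1 p s lam (contact t) t * (1 - contact t) / taila p s lam (contact t) t < 1.
  by rewrite ltr_pdivrMr// mul1r /slope1 divfK// ltrBlDr ltrDl.
apply: cvgD.
  by apply: cvgD; [exact: cmix|apply: cvgM; [exact: cdmix|exact: cl]].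
apply: cvgM.
  apply: continuous_cvg; first exact: is_derive_continuous (is_derive_logser u1).
  apply: cvgM; first by apply: cvgM; [exact: cm1|exact: cl].
  by apply: cvgV; [rewrite gt_eqF|exact: ctail].
apply: cvgV; first by rewrite gt_eqF// exprn_gt0.
exact: (cvgM cm1 cm1).
Qed.

End Continuity.

Variables kb ka : R.
Hypotheses (kb_gt0 : 0 < kb) (kb_lt_ka : kb < ka) (ka_lt1 : ka < 1).
Hypothesis curv_left : forall u, 0 < u < kb -> 0 < curvps u.
Hypothesis curv_mid : forall u, kb < u < ka -> curvps u < 0.
Hypothesis curv_right : forall u, ka < u < 1 -> 0 < curvps u.
Hypothesis curv_kb : curvps kb = 0.
Hypothesis Spos : forall w, 0 <= w < crit_weight p s kb -> 0 < Spol pr sr w.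
Hypothesis Sconv : forall w1 w2 w3, w1 < w2 < w3 ->
  Spol pr sr w1 < 0 -> Spol pr sr w3 < 0 -> Spol pr sr w2 <= 0.

(** The family starts at the tangency u of fails_tangent and ends at kb. Let T be the value at 1
    of the left piece continued beyond its contact point: T > 1 at u because the weight fails,
    and T < 1 at kb by mratio_inflection. From the last t1 with T = 1 on, slope0 is below
    slope1, the end value of the candidate is at least T = 1 at t1 and less than 1 at kb, and in
    between it takes the value 1. *)
Lemma two_step_of_failure : fails p s lam -> is_kRSB (mix lam) 2.
Proof.
move=> Fl.
have kb1 : kb < 1 by exact: lt_trans ka_lt1.
have [k [a [/andP[kbk k1] Ek /andP[a0 a1] ta [kab Fa]]]] :=
  fails_tangent p_gt2 p_lt_s kb_gt0 kb_lt_ka ka_lt1 curv_left curv_mid curv_right curv_kb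
    l01' Fl.
have k0 : 0 < k by exact: lt_trans kbk.
pose u := k * a.
have u0 : 0 < u by rewrite mulr_gt0.
have u01 : 0 < u < 1 by rewrite u0 (lt_trans kab).
have Eu : cratio u = mexp lam a by apply/(tilt_eq0 p s l01' a0 u01).
have tI t : u <= t <= kb -> 0 < t < 1.
  by move=> /andP[ut tb]; rewrite (lt_le_trans u0)// (le_lt_trans tb).
have kI : 0 < k < 1 by rewrite k0.
have ct t : u <= t <= kb -> pr < cratio t < sr.
  move=> tub; have /andP[ut tb] := tub; have t01 := tI t tub; apply/andP; split.
    by apply: (lt_le_trans (mexp_gt a0)); rewrite -Eu cratio_leE.
  apply: (@le_lt_trans _ _ (cratio k)).
    by rewrite cratio_leE// (le_trans tb)// ltW.
  by rewrite Ek mexp1 gtrBl mulr_gt0.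
have Et t : u <= t <= kb -> mexp lam (contact t) = cratio t.
  by move=> /ct; exact: mexp_contact.
have at1 t : u <= t <= kb -> contact t < 1.
  move=> tub; rewrite -(mexp_lt p_lt_s l01 (contact_gt0 t) ltr01) Et// -Ek.
  rewrite (cratio_ltE (tI t tub) kI).
  by case/andP: tub => _ tb; exact: le_lt_trans kbk.
have a01t t : u <= t <= kb -> 0 < contact t < 1.
  by move=> tub; rewrite contact_gt0 at1.
have uI : u <= u <= kb by rewrite lexx ltW.
have bI : u <= kb <= kb by rewrite lexx ltW.
have au : contact u = a.
  by apply: (mexp_inj p_lt_s l01 (contact_gt0 u) a0); rewrite Et.
(* along the path the slope t / contact t stays below its initial value k *)
have tk t : u < t <= kb -> t < k * contact t.
  move=> /andP[ut tb]; have tub : u <= t <= kb by rewrite ltW.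
  rewrite ltNge; apply/negP => h.
  have aat : a < contact t.
    by rewrite -(mexp_lt p_lt_s l01 a0 (contact_gt0 t)) Et// -Eu (cratio_ltE u01 (tI t tub)).
  have kt0 : 0 < k * contact t by rewrite mulr_gt0// contact_gt0.
  have t1 : t < 1 by have /andP[] := tI t tub.
  have kt1 : k * contact t < 1 by exact: le_lt_trans t1.
  have : tilt p s lam k a < tilt p s lam k (contact t).
    apply: (tilt_incr l01' a0 aat k0 kt1) => x /andP[ax xc].
    apply: curv_left; apply/andP; split; first by rewrite mulr_gt0// (lt_trans a0).
    by apply: (lt_le_trans _ tb); apply: (lt_le_trans _ h); rewrite ltr_pM2l.
  have kt01 : 0 < k * contact t < 1 by rewrite kt0.
  rewrite ta (tilt_gt0 p s l01' (contact_gt0 t) kt01) Et// (cratio_ltE (tI t tub) kt01).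
  by apply/negP; rewrite -leNgt.
have tk' t : u <= t <= kb -> t <= k * contact t.
  move=> /andP[]; rewrite le_eqVlt => /predU1P[<-|ut] tb; first by rewrite au.
  by rewrite ltW// tk// ut.
have tat t : u <= t <= kb -> t < contact t.
  by move=> tub; apply: (le_lt_trans (tk' t tub)); rewrite gtr_pMl// contact_gt0.
pose T t := left_arc p s lam (contact t) t 1.
have cT t : u <= t <= kb -> {for t, continuous T}.
  by move=> tub; apply: continuous_left_end; [exact: tI|exact: ct|exact: tat].
have Tu : 1 < T u.
  have Ru := logser_gt0 u01.
  rewrite /T /left_arc au mulr1 [u / a]mulfK ?gt_eqF// mulrAC ltr_pdivlMr// mul1r.
  by rewrite mulrC.
have kapk t : u < t <= kb -> 0 < t / contact t < k.
  move=> tub; have /andP[ut tb] := tub.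
  rewrite divr_gt0 ?contact_gt0 ?(lt_trans u0)//=.
  by rewrite ltr_pdivrMr ?contact_gt0// tk.
have Tb : T kb < 1.
  have b0 := contact_gt0 kb; have m0 := mixture_gt0 p s l01' b0.
  have /andP[kp0 kpk] : 0 < kb / contact kb < k by rewrite kapk// kab lexx.
  have kp1 : 0 < kb / contact kb < 1 by rewrite kp0 (lt_trans kpk).
  have E : kb / contact kb * contact kb = kb by rewrite divfK// gt_eqF.
  have t1 : tilt p s lam (kb / contact kb) (contact kb) = 0.
    by apply/tilt_eq0; rewrite // E ?tI// Et.
  have := mratio_inflection kb_gt0 kb_lt_ka ka_lt1 curv_mid curv_right l01' kp1
    (a01t kb bI) E t1.
  rewrite tilt_le0 ?mulr1// -Ek cratio_leE// (ltW kpk) => /(_ isT).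
  rewrite /mratio E mulr1 mixture1 divr1 /T /left_arc mulr1 ltr_pdivlMr// => h.
  by rewrite mulrAC ltr_pdivrMr ?logser_gt0 ?tI// mul1r mulrC.
(* T <= 1 from here on, which keeps the end slope of the left piece below xi'(1) *)
have [t1 [ut1 t1b Tt1 Tafter]] := last_crossing (ltW kab) cT (ltW Tu) Tb.
have {}ut1 : u < t1.
  by rewrite lt_neqAle ut1 andbT; apply/eqP => h; move: Tu; rewrite h Tt1 ltxx.
have tub t : t1 <= t <= kb -> u < t <= kb.
  by move=> /andP[h ->]; rewrite (lt_le_trans ut1).
have tub' t : t1 <= t <= kb -> u <= t <= kb.
  by move=> /tub/andP[/ltW -> ->].
have slope t : t1 <= t <= kb -> dleft_arc p s lam (contact t) t 1 < dmix lam 1.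
  move=> tt; have /andP[kp0 kpk] := kapk t (tub t tt).
  have kp1 : 0 < t / contact t < 1 by rewrite kp0 (lt_trans kpk).
  have Tle : T t <= 1.
    have /andP[] := tt; rewrite le_eqVlt => /predU1P[<-|lt] tb; first by rewrite Tt1.
    by rewrite ltW// Tafter// lt.
  have -> : dleft_arc p s lam (contact t) t 1 = T t * cratio (t / contact t).
    rewrite /dleft_arc /T /left_arc /cratio !mulr1; move: kp1 => kp1.
    have Rk := logser_gt0 kp1; have Rt := logser_gt0 (tI t (tub' t tt)).
    set kp := t / contact t in kp0 kpk kp1 Rk *.
    field; case/andP: kp1 => _ kp1.
    by rewrite (gt_eqF Rk) (gt_eqF Rt) gt_eqF// subr_gt0.
  rewrite dmix1 -Ek; apply: (@le_lt_trans _ _ (cratio (t / contact t))).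
    by rewrite ger_pMl// (lt_trans _ (cratio_gt2 kp1)).
  by rewrite cratio_ltE.
have t0 t : t1 <= t <= kb -> 0 < t by move=> /tub'/tI/andP[].
have m1 t : t1 <= t <= kb -> 0 < slope1 p s lam (contact t) t.
  move=> tt; have tt' := tub' t tt.
  apply: lt_trans (slope_lt p_gt2 p_lt_s l01 (a01t t tt') (t0 t tt) (tat t tt')
    (esym (Et t tt')) (slope t tt)).
  exact: (@slope0_gt0 R p s lam _ _ l01 (a01t t tt') (t0 t tt) (tat t tt')).
pose E t := right_arc p s lam (contact t) t 1.
have cE t : t1 <= t <= kb -> {for t, continuous E}.
  move=> tt; have tt' := tub' t tt.
  by apply: continuous_right_end; rewrite ?tI ?ct ?at1 ?tat ?Et ?m1.
have t1I : t1 <= t1 <= kb by rewrite lexx ltW.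
have bI' : t1 <= kb <= kb by rewrite lexx ltW.
have E1 : 1 <= E t1.
  have tt' := tub' t1 t1I; rewrite -Tt1.
  exact: (left_arc_le_right p_gt2 p_lt_s l01 (a01t t1 tt') (t0 t1 t1I) (tat t1 tt')
    (esym (Et t1 tt')) (slope t1 t1I)).
have Eb : E kb < 1.
  apply: (right_arc_lt1 p_gt2 p_lt_s l01 (a01t kb bI) (t0 kb bI') (tat kb bI)
    (esym (Et kb bI)) (slope kb bI') curv_kb).
  move=> x /andP[ax x1]; have x0 : 0 < x by apply: lt_trans ax; exact: contact_gt0.
  apply: Spos; have /andP[-> _] := weight_bounds p s l01' x0.
  rewrite -(mexp1_lt p_lt_s) mexp_crit_weight// -mexp_weight -Et//.
  by rewrite mexp_lt// contact_gt0.
have Eb1 : E kb <= 1 <= E t1 by rewrite (ltW Eb).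
have [t tt Et1] := intermediate_value (ltW t1b) cE (or_intror Eb1).
have tt' := tub' t tt.
have tb : t < kb.
  by case/andP: tt => _; rewrite le_eqVlt => /predU1P[h|//]; move: Eb; rewrite -h Et1 ltxx.
have cv : 0 < curvps t by apply: curv_left; rewrite t0.
have at0 := contact_gt0 t.
apply: (two_step p_gt2 p_lt_s l01 (a01t t tt') (t0 t tt) (tat t tt') (esym (Et t tt'))
  (slope t tt) Et1).
- move=> x /andP[x0 xa]; have mx := mixture_gt0 p s l01' x0.
  have E' : t / contact t * contact t = t by rewrite divfK// gt_eqF.
  have kp0 : 0 < t / contact t by rewrite divr_gt0// t0.
  have tz : tilt p s lam (t / contact t) (contact t) = 0.
    by apply/tilt_eq0; rewrite // E' ?tI// Et.
  have := tangent_below kb_gt0 kb_lt_ka ka_lt1 curv_left l01' kp0 _ tz.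
  rewrite E' => /(_ x (ltW tb)); rewrite x0 xa => /(_ isT).
  have ma := mixture_gt0 p s l01' at0.
  rewrite /mratio E' ler_pdivrMr// mulrAC ler_pdivlMr// => h.
  by rewrite /left_arc mulrAC ler_pdivlMr ?logser_gt0 ?tI// mulrC [_ * logser _]mulrC.
- exact: (right_arc_ge p_gt2 p_lt_s l01 (a01t t tt') (t0 t tt) (tat t tt') (esym (Et t tt'))
    (slope t tt) Et1 cv Sconv).
Qed.

End TwoStepExistence.

(** * The roots of the two quadratic polynomials *)

Section QuadraticRoots.
Context {R : realType}.

Lemma two_roots_factor (f : R -> R) (A B C r1 r2 : R) :
  (forall x, f x = A * x ^+ 2 + B * x + C) -> two_real_roots f r1 r2 ->
  forall x, f x = A * (x - r1) * (x - r2).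
Proof.
move=> fE [r12 roots] x.
have E1 : f r1 = 0 by apply/roots; left.
have E2 : f r2 = 0 by apply/roots; right.
have d : r1 - r2 != 0 by rewrite subr_eq0 lt_eqF.
have EB : A * (r1 + r2) + B = 0.
  apply: (mulfI d); rewrite mulr0 -[RHS](subrr (f r1)) [in X in _ = _ - X]E1 -E2 !fE; ring.
have BE : B = - A * (r1 + r2) by lra.
have CE : C = A * r1 * r2 by move: E1; rewrite fE BE => ?; lra.
by rewrite fE CE BE; ring.
Qed.

End QuadraticRoots.

Section RootPositions.
Context {R : realType}.
Variables P S : R.
Hypotheses (P_ge3 : 3 <= P) (S_gt : P + 2 <= S) (Delta_gt0 : 0 < Delta_ps P S).

(** The vertex of Qpol is S nn / (2 (S - P) dd), one minus it is P mm / (2 (S - P) dd), and bb is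
    the bracket in Spol. *)
Let nn := 2 * S ^+ 2 - 6 * S + 4 - P ^+ 2 + 3 * P * S - 3 * P.
Let dd := S ^+ 2 - 3 * S + 2 + P ^+ 2 + 3 * P * S - 3 * P.
Let mm := S ^+ 2 - 3 * (P - 1) * S - 2 * (P - 1) * (P - 2).
Let bb := (P - 2) * (P - 3) + (S - 2) * (S - 3) - 3 * (P - 2) * (S - 2).

(** Delta_ps is convex in S and nonpositive at both ends of [P + 2, 5 (P - 1)]. *)
Lemma Delta_gt0_ge : 5 * (P - 1) <= S.
Proof.
have [P3 Sg D] := And3 P_ge3 S_gt Delta_gt0.
rewrite leNgt; apply/negP => S5.
have h1 : 0 <= (S - (P + 2)) * (5 * (P - 1) - S) by rewrite mulr_ge0//; lra.
have h2 : 0 <= (P - 1) * (P - 3) by rewrite mulr_ge0//; lra.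
by move: D; rewrite /Delta_ps; nra.
Qed.

(** In the variables x and y the polynomials below have nonnegative coefficients. *)
Let x := P - 3.
Let y := S - 5 * (P - 1).
Let x0 : 0 <= x. Proof. by rewrite subr_ge0. Qed.
Let y0 : 0 <= y. Proof. by rewrite subr_ge0 Delta_gt0_ge. Qed.

(* splits along the syntactic structure only, so that local definitions stay folded *)
Ltac nonneg := repeat first
  [ assumption
  | match goal with
    | |- is_true (0 <= _ + _) => apply: addr_ge0
    | |- is_true (0 <= _ * _) => apply: mulr_ge0
    | |- is_true (0 <= _ ^+ _) => apply: exprn_ge0
    | |- is_true (0 <= _%:R) => exact: ler0n
    end ].
Ltac nneg := move: (x) (y) x0 y0 => u v u0 v0; nonneg.

Let mm_gt0 : 0 < mm.
Proof.
have -> : mm = 8 * x ^+ 2 + 7 * x * y + y ^+ 2 + 34 * x + 14 * y + 36.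
  by rewrite /mm /y /x; ring.
by apply: ltr_wpDl; [nneg|exact: ltr0Sn].
Qed.

Let nn_gt0 : 0 < nn.
Proof.
have -> : nn = 64 * x ^+ 2 + 23 * x * y + 2 * y ^+ 2 + 236 * x + 43 * y + 216.
  by rewrite /nn /y /x; ring.
by apply: ltr_wpDl; [nneg|exact: ltr0Sn].
Qed.

Let bb_ge0 : 0 <= bb.
Proof.
have -> : bb = 11 * x ^+ 2 + 7 * x * y + y ^+ 2 + 37 * x + 12 * y + 32.
  by rewrite /bb /y /x; ring.
nneg.
Qed.

(** Up to positive factors this is Spol at the vertex of Qpol; it is divisible by Delta_ps. *)
Let vertex_poly_gt0 :
  0 < S * (S - 1) ^+ 2 * (S - 2) * mm ^+ 2 + P * (P - 1) ^+ 2 * (P - 2) * nn ^+ 2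
      - 2 * (P - 1) * (S - 1) * bb * mm * nn.
Proof.
have -> : S * (S - 1) ^+ 2 * (S - 2) * mm ^+ 2 + P * (P - 1) ^+ 2 * (P - 2) * nn ^+ 2
      - 2 * (P - 1) * (S - 1) * bb * mm * nn =
    Delta_ps P S * (S - P) ^+ 2 *
    (191 * x ^+ 4 + 278 * x ^+ 3 * y + 113 * x ^+ 2 * y ^+ 2 + 18 * x * y ^+ 3 + y ^+ 4
    + 1442 * x ^+ 3 + 1570 * x ^+ 2 * y + 426 * x * y ^+ 2 + 34 * y ^+ 3 + 4043 * x ^+ 2
    + 2940 * x * y + 400 * y ^+ 2 + 4980 * x + 1824 * y + 2268).
  by rewrite /Delta_ps /mm /nn /bb /y /x; ring.
have [P3 Sg] := (P_ge3, S_gt).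
apply: mulr_gt0.
  by apply: mulr_gt0; [exact: Delta_gt0|apply: exprn_gt0; rewrite subr_gt0; lra].
by apply: ltr_wpDl; [nneg|exact: ltr0Sn].
Qed.

Let nn_le : 0 <= 8 * mm - nn.
Proof.
have -> : 8 * mm - nn = 33 * x * y + 6 * y ^+ 2 + 36 * x + 69 * y + 72.
  by rewrite /mm /nn /y /x; ring.
nneg.
Qed.

Let bb_le : 0 <= S * (S - 1) * (S - 2) - 8 * (P - 1) * bb.
Proof.
have -> : S * (S - 1) * (S - 2) - 8 * (P - 1) * bb =
    37 * x ^+ 3 + 19 * x ^+ 2 * y + 7 * x * y ^+ 2 + y ^+ 3 + 203 * x ^+ 2 + 62 * x * y
    + 11 * y ^+ 2 + 362 * x + 50 * y + 208 by rewrite /bb /y /x; ring.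
nneg.
Qed.

Let bb_ge : 0 <= (S - 1) * bb - 8 * P * (P - 1) * (P - 2).
Proof.
have -> : (S - 1) * bb - 8 * P * (P - 1) * (P - 2) =
    47 * x ^+ 3 + 46 * x ^+ 2 * y + 12 * x * y ^+ 2 + y ^+ 3 + 236 * x ^+ 2 + 160 * x * y
    + 21 * y ^+ 2 + 405 * x + 140 * y + 240 by rewrite /bb /y /x; ring.
nneg.
Qed.

(** Up to positive factors this is minus the derivative of Spol at the vertex of Qpol. *)
Let vertex_slope_ge0 :
  0 <= S ^+ 2 * (S - 1) ^+ 2 * (S - 2) * mm - P ^+ 2 * (P - 1) ^+ 2 * (P - 2) * nn
       + (P - 1) * (S - 1) * bb * (P * mm - S * nn).
Proof.
have -> : S ^+ 2 * (S - 1) ^+ 2 * (S - 2) * mm - P ^+ 2 * (P - 1) ^+ 2 * (P - 2) * nn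
       + (P - 1) * (S - 1) * bb * (P * mm - S * nn) =
    (8 * mm - nn) * (P ^+ 2 * (P - 1) ^+ 2 * (P - 2) + (P - 1) * (S - 1) * bb * S)
    + mm * (S * (S - 1) * (S * (S - 1) * (S - 2) - 8 * (P - 1) * bb)
            + P * (P - 1) * ((S - 1) * bb - 8 * P * (P - 1) * (P - 2))) by ring.
have [P3 Sg] := (P_ge3, S_gt).
have [P0 P1 P2] : [/\ 0 <= P, 0 <= P - 1 & 0 <= P - 2] by split; lra.
have [S0 S1] : 0 <= S /\ 0 <= S - 1 by split; lra.
have m0 := ltW mm_gt0.
nonneg.
Qed.

Let s0 := S ^+ 3 * (S - 1) ^+ 2 * (S - 2).
Let s2 := P ^+ 3 * (P - 1) ^+ 2 * (P - 2).
Let sb := P * (P - 1) * S * (S - 1) * bb.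

Let SpolE z : Spol P S z = (s0 + s2 + 2 * sb) * z ^+ 2 + (- 2 * s0 - 2 * sb) * z + s0.
Proof. by rewrite /Spol /s0 /s2 /sb /bb; ring. Qed.

Let lead_gt0 : 0 < s0 + s2 + 2 * sb.
Proof.
have [P3 Sg] := (P_ge3, S_gt).
have [P0 P1 P2] : [/\ 0 <= P, 0 <= P - 1 & 0 <= P - 2] by split; lra.
have [S0 S1 S2] : [/\ 0 < S, 0 < S - 1 & 0 < S - 2] by split; lra.
have pos0 : 0 < s0.
  by apply: mulr_gt0; [apply: mulr_gt0; exact: exprn_gt0|].
have pos2 : 0 <= s2 by rewrite /s2; nonneg.
have posb : 0 <= sb by move: (ltW S0) (ltW S1) => S0' S1'; rewrite /sb; nonneg.
by lra.
Qed.

Variables r1 r2 : R.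
Hypothesis roots : two_real_roots (Spol P S) r1 r2.

Let factor z : Spol P S z = (s0 + s2 + 2 * sb) * ((z - r1) * (z - r2)).
Proof. by rewrite mulrA (two_roots_factor SpolE roots). Qed.
Let r12 : r1 < r2. Proof. by case: roots. Qed.

Lemma Spol_gt0 w : w < r1 -> 0 < Spol P S w.
Proof.
have h := r12; move=> w1; rewrite factor (pmulr_rgt0 _ lead_gt0).
by rewrite nmulr_rgt0 subr_lt0//; lra.
Qed.

Lemma Spol_convex w1 w2 w3 : w1 < w2 < w3 ->
  Spol P S w1 < 0 -> Spol P S w3 < 0 -> Spol P S w2 <= 0.
Proof.
have h := r12.
rewrite !factor !(pmulr_rlt0 _ lead_gt0) (pmulr_rle0 _ lead_gt0) => /andP[w12 w23] n1 n3.
have h1 : r1 < w1 by rewrite ltNge; apply/negP => ?; nra.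
have h3 : w3 < r2 by rewrite ltNge; apply/negP => ?; nra.
by nra.
Qed.

Variables q1 q2 : R.
Hypothesis Qroots : two_real_roots (Qpol P S) q1 q2.

(** The vertex of Qpol is to the left of both roots of Spol, because Spol is positive and
    nonincreasing there. *)
Lemma Q_root_position : [/\ 0 < q1, q1 < 1 & q1 < r1].
Proof.
have [P3 Sg] := (P_ge3, S_gt).
have QE z : Qpol P S z = (S - P) ^+ 2 * dd * z ^+ 2 + (- S * (S - P) * nn) * z
    + S ^+ 2 * (S - 1) * (S - 2) by rewrite /Qpol /dd /nn; ring.
have Qf := two_roots_factor QE Qroots; have [q12 _] := Qroots.
have dE : 2 * (S - P) * dd = S * nn + P * mm by rewrite /dd /nn /mm; ring.
have [m0 n0] := (mm_gt0, nn_gt0).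
have SP0 : 0 < S - P by lra.
have S0 : 0 < S by lra.
have P0 : 0 < P by lra.
have d0 : 0 < dd.
  have : 0 < 2 * (S - P) * dd by rewrite dE; apply: addr_gt0; exact: mulr_gt0.
  by rewrite pmulr_rgt0// mulr_gt0.
have prod : (S - P) ^+ 2 * dd * (q1 * q2) = S ^+ 2 * (S - 1) * (S - 2).
  by have := Qf 0; rewrite QE; lra.
have sum : (S - P) * dd * (q1 + q2) = S * nn.
  have SPn : S - P != 0 by rewrite gt_eqF.
  apply: (mulfI SPn).
  by have := Qf 1; have := Qf 0; rewrite !QE; lra.
pose v := (q1 + q2) / 2.
have vE : 2 * (S - P) * dd * v = S * nn by rewrite -sum /v; field.
have D0 : 0 < 2 * (S - P) * dd by apply: mulr_gt0 => //; exact: mulr_gt0.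
have Sn0 : 0 < S * nn by rewrite mulr_gt0.
have Pm0 : 0 < P * mm by rewrite mulr_gt0.
have v0 : 0 < v by rewrite -(pmulr_rgt0 _ D0) vE.
have v1 : v < 1 by rewrite -(ltr_pM2l D0) vE dE mulr1 ltrDl.
have q1v : q1 < v by rewrite /v; lra.
have q10 : 0 < q1.
  have : 0 < q1 * q2.
    have D1 : 0 < (S - P) ^+ 2 * dd by apply: mulr_gt0 => //; exact: exprn_gt0.
    rewrite -(pmulr_rgt0 (q1 * q2) D1) prod.
    by apply: mulr_gt0; [apply: mulr_gt0; [exact: exprn_gt0|]|]; lra.
  by move: v0; rewrite /v => ? ?; nra.
split => //; first exact: lt_trans v1.
apply: (lt_trans q1v).
have Dn : 2 * (S - P) * dd != 0 by rewrite gt_eqF.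
have Sv : 0 < Spol P S v.
  have -> : Spol P S v = P ^+ 2 * S ^+ 2 / (2 * (S - P) * dd) ^+ 2 *
      (S * (S - 1) ^+ 2 * (S - 2) * mm ^+ 2 + P * (P - 1) ^+ 2 * (P - 2) * nn ^+ 2
      - 2 * (P - 1) * (S - 1) * bb * mm * nn).
    have -> : v = S * nn / (2 * (S - P) * dd) by rewrite -vE mulrAC divff// mul1r.
    rewrite dE /Spol /bb; field.
    by rewrite gt_eqF// addr_gt0.
  apply: mulr_gt0; last exact: vertex_poly_gt0.
  by apply: divr_gt0; [apply: mulr_gt0|]; exact: exprn_gt0.
have dSv : (s0 + s2 + 2 * sb) * (2 * v - r1 - r2) <= 0.
  have rsum : (s0 + s2 + 2 * sb) * (r1 + r2) = 2 * s0 + 2 * sb.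
    by have := factor 1; have := factor 0; rewrite !SpolE; lra.
  have -> : (s0 + s2 + 2 * sb) * (2 * v - r1 - r2) =
      - (2 * P * S / (2 * (S - P) * dd) *
       (S ^+ 2 * (S - 1) ^+ 2 * (S - 2) * mm - P ^+ 2 * (P - 1) ^+ 2 * (P - 2) * nn
       + (P - 1) * (S - 1) * bb * (P * mm - S * nn))).
    have -> : (s0 + s2 + 2 * sb) * (2 * v - r1 - r2) =
      2 * (s0 + s2 + 2 * sb) * v - (2 * s0 + 2 * sb) by rewrite -rsum; ring.
    have -> : v = S * nn / (2 * (S - P) * dd) by rewrite -vE mulrAC divff// mul1r.
    rewrite dE /s0 /s2 /sb; field.
    by rewrite gt_eqF// addr_gt0.
  rewrite oppr_le0; apply: mulr_ge0; last exact: vertex_slope_ge0.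
  by apply: divr_ge0; last exact: ltW; apply: mulr_ge0; [apply: mulr_ge0|]; rewrite ?ltW.
have h := r12; move: Sv dSv.
rewrite factor (pmulr_rgt0 _ lead_gt0) (pmulr_rle0 _ lead_gt0) => Sv dSv.
by rewrite ltNge; apply/negP => ?; nra.
Qed.

End RootPositions.

(** * The sign of Psi and the phase diagram *)

Section PsiSign.
Context {R : realType}.
Variables p s : nat.
Hypotheses (p_gt2 : (2 < p)%N) (p_lt_s : (p < s)%N).

Notation mix := (@mixture R p s).
Notation pr := (p%:R : R).
Notation sr := (s%:R : R).
Notation mexp := (@mexp R p s).

Let pr3 : 3 <= pr. Proof. by rewrite ler_nat. Qed.
Let psr : pr < sr. Proof. by rewrite ltr_nat. Qed.

Lemma derive1_mixture lam : derive1 (mix lam) = dmix p s lam.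
Proof.
by apply/funext => x; rewrite derive1E; have ? := is_derive_mix p s lam x; apply: derive_val.
Qed.

Lemma derive1n2_mixture lam : derive1n 2 (mix lam) = ddmix p s lam.
Proof.
apply/funext => x; rewrite /derive1n/= derive1_mixture derive1E.
by have ? := is_derive_dmix p s lam x; apply: derive_val.
Qed.

(** With w = xi''(1) / xi'(1), Psi is a positive multiple of cratio (1 - 1 / w) - xi'(1), so its
    sign compares k with 1 - 1 / w; that of curv k does the same. *)
Lemma Psi_gt0 lam k : 0 <= lam <= 1 -> 0 < k < 1 -> cratio k = mexp lam 1 ->
  (0 < Psi p s lam) = (curv pr sr k < 0).
Proof.
move=> l01 k01 E; have [P3 PS] := (pr3, psr).
have /andP[l0 l1] := l01; have /andP[k0 k1] := k01.
have cE : mexp lam 1 = pr * lam + sr * (1 - lam) by rewrite mexp1; ring.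
rewrite /Psi derive1_mixture derive1n2_mixture dmix1.
set c := mexp lam 1 in E cE *.
have DE : ddmix p s lam 1 = (sr + pr - 1) * c - sr * pr.
  by rewrite ddmixE// /euler2 !expr1n cE; field.
set D := ddmix p s lam 1 in DE *.
have c0 : 0 < c by rewrite cE; nra.
have cD : c < D.
  rewrite -subr_gt0.
  have -> : D - c = lam * (pr * (pr - 2)) + (1 - lam) * (sr * (sr - 2)).
    by rewrite DE cE; ring.
  have hp : 0 < pr * (pr - 2) by rewrite mulr_gt0//; lra.
  have hs : pr * (pr - 2) <= sr * (sr - 2) by nra.
  have : 0 <= (1 - lam) * (sr * (sr - 2) - pr * (pr - 2)) by rewrite mulr_ge0 ?subr_ge0.
  by lra.
have D0 : 0 < D by exact: lt_trans cD.
have kw01 : 0 < 1 - c / D < 1.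
  by rewrite subr_gt0 ltr_pdivrMr// mul1r cD ltrBlDr ltrDl divr_gt0.
have Lw : logser (1 - c / D) = ln (D / c) - (1 - c / D).
  rewrite /logser; have -> : 1 - (1 - c / D) = (D / c)^-1 by rewrite invf_div; ring.
  by rewrite lnV ?opprK// posrE divr_gt0.
have PsiE : - ((c - 1) / D) - ln (D / c) + 1 - 2 / c + D / c ^+ 2 =
    logser (1 - c / D) / c * (cratio (1 - c / D) - c).
  have Ln : ln (D / c) - (1 - c / D) != 0 by rewrite -Lw gt_eqF// logser_gt0.
  rewrite /cratio Lw; set L := ln (D / c) in Ln *.
  move: Ln; have -> : L - (1 - c / D) = (L * D - D + c) / D by field; rewrite gt_eqF.
  rewrite mulf_eq0 invr_eq0 (gt_eqF D0) orbF => Ln.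
  have Dc : D - (D - c) != 0 by rewrite subKr gt_eqF.
  by field; rewrite (gt_eqF D0) Ln Dc.
rewrite PsiE pmulr_rgt0 ?divr_gt0 ?logser_gt0// subr_gt0 -[X in X < _]E (cratio_ltE k01 kw01).
have Rk := logser_gt0 k01; have k1' : 0 < 1 - k by rewrite subr_gt0.
rewrite curvE// pmulr_rlt0// E.
have -> : c * (1 + (1 - k)^-1) - (sr + pr) * c + sr * pr = c / (1 - k) - D.
  by rewrite DE; ring.
rewrite subr_lt0 ltr_pdivrMr// [D * _]mulrC -ltr_pdivrMr//; lra.
Qed.

End PsiSign.

Theorem theorem3 (R : realType) (p s : nat)
    (lam1 lam2 lam21F lam21F' : R) :
  (p < s - 1)%N -> (2 < p)%N ->
  0 < Delta_ps p%:R s%:R :> R ->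
  two_real_roots (Qpol p%:R s%:R) lam1 lam2 ->
  two_real_roots (Spol p%:R s%:R) lam21F lam21F' ->
  0 < Psi p s lam1 ->
  Psi p s lam21F <= 0 ->
  exists lam12 lam21 : R,
    [/\ 0 < lam12, lam12 < lam21, lam21 < 1,
        forall lam : R, lam \in `[0, lam12] \/ lam \in `[lam21, 1] ->
          is_kRSB (mixture p s lam) 1 &
        forall lam : R, lam \in `]lam12, lam21[ ->
          is_kRSB (mixture p s lam) 2].
Proof.
move=> ps p2 Delta0 Qroots Sroots Psi1 PsiF.
have p_lt_s : (p < s)%N by apply: leq_trans ps _; exact: leq_subr.
have P3 : 3 <= p%:R :> R by rewrite ler_nat.
have PS : p%:R < s%:R :> R by rewrite ltr_nat.
have PS2 : p%:R + 2 <= s%:R :> R by rewrite -natrD ler_nat addn2; move: ps; rewrite ltn_subRL add1n.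
have [l10 l11 l1F] := Q_root_position P3 PS2 Delta0 Sroots Qroots.
have l1I : 0 <= lam1 <= 1 by rewrite !ltW.
have [k k01 Ek] := mexp_surj p2 p_lt_s l1I ltr01.
have ck : curv (p%:R : R) s%:R k < 0 by rewrite -(Psi_gt0 p2 p_lt_s l1I k01 Ek).
have [kb [ka [kb0 kbk kka ka1 [cl cm cr [cb _]]]]] := curv_pattern P3 PS k01 ck.
have kba : kb < ka by exact: lt_trans kka.
have l1I' : 0 < lam1 < 1 by rewrite l10.
have kI : kb < k < ka by rewrite kbk.
have [lam12 [l120 l12l1 l1b nf ff]] :=
  failure_interval p2 p_lt_s kb0 kba ka1 cl cm cr cb l1I' k01 Ek kI.
have /andP[b0 b1] := crit_weight01 p_lt_s kb0 kba ka1 cb.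
(* at lam21F the parameter k is below its value at lam1, so that curv k >= 0 forces k <= kb *)
have bF : crit_weight p s kb <= lam21F.
  have [F1|F1] := leP 1 lam21F; first by rewrite ltW// (lt_le_trans b1).
  have FI : 0 <= lam21F <= 1 by rewrite !ltW// (lt_trans l10).
  have [kF kF01 EF] := mexp_surj p2 p_lt_s FI ltr01.
  have cF : 0 <= curv (p%:R : R) s%:R kF.
    by rewrite leNgt -(Psi_gt0 p2 p_lt_s FI kF01 EF) -leNgt.
  have kFk : kF < k by rewrite -cratio_ltE// EF Ek mexp1_lt.
  have kFb : kF <= kb.
    rewrite leNgt; apply/negP => h; move: cF; apply/negP; rewrite -ltNge.
    by apply: cm; rewrite h (lt_trans kFk).
  have kb01 : 0 < kb < 1 by rewrite kb0 (lt_trans kba).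
  by rewrite -(mexp1_le p_lt_s) -EF mexp_crit_weight// cratio_leE.
have l12b : lam12 < crit_weight p s kb by exact: lt_trans l1b.
exists lam12, (crit_weight p s kb); split => //.
- move=> lam H; have lI : 0 <= lam <= 1.
    by case: H; rewrite in_itv/= => /andP[h1 h2]; apply/andP; split; lra.
  apply: (one_step p2 p_lt_s lI); apply: nf => //.
  by case: H; rewrite in_itv/= => /andP[h1 h2]; [left|right].
- move=> lam; rewrite in_itv/= => /andP[h1 h2].
  have lI : 0 < lam < 1 by apply/andP; split; lra.
  apply: (two_step_of_failure p2 p_lt_s lI kb0 kba ka1 cl cm cr cb).
  + by move=> w /andP[_ wb]; apply: (Spol_gt0 P3 PS2 Delta0 Sroots); exact: lt_le_trans bF.
  + exact: (Spol_convex P3 PS2 Delta0 Sroots).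
  + by apply: ff; rewrite h1.
Qed.
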